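(* Two MALL proofs are proof-net equivalent if and only if they can be converted into each other by a series of rule commutations.
   Context: MALL is cut-free multiplicative-additive linear logic without units (connectives $\otimes$, par ($⅋$), $\&$, $\oplus$; rules axiom, $\otimes$, par, $\&$, $\oplus_1$, $\oplus_2$, optional mix) extended with the cut rule (from $\Gamma,A$ and $A^\perp,\Delta$ infer $\Gamma,\Delta$). The translation to proof nets goes via the variant MALL$^\ast$, whose formulas additionally include cuts $A\ast A^\perp$ (an unordered, outermost-only cut connective) for cut-free $A$; its rules are those of MALL$^{-}$ except that the cut rule becomes ''from $\Gamma,A$ and $A^\perp,\Delta$ infer $\Gamma,A\ast A^\perp,\Delta$'' and the $\&$-rule becomes ''from $\Omega_1,\Gamma,A$ and $\Omega_2,\Gamma,B$ infer $\Omega_1,\Omega_2,\Gamma,A\&B$'' with $\Omega_i$ disjoint unions of cuts (so cuts in $\Gamma$ are superimposed). A MALL$^\ast$ proof $\Pi$ translates to the linking set $\theta_\Pi=\{\lambda_R\}$ over all $\&$-resolutions $R$ (delete one branch above each $\&$-rule; axioms of $R$ determine, by downward leaf tracking, a linking $\lambda_R$, i.e. a set of pairs of leaves). Each MALL$^\ast$ proof projects to a MALL proof by deleting all cuts. A MALL proof translates to $\theta$ if it is the projection of a MALL$^\ast$ proof translating to $\theta$; a MALL proof may translate to several proof nets. Proof-net equivalence is the smallest equivalence relation on MALL proofs such that proofs with a common translation are equivalent. Rule commutations are transpositions of adjacent rules preserving the subproofs immediately above, with possible duplication/identification; for MALL these are the cut-free commutations together with those of cut over cut, and $\otimes$, $\oplus$,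 par, $\&$ over cut and cut over mix (and their inverses). *)

(* Defs.v *)
From HB Require Import structures.
From Stdlib Require Import Relation_Definitions Relation_Operators.
From mathcomp Require Import all_boot finmap.

Set Implicit Arguments.
Unset Strict Implicit.
Unset Printing Implicit Defensive.

Local Open Scope fset_scope.

(* Propositional variables are natural numbers; [Lit true P] is the variable P
   and [Lit false P] its negation. *)
Inductive form : Type :=
| Lit of bool & nat
| Tensor of form & form
| Parr of form & form
| With of form & form
| Plus of form & form.

Fixpoint dual (A : form) : form :=
  match A with
  | Lit b P => Lit (~~ b) P
  | Tensor A B => Parr (dual A) (dual B)
  | Parr A B => Tensor (dual A) (dual B)
  | With A B => Plus (dual A) (dual B)
  | Plus A B => With (dual A) (dual B)
  end.

Fixpoint form_encode (A : form) : GenTree.tree (bool * nat) :=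
  match A with
  | Lit b P => GenTree.Leaf (b, P)
  | Tensor A B => GenTree.Node 0 [:: form_encode A; form_encode B]
  | Parr A B => GenTree.Node 1 [:: form_encode A; form_encode B]
  | With A B => GenTree.Node 2 [:: form_encode A; form_encode B]
  | Plus A B => GenTree.Node 3 [:: form_encode A; form_encode B]
  end.

Fixpoint form_decode (t : GenTree.tree (bool * nat)) : option form :=
  match t with
  | GenTree.Leaf (b, P) => Some (Lit b P)
  | GenTree.Node k [:: t; u] =>
      match form_decode t, form_decode u with
      | Some A, Some B =>
          match k with
          | 0 => Some (Tensor A B)
          | 1 => Some (Parr A B)
          | 2 => Some (With A B)
          | 3 => Some (Plus A B)
          | _ => None
          end
      | _, _ => None
      end
  | _ => None
  end.

Lemma form_encodeK : pcancel form_encode form_decode.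
Proof. by elim=> //= A -> B ->. Qed.

HB.instance Definition _ := Countable.copy form (pcan_type form_encodeK).

(* Formula occurrences are named by vertices of parse trees, so that the
   downward tracking of occurrences through the rules is explicit: a rule whose
   principal formula is at vertex [a] acts on premise formulas at the children
   of [a].  A vertex is a path (false = left, true = right) from a root.
   [Concl i] is the root of the i-th formula of the conclusion of the whole
   proof; [CutRoot c A] is the root of the branch A of the cut named c, whose
   two branches [A] and [dual A] are told apart by the formula. *)
Inductive root : Type :=
| Concl of nat
| CutRoot of nat & form.

Definition root_encode (r : root) : nat + nat * form :=
  match r with Concl i => inl i | CutRoot c A => inr (c, A) end.

Definition root_decode (s : nat + nat * form) : root :=
  match s with inl i => Concl i | inr (c, A) => CutRoot c A end.

Lemma root_encodeK : cancel root_encode root_decode.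
Proof. by case. Qed.

HB.instance Definition _ := Countable.copy root (can_type root_encodeK).

Definition vertex : Type := (root * seq bool)%type.

Definition child (b : bool) (a : vertex) : vertex := (a.1, rcons a.2 b).

Definition cut_vertex (c : nat) (A : form) : vertex := (CutRoot c A, [::]).

(* Sequents are disjoint unions of occurrences: lists of named formulas with
   distinct names, considered up to reordering. *)
Definition sequent : Type := seq (vertex * form).

Definition is_sequent (G S : sequent) : bool :=
  uniq (unzip1 G) && perm_eq G S.

Definition cut_free_name (c : nat) (G : sequent) : bool :=
  all (fun x => if x.1.1 is CutRoot d _ then d != c else true) G.

Definition conclusion (G : seq form) : sequent :=
  [seq ((Concl p.1, [::]), p.2) | p <- zip (iota 0 (size G)) G].

(* Derivation trees, with each rule labelled by its principal vertex.  They
   serve both MALL and MALL*, which differ in the sequents they assign to a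
   tree.  &-rules are kept apart from the other binary rules because their
   premises share a context. *)
Inductive rule1 : Type :=
| RParr of vertex
| RPlus of bool & vertex.

Inductive rule2 : Type :=
| RTensor of vertex
| RCut of nat & form
| RMix.

Inductive tree : Type :=
| Ax of vertex & vertex
| Rule1 of rule1 & tree
| Rule2 of rule2 & tree & tree
| RWith of vertex & tree & tree.

(* [mall m G t]: t is a MALL derivation of G; the mix rule is available
   exactly when m holds. *)
Inductive mall (m : bool) : sequent -> tree -> Prop :=
| mall_ax T x y P :
    is_sequent T [:: (x, Lit true P); (y, Lit false P)] ->
    mall m T (Ax x y)
| mall_tensor T G D a A B t u :
    mall m ((child false a, A) :: G) t ->
    mall m ((child true a, B) :: D) u ->
    is_sequent T ((a, Tensor A B) :: G ++ D) ->
    mall m T (Rule2 (RTensor a) t u)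
| mall_parr T G a A B t :
    mall m ((child false a, A) :: (child true a, B) :: G) t ->
    is_sequent T ((a, Parr A B) :: G) ->
    mall m T (Rule1 (RParr a) t)
| mall_with T G a A B t u :
    mall m ((child false a, A) :: G) t ->
    mall m ((child true a, B) :: G) u ->
    is_sequent T ((a, With A B) :: G) ->
    mall m T (RWith a t u)
| mall_plus T G a b A B t :
    mall m ((child b a, if b then B else A) :: G) t ->
    is_sequent T ((a, Plus A B) :: G) ->
    mall m T (Rule1 (RPlus b a) t)
| mall_mix T G D t u :
    m ->
    mall m G t ->
    mall m D u ->
    is_sequent T (G ++ D) ->
    mall m T (Rule2 RMix t u)
| mall_cut T G D c A t u :
    mall m ((cut_vertex c A, A) :: G) t ->
    mall m ((cut_vertex c (dual A), dual A) :: D) u ->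
    cut_free_name c T ->
    is_sequent T (G ++ D) ->
    mall m T (Rule2 (RCut c A) t u).

(* The cuts of a MALL* sequent: named unordered pairs {A, dual A}. *)
Definition cuts : Type := seq (nat * {fset form}).

Definition is_cuts (O S : cuts) : bool :=
  uniq (unzip1 O) && perm_eq O S.

(* [star m O G t]: t is a MALL* derivation of the sequent with cuts O and
   remaining formulas G.  Cuts of the two premises of a &-rule with the same
   name (necessarily in O0) are superimposed. *)
Inductive star (m : bool) : cuts -> sequent -> tree -> Prop :=
| star_ax T x y P :
    is_sequent T [:: (x, Lit true P); (y, Lit false P)] ->
    star m [::] T (Ax x y)
| star_tensor O O1 O2 T G D a A B t u :
    star m O1 ((child false a, A) :: G) t ->
    star m O2 ((child true a, B) :: D) u ->
    is_cuts O (O1 ++ O2) ->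
    is_sequent T ((a, Tensor A B) :: G ++ D) ->
    star m O T (Rule2 (RTensor a) t u)
| star_parr O O1 T G a A B t :
    star m O1 ((child false a, A) :: (child true a, B) :: G) t ->
    is_cuts O O1 ->
    is_sequent T ((a, Parr A B) :: G) ->
    star m O T (Rule1 (RParr a) t)
| star_with O O0 O1 O2 T G a A B t u :
    star m (O1 ++ O0) ((child false a, A) :: G) t ->
    star m (O2 ++ O0) ((child true a, B) :: G) u ->
    is_cuts O (O1 ++ O2 ++ O0) ->
    is_sequent T ((a, With A B) :: G) ->
    star m O T (RWith a t u)
| star_plus O O1 T G a b A B t :
    star m O1 ((child b a, if b then B else A) :: G) t ->
    is_cuts O O1 ->
    is_sequent T ((a, Plus A B) :: G) ->
    star m O T (Rule1 (RPlus b a) t)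
| star_mix O O1 O2 T G D t u :
    m ->
    star m O1 G t ->
    star m O2 D u ->
    is_cuts O (O1 ++ O2) ->
    is_sequent T (G ++ D) ->
    star m O T (Rule2 RMix t u)
| star_cut O O1 O2 T G D c A t u :
    star m O1 ((cut_vertex c A, A) :: G) t ->
    star m O2 ((cut_vertex c (dual A), dual A) :: D) u ->
    is_cuts O ((c, [fset A; dual A]) :: O1 ++ O2) ->
    cut_free_name c T ->
    is_sequent T (G ++ D) ->
    star m O T (Rule2 (RCut c A) t u).

Lemma star_mall m O G t : star m O G t -> mall m G t.
Proof. by elim=> *; econstructor; eassumption. Qed.

Definition mall_proof (m : bool) (G : seq form) : Type :=
  {t : tree | mall m (conclusion G) t}.

Definition star_proof (m : bool) (O : cuts) (G : seq form) : Type :=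
  {t : tree | star m O (conclusion G) t}.

(* Deleting the cuts of a MALL* proof affects its sequents only. *)
Definition project m O G (p : star_proof m O G) : mall_proof m G :=
  exist _ (sval p) (star_mall (svalP p)).

Definition swap (c d n : nat) : nat :=
  if n == c then d else if n == d then c else n.

Definition swap_vertex (c d : nat) (a : vertex) : vertex :=
  (if a.1 is CutRoot n A then CutRoot (swap c d n) A else a.1, a.2).

Fixpoint swap_tree (c d : nat) (t : tree) : tree :=
  match t with
  | Ax x y => Ax (swap_vertex c d x) (swap_vertex c d y)
  | Rule1 (RParr a) t => Rule1 (RParr (swap_vertex c d a)) (swap_tree c d t)
  | Rule1 (RPlus b a) t => Rule1 (RPlus b (swap_vertex c d a)) (swap_tree c d t)
  | Rule2 (RTensor a) t u =>
      Rule2 (RTensor (swap_vertex c d a)) (swap_tree c d t) (swap_tree c d u)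
  | Rule2 (RCut n A) t u =>
      Rule2 (RCut (swap c d n) A) (swap_tree c d t) (swap_tree c d u)
  | Rule2 RMix t u => Rule2 RMix (swap_tree c d t) (swap_tree c d u)
  | RWith a t u =>
      RWith (swap_vertex c d a) (swap_tree c d t) (swap_tree c d u)
  end.

(* Differences of notation between trees denoting the same MALL proof: cut
   names are bound in MALL, and the premises of mix and cut are unordered.
   The freshness of d in [ident_rename] is enforced by requiring both trees to
   derive the same sequent. *)
Inductive ident : tree -> tree -> Prop :=
| ident_mix t u : ident (Rule2 RMix t u) (Rule2 RMix u t)
| ident_cut c A t u : ident (Rule2 (RCut c A) t u) (Rule2 (RCut c (dual A)) u t)
| ident_rename c d A t u :
    ident (Rule2 (RCut c A) t u)
          (Rule2 (RCut d A) (swap_tree c d t) (swap_tree c d u)).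

(* Transpositions of adjacent rules.  The provisos of the commutations (e.g.
   that both active formulas of a par below a tensor come from the same premise
   of the tensor) say precisely that both trees derive the same sequent, which
   is required below. *)
Inductive commute : tree -> tree -> Prop :=
| comm_1_1 r s t :
    commute (Rule1 r (Rule1 s t)) (Rule1 s (Rule1 r t))
| comm_1_2l r s t u :
    commute (Rule1 r (Rule2 s t u)) (Rule2 s (Rule1 r t) u)
| comm_1_2r r s t u :
    commute (Rule1 r (Rule2 s t u)) (Rule2 s t (Rule1 r u))
| comm_2_2ll r s t u v :
    commute (Rule2 r (Rule2 s t u) v) (Rule2 s (Rule2 r t v) u)
| comm_2_2lr r s t u v :
    commute (Rule2 r (Rule2 s t u) v) (Rule2 s t (Rule2 r u v))
| comm_2_2rl r s t u v :
    commute (Rule2 r v (Rule2 s t u)) (Rule2 s (Rule2 r v t) u)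
| comm_2_2rr r s t u v :
    commute (Rule2 r v (Rule2 s t u)) (Rule2 s t (Rule2 r v u))
| comm_with_1 a r t u :
    commute (RWith a (Rule1 r t) (Rule1 r u)) (Rule1 r (RWith a t u))
| comm_with_2l a r t u v :
    commute (RWith a (Rule2 r t v) (Rule2 r u v)) (Rule2 r (RWith a t u) v)
| comm_with_2r a r t u v :
    commute (RWith a (Rule2 r v t) (Rule2 r v u)) (Rule2 r v (RWith a t u))
| comm_with_with a b t u v w :
    commute (RWith a (RWith b t u) (RWith b v w))
            (RWith b (RWith a t v) (RWith a u w)).

Inductive in_context (R : tree -> tree -> Prop) : tree -> tree -> Prop :=
| ctx_here t t' : R t t' -> in_context R t t'
| ctx_rule1 r t t' :
    in_context R t t' -> in_context R (Rule1 r t) (Rule1 r t')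
| ctx_rule2l r t t' u :
    in_context R t t' -> in_context R (Rule2 r t u) (Rule2 r t' u)
| ctx_rule2r r t u u' :
    in_context R u u' -> in_context R (Rule2 r t u) (Rule2 r t u')
| ctx_withl a t t' u :
    in_context R t t' -> in_context R (RWith a t u) (RWith a t' u)
| ctx_withr a t u u' :
    in_context R u u' -> in_context R (RWith a t u) (RWith a t u').

(* Equality of trees is included so that the particular proof that a tree is a
   derivation is irrelevant. *)
Definition same_proof m G : relation (mall_proof m G) :=
  clos_refl_sym_trans _
    (fun p q => sval p = sval q \/ in_context ident (sval p) (sval q)).

Definition commutation_step m G : relation (mall_proof m G) :=
  fun p q => in_context commute (sval p) (sval q).

Definition commutation_equiv m G : relation (mall_proof m G) :=
  clos_refl_sym_trans _
    (fun p q => same_proof p q \/ commutation_step p q).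

(* A &-resolution keeps each &-rule, with exactly one of its branches. *)
Inductive resolution : Type :=
| ResAx of vertex & vertex
| ResRule1 of rule1 & resolution
| ResRule2 of rule2 & resolution & resolution
| ResWith of vertex & bool & resolution.

Fixpoint resolutions (t : tree) : seq resolution :=
  match t with
  | Ax x y => [:: ResAx x y]
  | Rule1 r t => [seq ResRule1 r R | R <- resolutions t]
  | Rule2 r t u =>
      [seq ResRule2 r R1 R2 | R1 <- resolutions t, R2 <- resolutions u]
  | RWith a t u =>
      [seq ResWith a false R | R <- resolutions t] ++
      [seq ResWith a true R | R <- resolutions u]
  end.

Definition link : Type := {fset vertex}.
Definition linking : Type := {fset link}.

Fixpoint linking_of (R : resolution) : linking :=
  match R with
  | ResAx x y => [fset [fset x; y]]
  | ResRule1 _ R => linking_of R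
  | ResRule2 _ R1 R2 => linking_of R1 `|` linking_of R2
  | ResWith _ _ R => linking_of R
  end.

Definition linkings (t : tree) : {fset linking} :=
  [fset l in [seq linking_of R | R <- resolutions t]].

(* The proof net of a MALL* proof is its set of linkings together with the
   MALL* sequent, hence with the cuts O, on which they live. *)
Definition translates m G (p : mall_proof m G) (O : cuts)
    (theta : {fset linking}) : Prop :=
  exists q : star_proof m O G,
    same_proof p (project q) /\ linkings (sval q) = theta.

Definition proof_net_equiv m G : relation (mall_proof m G) :=
  clos_refl_sym_trans _
    (fun p q => exists (O : cuts) (theta : {fset linking}),
       translates p O theta /\ translates q O theta).

(* Main.v *)
(* Two star proofs with the same conclusion, cuts included, and the same linkings
   are related by commutations: by induction on size, the last rule of the second
   proof is moved to the bottom of the first. Par, plus and with always permute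
   downwards. For tensor, cut and mix, colour the vertices according to the premise
   of the second proof above which they lie. Every linking then consists of
   monochromatic links, and the two colours of different linkings recombine freely;
   this suffices to rearrange the first proof into a mix of monochromatic proofs,
   and into the given rule with one premise of each colour. The premises have the
   same linkings again.
   Conversely, two proofs that differ by a commutation have representatives that
   name the cuts apart inside each proof but in the same way in both, and hence
   have a common translation. *)

From Stdlib Require Import Relation_Definitions Relation_Operators Permutation.
From mathcomp Require Import all_boot finmap zify.
Require Import Defs.

Set Implicit Arguments.
Unset Strict Implicit.
Unset Printing Implicit Defensive.

Local Open Scope fset_scope.

(* The elements of a conclusion: [inl v] is the formula occurrence at [v], and
   [inr (c, {A, dual A})] is the cut named [c] on [A]. *)
Notation resource := (vertex + nat * {fset form})%type.

(** Contexts are not stored: a conclusion is a Boolean predicate on resources, and the formula at a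
    vertex is computed from [G] and the vertex, so that the validity of a transposition is checked
    one resource at a time. The obstacle to bringing a binary rule down is a with: its two premises
    are rearranged separately, and can only be put back under one rule if their parts of the
    opposite colour are literally the same tree. These are merely known to have the same conclusion
    and the same linkings; that they are convertible is again the statement to be proved, for
    smaller trees, hence the hypothesis [coherent_below] of both rearrangement lemmas. Cuts differ
    from formulas in one respect that recurs throughout: a with may have a cut in one premise only,
    so a linking can miss it. Where a formula is recognised as part of a shared context, a cut has
    to be recognised by a leaf above it. In the converse direction a MALL proof may use one cut name
    in several places, and a commutation may copy a subproof; names are therefore chosen on the
    common subproofs before either side of the commutation is assembled. *)

Definition is_vertex (x : resource) : bool := if x is inl _ then true else false.

Definition cone (x : resource) (w : vertex) : bool :=
  match x with
  | inl v => (v.1 == w.1) && prefix v.2 w.2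
  | inr (c, _) => if w.1 is CutRoot d _ then d == c else false
  end.

Definition subform (b : bool) (A : form) : option form :=
  match A with
  | Lit _ _ => None
  | Tensor A B | Parr A B | With A B | Plus A B => Some (if b then B else A)
  end.

Definition root_form (G : seq form) (r : root) : option form :=
  match r with
  | Concl i => ohead (drop i G)
  | CutRoot _ A => Some A
  end.

(** Once [G] is fixed, the formula is a function of the vertex; a sequent can thus be recovered from
    its set of vertices, as [is_sequentP] does. *)
Definition form_at (G : seq form) (v : vertex) : option form :=
  foldl (fun o b => obind (subform b) o) (root_form G v.1) v.2.

Lemma form_at_child G b a : form_at G (child b a) = obind (subform b) (form_at G a).
Proof. by rewrite /form_at /child /= -cats1 foldl_cat. Qed.

Definition prin1 (r : rule1) : vertex :=
  match r with RParr a | RPlus _ a => a end.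

Definition sub1 (r : rule1) (z : resource) : bool :=
  match r with
  | RParr a => (z == inl (child false a)) || (z == inl (child true a))
  | RPlus b a => z == inl (child b a)
  end.

Definition prin2 (r : rule2) (z : resource) : bool :=
  match r with
  | RTensor a => z == inl a
  | RCut c A => z == inr (c, [fset A; dual A])
  | RMix => false
  end.

Definition sub2 (k : bool) (r : rule2) (z : resource) : bool :=
  match r with
  | RTensor a => z == inl (child k a)
  | RCut c A => z == inl (cut_vertex c (if k then dual A else A))
  | RMix => false
  end.

(* [res t] is the conclusion of [t], including its cuts; [foot t] also collects the
   conclusions of all subtrees. *)
Fixpoint res (t : tree) (z : resource) : bool :=
  match t with
  | Ax x y => (z == inl x) || (z == inl y)
  | Rule1 r t => (z == inl (prin1 r)) || res t z && ~~ sub1 r z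
  | Rule2 r t u =>
      [|| prin2 r z, res t z && ~~ sub2 false r z | res u z && ~~ sub2 true r z]
  | RWith a t u =>
      [|| z == inl a, res t z && (z != inl (child false a))
        | res u z && (z != inl (child true a))]
  end.

Fixpoint foot (t : tree) (z : resource) : bool :=
  match t with
  | Ax x y => (z == inl x) || (z == inl y)
  | Rule1 r t => (z == inl (prin1 r)) || foot t z
  | Rule2 r t u => [|| prin2 r z, foot t z | foot u z]
  | RWith a t u => [|| z == inl a, foot t z | foot u z]
  end.

(** * Pointwise goals as truth tables *)

Lemma addb_eq (a b : bool) : ~~ (a (+) b) -> a = b.
Proof. by case: a b => [] []. Qed.

Definition allb (f : bool -> bool) : bool := f true && f false.
Lemma allbP (f : bool -> bool) : allb f -> forall b, f b.
Proof. by case/andP=> ? ? []. Qed.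

(** Folds the Boolean hypotheses in front of a Boolean goal into implications inside [bool]. After
    that, [batom] generalises one Boolean atom at a time and leaves both of its values to
    computation. *)
Ltac toimp :=
  lazymatch goal with
  | |- is_true _ -> _ =>
      let h := fresh in move=> h; toimp; move: h; apply: (elimT implyP)
  | |- _ => idtac
  end.

Ltac batom b := generalize b; apply allbP.

(** * Validity and adjacent rules *)

Section Validity.
Variables (m : bool) (G : seq form).

Definition form1 (r : rule1) : bool :=
  match r, form_at G (prin1 r) with
  | RParr _, Some (Parr _ _) | RPlus _ _, Some (Plus _ _) => true
  | _, _ => false
  end.

Definition form2 (r : rule2) : bool :=
  match r with
  | RTensor a => if form_at G a is Some (Tensor _ _) then true else false
  | RCut _ _ => true
  | RMix => m
  end.

Definition formW (a : vertex) : bool :=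
  if form_at G a is Some (With _ _) then true else false.

Definition form0 (x y : vertex) : bool :=
  match form_at G x, form_at G y with
  | Some (Lit true P), Some (Lit false Q) => P == Q
  | _, _ => false
  end.

(* Validity of a star proof, with its conclusion seen as a set. All conditions are
   Boolean implications at a single resource (hence [(+)] instead of an equality),
   so that preservation by commutations is decided by truth tables. *)
Fixpoint ok (t : tree) : Prop :=
  match t with
  | Ax x y => form0 x y
  | Rule1 r t =>
      ok t /\ form1 r /\ (forall z, sub1 r z -> res t z) /\
      (forall z, z == inl (prin1 r) -> ~~ foot t z)
  | Rule2 r t u =>
      ok t /\ ok u /\ form2 r /\
      (forall z, sub2 false r z -> res t z) /\
      (forall z, sub2 true r z -> res u z) /\
      (forall z, prin2 r z -> ~~ foot t z) /\
      (forall z, prin2 r z -> ~~ foot u z) /\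
      (forall z, foot t z -> ~~ foot u z)
  | RWith a t u =>
      ok t /\ ok u /\ formW a /\
      (forall z, z == inl (child false a) -> res t z) /\
      (forall z, z == inl (child true a) -> res u z) /\
      (forall z, z == inl a -> ~~ foot t z) /\
      (forall z, z == inl a -> ~~ foot u z) /\
      (forall z, is_vertex z ->
         ~~ ((res t z && (z != inl (child false a))) (+) (res u z && (z != inl (child true a)))))
  end.

Lemma res_foot t z : res t z -> foot t z.
Proof.
elim: t => //= [r t IH|r t IHt u IHu|a t IHt u IHu].
- by case/orP=> [->//|/andP[/IH-> _]]; rewrite orbT.
- by case/or3P=> [->//|/andP[/IHt-> _]|/andP[/IHu-> _]]; rewrite !orbT.
- by case/or3P=> [->//|/andP[/IHt-> _]|/andP[/IHu-> _]]; rewrite !orbT.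
Qed.

(* [x] is the premise in which a transformation takes place, on either side. *)
Definition side (k : bool) (r : rule2) (x y : tree) : tree :=
  if k then Rule2 r y x else Rule2 r x y.

Lemma ok_side k r x y :
  ok (side k r x y) <->
  ok x /\ ok y /\ form2 r /\
      (forall z, sub2 k r z -> res x z) /\
      (forall z, sub2 (~~ k) r z -> res y z) /\
      (forall z, prin2 r z -> ~~ foot x z) /\
      (forall z, prin2 r z -> ~~ foot y z) /\
      (forall z, foot x z -> ~~ foot y z).
Proof.
case: k => //=; split; case=> ? [? [? [? [? [? [? H]]]]]]; do !split=> //;
  by move=> z h; apply/negP => /H; rewrite h.
Qed.

Lemma res_side k r x y z :
  res (side k r x y) z =
  [|| prin2 r z, res x z && ~~ sub2 k r z | res y z && ~~ sub2 (~~ k) r z].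
Proof. by case: k => //=; congr orb; rewrite orbC. Qed.

Lemma foot_side k r x y z :
  foot (side k r x y) z = [|| prin2 r z, foot x z | foot y z].
Proof. by case: k => //=; congr orb; rewrite orbC. Qed.

(** Used under [ok t]: then [t] may be replaced by [u] below any rules, since the validity of these
    depends on the premises only through [ok], [res] and [foot]. *)
Definition same t u := ok u /\ res t =1 res u /\ foot t =1 foot u.

Ltac destr := repeat match goal with H : _ /\ _ |- _ => destruct H end.

Ltac inst z :=
  repeat match goal with
  | H : forall _ : (_ + _)%type, is_true _ -> is_true _ |- _ => move: (introT implyP (H z)); clear H
  | H : forall _ : (_ + _)%type, _ = _ |- _ => rewrite ?(H z); clear H
  end; toimp.

Ltac batoms :=
  repeat match goal with
  | |- context [res ?t ?z] => is_var t; batom (res t z)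
  | |- context [foot ?t ?z] => is_var t; batom (foot t z)
  | |- context [sub1 ?t ?z] => batom (sub1 t z)
  | |- context [sub2 ?k ?t ?z] => batom (sub2 k t z)
  | |- context [prin2 ?t ?z] => batom (prin2 t z)
  | |- context [is_vertex ?z] => batom (is_vertex z)
  | |- context [?x == ?y] => batom (x == y)
  end; cbv beta delta [implb andb orb negb addb]; vm_compute; reflexivity.

(** Once the hypotheses are instantiated at [z], the only fact about the subtrees that has to be
    supplied is [res_foot]; a truth table does the rest. *)
Ltac bsolve z :=
  repeat match goal with
  | t : tree |- _ =>
    lazymatch goal with
    | _ : forall x, is_true (res t x) -> is_true (foot t x) |- _ => fail
    | |- _ => have := @res_foot t; move=> ?
    end
  end;
  try apply: addb_eq; inst z; rewrite ?res_side ?foot_side /=; batoms.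

Lemma sub1_vertex r z : sub1 r z -> is_vertex z.
Proof. by case: r => [a|b a] /=; [case/orP|]; move/eqP->. Qed.

Lemma sub2_vertex k r z : sub2 k r z -> is_vertex z.
Proof. by case: r => [a|c A|] //= /eqP->. Qed.

Lemma eq_vertex v (z : resource) : z == inl v -> is_vertex z.
Proof. by move/eqP->. Qed.

Lemma child_neq a (z : resource) : z == inl (child false a) -> z != inl (child true a).
Proof.
move/eqP->; apply/eqP => -[] /(congr1 (last true)).
by rewrite !last_rcons.
Qed.

Ltac vertex_facts :=
  repeat match goal with
  | r : rule1 |- _ =>
    lazymatch goal with
    | _ : forall x, is_true (sub1 r x) -> is_true (is_vertex x) |- _ => fail
    | |- _ => have := @sub1_vertex r; move=> ?
    end
  | _ : context [sub2 ?k ?r] |- _ =>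
    lazymatch goal with
    | _ : forall x, is_true (sub2 k r x) -> is_true (is_vertex x) |- _ => fail
    | |- _ => have := @sub2_vertex k r; move=> ?
    end
  | a : vertex |- _ =>
    lazymatch goal with
    | _ : forall x, is_true (x == inl a) -> is_true (is_vertex x) |- _ => fail
    | |- _ => have := @eq_vertex a; have := @eq_vertex (child false a);
             have := @eq_vertex (child true a); have := @child_neq a; move=> ? ? ? ?
    end
  end.

Ltac swap_tac :=
  rewrite /same /=; intros;
  repeat (rewrite -> ok_side in * || simpl in *; destr);
  rewrite ?ok_side /=; do ?split=> //;
  match goal with
  | |- forall z : _, _ => let z := fresh "z" in move=> z; vertex_facts; bsolve z
  | |- _ =1 _ => let z := fresh "z" in move=> z; vertex_facts; bsolve z
  end.

(** The extra hypothesis in this and the following lemmas is the proviso of the commutation: either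
    the active formulas of the rule moving up are present in the premise it moves to, or the
    principal formula of the rule moving down is not active in the rule it passes. *)
Lemma swap11 r s t : ok (Rule1 r (Rule1 s t)) -> (forall z, sub1 r z -> res t z) ->
  same (Rule1 r (Rule1 s t)) (Rule1 s (Rule1 r t)).
Proof. by swap_tac. Qed.

Lemma swap12A k r s x y : ok (side k s (Rule1 r x) y) ->
  (forall z, z == inl (prin1 r) -> ~~ sub2 k s z) ->
  same (side k s (Rule1 r x) y) (Rule1 r (side k s x y)).
Proof. by swap_tac. Qed.

Lemma swap12B k r s x y : ok (Rule1 r (side k s x y)) ->
  (forall z, sub1 r z -> res x z) ->
  same (Rule1 r (side k s x y)) (side k s (Rule1 r x) y).
Proof. by swap_tac. Qed.

Lemma swapW1A a r t u : ok (RWith a (Rule1 r t) (Rule1 r u)) ->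
  (forall z, z == inl (child false a) -> res t z) ->
  (forall z, z == inl (child true a) -> res u z) ->
  same (RWith a (Rule1 r t) (Rule1 r u)) (Rule1 r (RWith a t u)).
Proof. by swap_tac. Qed.

Lemma swapW1B a r t u : ok (Rule1 r (RWith a t u)) ->
  (forall z, z == inl a -> ~~ sub1 r z) ->
  same (Rule1 r (RWith a t u)) (RWith a (Rule1 r t) (Rule1 r u)).
Proof. by swap_tac. Qed.

Lemma swapW2A k a r x y t : ok (RWith a (side k r x t) (side k r y t)) ->
  (forall z, z == inl (child false a) -> res x z) ->
  (forall z, z == inl (child true a) -> res y z) ->
  same (RWith a (side k r x t) (side k r y t)) (side k r (RWith a x y) t).
Proof. by swap_tac. Qed.

(** Copying [t] into both premises is harmless, because the premises of a with may share vertices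
    and cuts. *)
Lemma swapW2B k a r x y t : ok (side k r (RWith a x y) t) ->
  (forall z, z == inl a -> ~~ sub2 k r z) ->
  same (side k r (RWith a x y) t) (RWith a (side k r x t) (side k r y t)).
Proof. by swap_tac. Qed.

Lemma swapWW a b t u v w : ok (RWith a (RWith b t u) (RWith b v w)) ->
  (forall z, z == inl (child false a) -> res t z && res u z) ->
  (forall z, z == inl (child true a) -> res v z && res w z) ->
  same (RWith a (RWith b t u) (RWith b v w)) (RWith b (RWith a t v) (RWith a u w)).
Proof. by swap_tac. Qed.

Lemma swap22 j k r s x y t : ok (side j s (side k r x y) t) ->
  (forall z, sub2 j s z -> res x z) ->
  same (side j s (side k r x y) t) (side k r (side j s x t) y).
Proof. by swap_tac. Qed.

End Validity.

(** * Linkings and commutations *)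

Lemma dualK : involutive dual.
Proof. by elim=> [b P|A IHA B IHB|A IHA B IHB|A IHA B IHB|A IHA B IHB] /=; rewrite ?negbK ?IHA ?IHB. Qed.

Definition lnk (t : tree) (l : linking) : Prop := l \in linkings t.

Lemma mem_mapP (T : Type) (K : eqType) (f : T -> K) s l :
  l \in map f s <-> exists2 x, List.In x s & f x = l.
Proof.
elim: s => [|x s IH] /=; first by split=> // -[].
rewrite inE; split=> [/orP[/eqP->|/IH[y ? <-]]|[y [<-|ys] yl]].
- by exists x; [left|].
- by exists y; [right|].
- by rewrite yl eqxx.
- by apply/orP; right; apply/IH; exists y.
Qed.

Lemma lnkP t l : lnk t l <-> exists2 R, List.In R (resolutions t) & linking_of R = l.
Proof. by rewrite /lnk /linkings in_fset; apply: mem_mapP. Qed.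

Lemma lnk_ax x y l : lnk (Ax x y) l <-> l = [fset [fset x; y]].
Proof. by rewrite lnkP; split=> [[R [<-|[]]]|->] //; exists (ResAx x y) => //; left. Qed.

Lemma lnk_rule1 r t l : lnk (Rule1 r t) l <-> lnk t l.
Proof.
rewrite !lnkP /=; split=> [[R /List.in_map_iff[R' [<- ?]] <-]|[R ? <-]].
  by exists R'.
by exists (ResRule1 r R) => //; apply/List.in_map_iff; exists R.
Qed.

Lemma in_allpairs (S T U : Type) (f : S -> T -> U) s t z :
  List.In z (allpairs f s t) <-> exists x y, List.In x s /\ List.In y t /\ z = f x y.
Proof.
elim: s => [|x s IH] /=; first by split=> // -[x [y []]].
rewrite List.in_app_iff List.in_map_iff IH; split.
- case=> [[y [<- ?]]|[x' [y [? [? ->]]]]]; first by exists x, y; auto.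
  by exists x', y; auto.
- case=> x' [y [[<-|?] [? ->]]]; first by left; exists y.
  by right; exists x', y.
Qed.

Lemma lnk_rule2 r t u l :
  lnk (Rule2 r t u) l <-> exists l1 l2, lnk t l1 /\ lnk u l2 /\ l = l1 `|` l2.
Proof.
rewrite !lnkP /=; split.
- case=> R /in_allpairs[R1 [R2 [? [? ->]]]] <-.
  exists (linking_of R1), (linking_of R2); split; [|split=> //];
  by apply/lnkP; eexists; eauto.
- case=> l1 [l2 [/lnkP[R1 ? <-] [/lnkP[R2 ? <-] ->]]].
  by exists (ResRule2 r R1 R2) => //; apply/in_allpairs; exists R1, R2.
Qed.

Lemma lnk_with a t u l : lnk (RWith a t u) l <-> lnk t l \/ lnk u l.
Proof.
rewrite !lnkP /=; split.
- case=> R /List.in_app_iff[] /List.in_map_iff[R' [<- ?]] <- /=.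
  + by left; exists R'.
  + by right; exists R'.
- case=> -[R ? <-].
  + by exists (ResWith a false R) => //; apply/List.in_app_iff; left;
      apply/List.in_map_iff; exists R.
  + by exists (ResWith a true R) => //; apply/List.in_app_iff; right;
      apply/List.in_map_iff; exists R.
Qed.

Lemma lnk_side k r t u l :
  lnk (side k r t u) l <-> exists l1 l2, lnk t l1 /\ lnk u l2 /\ l = l1 `|` l2.
Proof.
case: k; rewrite lnk_rule2 //; split=> -[l1 [l2 [? [? ->]]]]; exists l2, l1;
by rewrite fsetUC.
Qed.

Definition lnkE := (lnk_ax, lnk_rule1, lnk_side, lnk_rule2, lnk_with).

(** Unary rules leave linkings alone, binary rules take unions of one linking from each premise, and
    a with collects the linkings of both premises. The commutations reduce to associativity,
    commutativity and distributivity of these operations. *)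
Lemma commute_lnk t u : commute t u -> forall l, lnk t l <-> lnk u l.
Proof.
have D r t1 t2 l1 l2 : lnk t1 l1 -> lnk t2 l2 -> lnk (Rule2 r t1 t2) (l1 `|` l2).
  by move=> ? ?; apply/lnk_rule2; exists l1, l2.
case=> *; (split=> H; [rename H into Hl | rename H into Hr]);
repeat match goal with
| H : lnk (Rule1 _ _) _ |- _ => move/lnk_rule1: H => H
| H : lnk (Rule2 _ _ _) _ |- _ => case/lnk_rule2: H => ? [? [? [? ->]]]
| H : lnk (RWith _ _ _) _ |- _ => case/lnk_with: H => ?
end;
rewrite ?lnkE;
try by [auto | do 2 eexists; split; [|split; [|reflexivity]]; rewrite ?lnkE; eauto
   | left; do 2 eexists; split; [|split; [|reflexivity]]; rewrite ?lnkE; eauto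
   | right; do 2 eexists; split; [|split; [|reflexivity]]; rewrite ?lnkE; eauto ].
all: do 2 eexists; split; [first [eassumption | apply: D; eassumption]|
  split; [first [eassumption | apply: D; eassumption]|]].
all: by apply/fsetP => z; rewrite !inE; do !case: (z \in _).
Qed.

(* The connectives introduced by mix and by cut are unordered. *)
Inductive flip : tree -> tree -> Prop :=
| flip_mix t u : flip (Rule2 RMix t u) (Rule2 RMix u t)
| flip_cut c A t u : flip (Rule2 (RCut c A) t u) (Rule2 (RCut c (dual A)) u t).

Definition redex t u := commute t u \/ flip t u.

Lemma redex_lnk t u : in_context redex t u -> forall l, lnk t l <-> lnk u l.
Proof.
elim=> {t u} [t u [/commute_lnk//|[t' u'|c A t' u']] l||||a t t' u _ IH l|a t u u' _ IH l].
- rewrite (lnk_side false) (lnk_side true) //.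
- by rewrite (lnk_side false) (lnk_side true).
- by move=> r t t' _ IH l; rewrite !lnk_rule1.
- move=> r t t' u _ IH l; rewrite !lnk_rule2.
  by split=> -[l1 [l2 [/IH ? [? ->]]]]; exists l1, l2.
- move=> r t u u' _ IH l; rewrite !lnk_rule2.
  by split=> -[l1 [l2 [? [/IH ? ->]]]]; exists l1, l2.
- by rewrite !lnk_with IH.
- by rewrite !lnk_with IH.
Qed.

Section Equivalence.
Variables (m : bool) (G : seq form).
Notation ok := (ok m G).
Notation same := (same m G).

(** Validity and the invariance of [res] and [foot] are part of the step, since [in_context redex]
    relates invalid trees as well; whole chains of steps can then be placed under further rules. *)
Definition cstep t u :=
  ok t /\ ok u /\ res t =1 res u /\ foot t =1 foot u /\ in_context redex t u.

Definition eqv := clos_refl_sym_trans tree cstep.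

Lemma eqv_same t u : eqv t u ->
  (ok t <-> ok u) /\ res t =1 res u /\ foot t =1 foot u /\ (forall l, lnk t l <-> lnk u l).
Proof.
elim=> {t u} [t u [? [? [? [? /redex_lnk]]]]|t|t u _ [E [R [F L]]]|
  t u v _ [E1 [R1 [F1 L1]]] _ [E2 [R2 [F2 L2]]]].
- by [].
- by [].
- by split; [split=> /E|do 2?split=> //; move=> l; split=> /L].
- split; first by rewrite E1.
  split; first by move=> z; rewrite R1.
  by split=> [z|l]; [rewrite F1|rewrite L1].
Qed.

Lemma eqv_ok t u : eqv t u -> ok t -> ok u.
Proof. by move/eqv_same=> [H _] /H. Qed.

Lemma eqv_okr t u : eqv t u -> ok u -> ok t.
Proof. by move/eqv_same=> [H _] /H. Qed.

Lemma eqv_res t u : eqv t u -> res t =1 res u.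
Proof. by move/eqv_same=> [_ [H _]]. Qed.

Lemma eqv_lnk t u : eqv t u -> forall l, lnk t l <-> lnk u l.
Proof. by move/eqv_same=> [_ [_ [_ H]]]. Qed.

Lemma eqv_refl t : eqv t t.
Proof. exact: rst_refl. Qed.

Lemma eqv_sym t u : eqv t u -> eqv u t.
Proof. exact: rst_sym. Qed.

Lemma eqv_trans t u v : eqv t u -> eqv u v -> eqv t v.
Proof. exact: rst_trans. Qed.

Lemma same_redex t u : ok t -> same t u -> redex t u -> eqv t u.
Proof. by move=> ? [? [? ?]] ?; apply: rst_step; do 4!split=> //; apply: ctx_here. Qed.

Lemma same_redexV t u : ok t -> same t u -> redex u t -> eqv t u.
Proof.
move=> ? [? [R F]] ?; apply/eqv_sym/rst_step; split=> //; split=> //.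
by split=> [z|]; [rewrite R|split=> [z|]; [rewrite F|apply: ctx_here]].
Qed.

(** Validity of the filled context is assumed at one end only: it travels along the chain, as it
    depends on the hole through [ok], [res] and [foot] alone. *)
Lemma eqv_context (C : tree -> tree) :
  (forall t u, in_context redex t u -> in_context redex (C t) (C u)) ->
  (forall t u, ok t -> ok u -> res t =1 res u -> foot t =1 foot u ->
    ok (C t) -> same (C t) (C u)) ->
  forall t u, eqv t u -> ok (C t) -> ok t -> eqv (C t) (C u).
Proof.
move=> H1 H2 t u; elim=> {t u} [t u [ot' [ou [R [F c]]]] o _|t _ _|t u e IH o ot|t u v e IH1 _ IH2 o ot].
- have [? [? ?]] := H2 _ _ ot' ou R F o.
  by apply: rst_step; do 4!split=> //; apply: H1.
- exact: eqv_refl.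
- have [E [R [F _]]] := eqv_same e.
  apply/eqv_sym/IH; last exact/E.
  suff [] : same (C u) (C t) by [].
  by apply: H2=> //; exact/E.
- apply: (eqv_trans (IH1 o ot)); apply: IH2; last exact: eqv_ok ot.
  exact: eqv_ok (IH1 o ot) o.
Qed.

Lemma ctx_side R k r t t' u : in_context R t t' -> in_context R (side k r t u) (side k r t' u).
Proof. by case: k => ?; [apply: ctx_rule2r|apply: ctx_rule2l]. Qed.

Lemma eqv_rule1 r t t' : eqv t t' -> ok (Rule1 r t) -> eqv (Rule1 r t) (Rule1 r t').
Proof.
move=> e o; apply: (eqv_context (C := Rule1 r) _ _ e o); last by case: o.
  by move=> *; apply: ctx_rule1.
move=> x y ox oy R F /= [_ [? [S P]]]; split; last first.
  by split=> z /=; rewrite ?R ?F.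
do !split=> //; move=> z; first by move/S; rewrite R.
by move/P; rewrite F.
Qed.

Lemma eqv_side k r t t' u : eqv t t' -> ok (side k r t u) -> eqv (side k r t u) (side k r t' u).
Proof.
move=> e o; apply: (eqv_context (C := fun t => side k r t u) _ _ e o); last by case/ok_side: o.
  by move=> *; apply: ctx_side.
move=> x y ox oy R F /ok_side[_ [? [? [S1 [S2 [P1 [P2 D]]]]]]]; split; last first.
  by split=> z; rewrite ?res_side ?foot_side /= ?R ?F.
apply/ok_side; do !split=> //; move=> z.
- by move/S1; rewrite R.
- by move/P1; rewrite F.
- by rewrite -F; apply: D.
Qed.

Lemma sideC k r t u : side k r t u = side (~~ k) r u t.
Proof. by case: k. Qed.

Lemma eqv_side2 k r t t' u u' : eqv t t' -> eqv u u' -> ok (side k r t u) ->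
  eqv (side k r t u) (side k r t' u').
Proof.
move=> e e' o; have e1 := eqv_side e o; apply: (eqv_trans e1).
by rewrite sideC [side k r t' u']sideC; apply: eqv_side => //; rewrite -sideC; apply: eqv_ok e1 o.
Qed.

Lemma eqv_with a t t' u u' : eqv t t' -> eqv u u' -> ok (RWith a t u) ->
  eqv (RWith a t u) (RWith a t' u').
Proof.
move=> e e' o; apply: (@eqv_trans _ (RWith a t' u)).
- apply: (eqv_context (C := fun t => RWith a t u) _ _ e o); last by case: o.
    by move=> *; apply: ctx_withl.
  move=> x y ox oy R F /= [_ [? [? [S1 [S2 [P1 [P2 D]]]]]]]; split; last first.
    by split=> z /=; rewrite ?R ?F.
  do !split=> //; move=> z; rewrite -?R -?F; auto.
- have {}o : ok (RWith a t' u).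
    move: o; have [E [R [F _]]] := eqv_same e.
    move=> /= [/E ? [? [? [S1 [S2 [P1 [P2 D]]]]]]]; do !split=> //; move=> z; rewrite -?R -?F; auto.
  apply: (eqv_context (C := RWith a t') _ _ e' o); last by case: o => _ [].
    by move=> *; apply: ctx_withr.
  move=> x y ox oy R F /= [? [_ [? [S1 [S2 [P1 [P2 D]]]]]]]; split; last first.
    by split=> z /=; rewrite ?R ?F.
  do !split=> //; move=> z; rewrite -?R -?F; auto.
Qed.

Lemma eqv_flip k t u : ok (side k RMix t u) -> eqv (side k RMix t u) (side (~~ k) RMix t u).
Proof.
move=> o; apply: same_redex => //; last by case: k o => o; right; apply: flip_mix.
move: o => /ok_side[? [? [? [? [? [? [? D]]]]]]]; split; first by apply/ok_side.
by split=> z; rewrite ?res_side ?foot_side /= ?andbT.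
Qed.

Lemma eqv_flip_cut c A t u : ok (Rule2 (RCut c A) t u) ->
  eqv (Rule2 (RCut c A) t u) (Rule2 (RCut c (dual A)) u t).
Proof.
move=> o; apply: same_redex => //; last by right; apply: flip_cut.
have E : [fset A; dual A] = [fset dual A; dual (dual A)] by rewrite dualK fsetUC.
move: o => /= [? [? [? [? [? [? [? D]]]]]]]; split.
  rewrite /= -E dualK; do !split=> //; move=> z.
  by apply: contraL; apply: D.
by split=> z /=; rewrite -E ?dualK; congr orb; rewrite orbC.
Qed.

Lemma eqv_swap11 r s t : ok (Rule1 r (Rule1 s t)) -> (forall z, sub1 r z -> res t z) ->
  eqv (Rule1 r (Rule1 s t)) (Rule1 s (Rule1 r t)).
Proof. by move=> o H; apply: (same_redex _ (swap11 o H) _) => //; left; apply: comm_1_1. Qed.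

Lemma comm_1_side k r s x y : redex (Rule1 r (side k s x y)) (side k s (Rule1 r x) y).
Proof. by left; case: k; [apply: comm_1_2r|apply: comm_1_2l]. Qed.

Lemma eqv_swap12A k r s x y : ok (side k s (Rule1 r x) y) ->
  (forall z, z == inl (prin1 r) -> ~~ sub2 k s z) ->
  eqv (side k s (Rule1 r x) y) (Rule1 r (side k s x y)).
Proof. by move=> o H; apply: (same_redexV _ (swap12A o H) (comm_1_side _ _ _ _ _)). Qed.

Lemma eqv_swap12B k r s x y : ok (Rule1 r (side k s x y)) ->
  (forall z, sub1 r z -> res x z) ->
  eqv (Rule1 r (side k s x y)) (side k s (Rule1 r x) y).
Proof. by move=> o H; apply: (same_redex _ (swap12B o H) (comm_1_side _ _ _ _ _)). Qed.

Lemma eqv_swapW1A a r t u : ok (RWith a (Rule1 r t) (Rule1 r u)) ->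
  (forall z, z == inl (child false a) -> res t z) ->
  (forall z, z == inl (child true a) -> res u z) ->
  eqv (RWith a (Rule1 r t) (Rule1 r u)) (Rule1 r (RWith a t u)).
Proof. by move=> o H H'; apply: (same_redex _ (swapW1A o H H') _) => //; left; apply: comm_with_1. Qed.

Lemma eqv_swapW1B a r t u : ok (Rule1 r (RWith a t u)) ->
  (forall z, z == inl a -> ~~ sub1 r z) ->
  eqv (Rule1 r (RWith a t u)) (RWith a (Rule1 r t) (Rule1 r u)).
Proof. by move=> o H; apply: (same_redexV _ (swapW1B o H) _) => //; left; apply: comm_with_1. Qed.

Lemma comm_with_side k a r x y t :
  redex (RWith a (side k r x t) (side k r y t)) (side k r (RWith a x y) t).
Proof. by left; case: k; [apply: comm_with_2r|apply: comm_with_2l]. Qed.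

Lemma eqv_swapW2A k a r x y t : ok (RWith a (side k r x t) (side k r y t)) ->
  (forall z, z == inl (child false a) -> res x z) ->
  (forall z, z == inl (child true a) -> res y z) ->
  eqv (RWith a (side k r x t) (side k r y t)) (side k r (RWith a x y) t).
Proof. by move=> o H H'; apply: (same_redex _ (swapW2A o H H') (comm_with_side _ _ _ _ _ _)). Qed.

Lemma eqv_swapW2B k a r x y t : ok (side k r (RWith a x y) t) ->
  (forall z, z == inl a -> ~~ sub2 k r z) ->
  eqv (side k r (RWith a x y) t) (RWith a (side k r x t) (side k r y t)).
Proof. by move=> o H; apply: (same_redexV _ (swapW2B o H) (comm_with_side _ _ _ _ _ _)). Qed.

Lemma eqv_swapWW a b t u v w : ok (RWith a (RWith b t u) (RWith b v w)) ->
  (forall z, z == inl (child false a) -> res t z && res u z) ->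
  (forall z, z == inl (child true a) -> res v z && res w z) ->
  eqv (RWith a (RWith b t u) (RWith b v w)) (RWith b (RWith a t v) (RWith a u w)).
Proof. by move=> o H H'; apply: (same_redex _ (swapWW o H H') _) => //; left; apply: comm_with_with. Qed.

Lemma eqv_swap22 j k r s x y t : ok (side j s (side k r x y) t) ->
  (forall z, sub2 j s z -> res x z) ->
  eqv (side j s (side k r x y) t) (side k r (side j s x t) y).
Proof.
move=> o H; apply: (same_redex _ (swap22 o H) _) => //; left.
case: j k {o H} => [] []; [exact: comm_2_2rr|exact: comm_2_2rl|exact: comm_2_2lr|exact: comm_2_2ll].
Qed.

End Equivalence.

(** * Vertices above a resource *)

Lemma cone_child b a w : cone (inl (child b a)) w -> cone (inl a) w.
Proof.
rewrite /cone /child /= => /andP[-> /prefixP[s ->]].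
by apply/prefixP; exists (b :: s); rewrite cat_rcons.
Qed.

Lemma cone_child_disj a w : cone (inl (child false a)) w -> ~~ cone (inl (child true a)) w.
Proof.
rewrite /cone /child /= => /andP[-> /prefixP[s ->]]; apply/negP => /prefixP[s'].
by rewrite !cat_rcons => /eqP; rewrite eqseq_cat // => /andP[_ /eqP].
Qed.

Lemma cone_inhab x : exists w, cone x w.
Proof.
case: x => [v|[c P]]; first by exists v; rewrite /= eqxx prefix_refl.
(* The formula is arbitrary: the cone of a cut depends on its name only. *)
by exists (CutRoot c (Lit true 0), [::]); rewrite /= eqxx.
Qed.

Lemma cone_sub1 r z w : sub1 r z -> cone z w -> cone (inl (prin1 r)) w.
Proof.
by case: r => [a|b a] /=; [case/orP|] => /eqP->; apply: cone_child.
Qed.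

Lemma cone_sub2 k r z w : sub2 k r z -> cone z w -> exists2 p, prin2 r p & cone p w.
Proof.
case: r => [a|c A|] //= /eqP-> h; first by exists (inl a) => //; apply: cone_child h.
exists (inr (c, [fset A; dual A])) => //.
by move: h => /= /andP[/eqP<- _].
Qed.

Lemma dual_neq A : dual A != A.
Proof. by case: A => [[]||||]. Qed.

(** The two branches of a cut share their name and are told apart by the formulas [A] and [dual A],
    which are never equal. *)
Lemma cone_sub2_disj k r x y w : sub2 k r x -> sub2 (~~ k) r y -> cone x w -> cone y w -> False.
Proof.
wlog: k x y / k = false => [H|->].
  by case: k; [move=> ? ? ? ?; apply: (H false y x)|apply: H].
case: r => [a|c A|] //= /eqP-> /eqP->; first by move=> /cone_child_disj/negP.
move=> /= /andP[/eqP<- _] /andP[/eqP[] E].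
by move: (dual_neq A); rewrite E eqxx.
Qed.

Lemma sub2_uniq k r x y : sub2 k r x -> sub2 k r y -> x = y.
Proof. by case: r => [a|c A|] //= /eqP-> /eqP->. Qed.

Lemma prin2_uniq r x y : prin2 r x -> prin2 r y -> x = y.
Proof. by case: r => [a|c A|] //= /eqP-> /eqP->. Qed.

Lemma sub1_cone r x y w : sub1 r x -> sub1 r y -> cone x w -> cone y w -> x = y.
Proof.
case: r => [a|b a] /=; last by move=> /eqP-> /eqP->.
by case/orP=> /eqP-> /orP[]/eqP-> // h h';
  [have := cone_child_disj h; rewrite h'|have := cone_child_disj h'; rewrite h].
Qed.

Definition prins2 (r : rule2) : seq resource :=
  match r with
  | RTensor a => [:: inl a]
  | RCut c A => [:: inr (c, [fset A; dual A])]
  | RMix => [::]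
  end.

Fixpoint resources (t : tree) : seq resource :=
  match t with
  | Ax x y => [:: inl x; inl y]
  | Rule1 r t => inl (prin1 r) :: resources t
  | Rule2 r t u => prins2 r ++ resources t ++ resources u
  | RWith a t u => inl a :: resources t ++ resources u
  end.

Lemma footE t z : foot t z = (z \in resources t).
Proof.
elim: t => [x y|r t IH|r t IHt u IHu|a t IHt u IHu] /=; rewrite ?mem_cat ?inE ?mem_cat ?IH ?IHt ?IHu //.
by case: r => *; rewrite /= ?inE.
Qed.

(* As a colouring, [above u] separates the premises of [Rule2 r t u]. *)
Definition above (t : tree) (w : vertex) : bool :=
  has (fun z => res t z && cone z w) (resources t).

Lemma aboveP t w : reflect (exists2 z, res t z & cone z w) (above t w).
Proof.
apply: (iffP hasP) => [[z _ /andP[]]|[z h h']]; first by exists z.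
by exists z; [rewrite -footE res_foot|rewrite h h'].
Qed.

(** An antichain condition, which makes the resource below a given leaf unique. It holds for the
    conclusion of a whole proof, where roots and cut names differ, and passes to the premises of a
    valid tree. *)
Definition anti (S : resource -> bool) :=
  forall x y w, S x -> S y -> cone x w -> cone y w -> x = y.

Definition lv (l : linking) (w : vertex) : Prop := exists2 e, e \in l & w \in e.

(** Tensor, cut and mix count nothing, so that exchanging binary rules or regrouping mixes preserves
    the size, while stripping a par, plus or with strictly decreases it. *)
Fixpoint tsize (t : tree) : nat :=
  match t with
  | Ax _ _ => 1
  | Rule1 _ t => (tsize t).+1
  | Rule2 _ t u => (tsize t + tsize u)%N
  | RWith _ t u => (tsize t + tsize u).+1%N
  end.

Lemma tsize_gt0 t : (0 < tsize t)%N.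
Proof. by elim: t => //= r t IH u IHu; rewrite addn_gt0 IH. Qed.

Lemma tsize_side k r x y : tsize (side k r x y) = (tsize x + tsize y)%N.
Proof. by case: k => //=; rewrite addnC. Qed.

Lemma lvU l l' w : lv (l `|` l') w <-> lv l w \/ lv l' w.
Proof.
split=> [[e]|[] [e h h']].
- by rewrite inE => /orP[] h h'; [left|right]; exists e.
- by exists e; rewrite // inE h.
- by exists e; rewrite // inE h orbT.
Qed.

Lemma lnk_ex t : exists l, lnk t l.
Proof.
elim: t => [x y|r t [l ?]|r t [l ?] u [l' ?]|a t [l ?] u _].
- by exists [fset [fset x; y]]; apply/lnk_ax.
- by exists l; apply/lnk_rule1.
- by exists (l `|` l'); apply/lnk_rule2; exists l, l'.
- by exists l; apply/lnk_with; left.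
Qed.

(** Needed because an empty link would be monochromatic in both colours and belong to both
    slices. *)
Lemma lnk_link t l e : lnk t l -> e \in l -> exists w, w \in e.
Proof.
elim: t l e => [x y|r t IH|r t IHt u IHu|a t IHt u IHu] l e.
- by move/lnk_ax->; rewrite inE => /eqP->; exists x; rewrite !inE eqxx.
- by move/lnk_rule1/IH; apply.
- by case/lnk_rule2=> l1 [l2 [/IHt H [/IHu H' ->]]]; rewrite inE => /orP[/H|/H'].
- by case/lnk_with=> [/IHt|/IHu]; apply.
Qed.

Lemma lnk_nonempty t l : lnk t l -> exists e, e \in l.
Proof.
elim: t l => [x y|r t IH|r t IHt u IHu|a t IHt u IHu] l.
- by move/lnk_ax->; exists [fset x; y]; rewrite inE.
- by move/lnk_rule1/IH.
- by case/lnk_rule2=> l1 [l2 [/IHt [e H] [_ ->]]]; exists e; rewrite inE H.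
- by case/lnk_with=> [/IHt|/IHu].
Qed.

Lemma cone_refl v : cone (inl v) v.
Proof. by rewrite /= eqxx prefix_refl. Qed.

Arguments cone x w : simpl never.

Section Geometry.
Variables (m : bool) (G : seq form).
Notation ok := (ok m G).
Notation eqv := (eqv m G).

(** If an active formula and a context resource met above a leaf, the principal formula would meet
    the same resource in the conclusion and coincide with it, against freshness. The weak versions
    assume freshness with respect to [res] only, which is all that is known in [okm_ok]. *)
Lemma anti_rule1_weak r t : (forall z, z == inl (prin1 r) -> ~~ res t z) ->
  anti (res (Rule1 r t)) -> anti (res t).
Proof.
move=> P H.
have K x y w : res t x -> res t y -> sub1 r x -> ~~ sub1 r y -> cone x w -> cone y w -> False.
  move=> tx ty sx sy cx cy.
  have E := H (inl (prin1 r)) y w; rewrite /= eqxx ty sy orbT in E.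
  by move: (P y); rewrite -E // ?eqxx ?(cone_sub1 sx cx) // => /(_ isT); rewrite E ?ty ?(cone_sub1 sx cx).
move=> x y w tx ty cx cy.
case sx: (sub1 r x); case sy: (sub1 r y).
- exact: sub1_cone sx sy cx cy.
- by case: (@K x y w) => //; rewrite sy.
- by case: (@K y x w) => //; rewrite sx.
- by apply: (H x y w) => //=; rewrite ?tx ?ty ?sx ?sy orbT.
Qed.

Lemma anti_rule1 r t : ok (Rule1 r t) -> anti (res (Rule1 r t)) -> anti (res t).
Proof.
move=> /= [_ [_ [_ P]]]; apply: anti_rule1_weak => z /P.
by apply: contra; apply: res_foot.
Qed.

(* The part of [ok] needed to separate the premises of a binary rule; it speaks
   of their conclusions only. *)
Definition disjoint2 k r x y :=
  (forall z, prin2 r z -> ~~ res x z) /\ (forall z, prin2 r z -> ~~ res y z) /\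
  (forall z, res x z && ~~ sub2 k r z -> ~~ (res y z && ~~ sub2 (~~ k) r z)).

Lemma ok_disjoint2 k r x y : ok (side k r x y) -> disjoint2 k r x y.
Proof.
move=> /ok_side[_ [_ [_ [_ [_ [P1 [P2 D]]]]]]]; split=> [z /P1|].
  by apply: contra; apply: res_foot.
split=> [z /P2|z /andP[/res_foot/D h _]].
  by apply: contra; apply: res_foot.
by apply: contra h => /andP[/res_foot].
Qed.

Lemma disjoint2C k r x y : disjoint2 k r x y -> disjoint2 (~~ k) r y x.
Proof.
case=> P1 [P2 D]; split=> //; split=> // z h; rewrite negbK.
by apply/negP => /D; rewrite h.
Qed.

Lemma anti_sub2 k r x y a b w : disjoint2 k r x y -> anti (res (side k r x y)) ->
  sub2 k r a -> cone a w ->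
  res x b && ~~ sub2 k r b || res y b && ~~ sub2 (~~ k) r b -> cone b w -> False.
Proof.
move=> [P1 [P2 _]] H sa ca rb cb.
have [p pp cp] := cone_sub2 sa ca.
have E : p = b by apply: (H p b w) => //; rewrite res_side ?pp ?rb ?orbT.
move: rb; rewrite -E; case/orP=> /andP[h _].
- by move: (P1 _ pp); rewrite h.
- by move: (P2 _ pp); rewrite h.
Qed.

Lemma anti_side_weak k r x y : disjoint2 k r x y -> anti (res (side k r x y)) -> anti (res x).
Proof.
move=> o H a b w xa xb ca cb.
case sa: (sub2 k r a); case sb: (sub2 k r b).
- exact: sub2_uniq sa sb.
- by case: (anti_sub2 o H sa ca (b := b)) => //; rewrite xb sb.
- by case: (anti_sub2 o H sb cb (b := a)) => //; rewrite xa sa.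
- by apply: (H a b w) => //; rewrite res_side ?xa ?xb ?sa ?sb orbT.
Qed.

Lemma anti_side k r x y : ok (side k r x y) -> anti (res (side k r x y)) -> anti (res x).
Proof. by move/ok_disjoint2; apply: anti_side_weak. Qed.

Lemma anti_side2 k r x y : ok (side k r x y) -> anti (res (side k r x y)) -> anti (res y).
Proof. by rewrite sideC; apply: anti_side. Qed.

(** The cases are which of [a] and [b] are active. Two active resources have disjoint cones; an
    active one meeting a context resource would force the principal resource into the context; two
    context resources would coincide, although the contexts are disjoint. *)
Lemma sep_side_weak k r x y a b w : disjoint2 k r x y -> anti (res (side k r x y)) ->
  res x a -> res y b -> cone a w -> cone b w -> False.
Proof.
move=> o H xa yb ca cb.
case sa: (sub2 k r a); case sb: (sub2 (~~ k) r b).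
- exact: cone_sub2_disj sa sb ca cb.
- by case: (anti_sub2 o H sa ca (b := b)) => //; rewrite yb sb orbT.
- have o' := disjoint2C o; rewrite sideC in H.
  case: (anti_sub2 o' H sb cb (b := a)) => //.
  by rewrite negbK xa sa orbT.
- have E : a = b by apply: (H a b w); rewrite ?res_side ?xa ?yb ?sa ?sb ?orbT.
  case: o => _ [_ D]; move: (D a); rewrite xa sa E yb sb => /(_ isT) //.
Qed.

Lemma sep_side k r x y a b w : ok (side k r x y) -> anti (res (side k r x y)) ->
  res x a -> res y b -> cone a w -> cone b w -> False.
Proof. by move/ok_disjoint2; apply: sep_side_weak. Qed.

Lemma with_child k a t u : ok (RWith a t u) ->
  res (if k then u else t) (inl (child k a)).
Proof. by case: k => /= -[_ [_ [_ [S1 [S2 _]]]]]; [apply: S2|apply: S1]. Qed.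

Lemma anti_with_weak k j a t u x w : ~~ res t (inl a) -> ~~ res u (inl a) ->
  anti (res (RWith a t u)) ->
  res (if k then u else t) x -> x != inl (child k a) -> cone x w ->
  ~~ cone (inl (child j a)) w.
Proof.
move=> P1 P2 H rx nx cx; apply/negP => /cone_child ca.
have E : inl a = x.
  apply: (H _ x w); rewrite /= ?eqxx //; apply/orP; right.
  by case: k rx nx => -> ->; rewrite ?orbT.
by case: k rx {nx}; rewrite -E ?(negPf P1) ?(negPf P2).
Qed.

Lemma anti_with_prem_weak k a t u : ~~ res t (inl a) -> ~~ res u (inl a) ->
  anti (res (RWith a t u)) -> anti (res (if k then u else t)).
Proof.
move=> P1 P2 H x y w rx ry cx cy.
have [ex|nx] := eqVneq x (inl (child k a)); have [ey|ny] := eqVneq y (inl (child k a)).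
- by rewrite ex ey.
- by have := anti_with_weak k P1 P2 H ry ny cy; rewrite -ex cx.
- by have := anti_with_weak k P1 P2 H rx nx cx; rewrite -ey cy.
- apply: (H x y w) => //=; apply/orP; right;
  by case: k rx ry nx ny {cx cy} => rx ry nx ny; rewrite ?rx ?ry ?nx ?ny ?orbT.
Qed.

Lemma with_prin a t u : ok (RWith a t u) -> ~~ res t (inl a) /\ ~~ res u (inl a).
Proof.
move=> /= [_ [_ [_ [_ [_ [P1 [P2 _]]]]]]].
by split; [apply: contra (P1 _ (eqxx _))|apply: contra (P2 _ (eqxx _))]; apply: res_foot.
Qed.

Lemma anti_with k j a t u x w : ok (RWith a t u) -> anti (res (RWith a t u)) ->
  res (if k then u else t) x -> x != inl (child k a) -> cone x w ->
  ~~ cone (inl (child j a)) w.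
Proof. by move=> /with_prin[]; apply: anti_with_weak. Qed.

Lemma anti_with_prem k a t u : ok (RWith a t u) -> anti (res (RWith a t u)) ->
  anti (res (if k then u else t)).
Proof. by move=> /with_prin[]; apply: anti_with_prem_weak. Qed.

(** A leaf above the principal formula of a with therefore reveals the premise from which a linking
    comes. *)
Lemma sep_with k a t u x w : ok (RWith a t u) -> anti (res (RWith a t u)) ->
  res (if k then u else t) x -> cone x w -> ~~ cone (inl (child (~~ k) a)) w.
Proof.
move=> o H rx cx; have [ex|nx] := eqVneq x (inl (child k a)).
  rewrite ex in cx; apply/negP => h.
  by case: k cx h {o H rx ex} => h h'; [have := cone_child_disj h'; rewrite h|have := cone_child_disj h; rewrite h'].
exact: (anti_with (~~ k) o H rx nx cx).
Qed.

Lemma lnk_sup t l w : ok t -> lnk t l -> lv l w -> exists2 x, res t x & cone x w.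
Proof.
elim: t l => [x y|r t IH|r t IHt u IHu|a t IHt u IHu] l.
- move=> _ /lnk_ax-> [e]; rewrite inE => /eqP->; rewrite !inE => /orP[]/eqP->.
    by exists (inl x); rewrite /= ?eqxx ?cone_refl.
  by exists (inl y); rewrite /= ?eqxx ?cone_refl ?orbT.
- move=> /= [o _] /lnk_rule1 /(IH _ o) H /H[z tz cz].
  have [sz|nz] := boolP (sub1 r z).
    by exists (inl (prin1 r)); [rewrite eqxx|apply: cone_sub1 sz cz].
  by exists z => //; rewrite tz nz orbT.
- move=> /= [ot [ou _]] /lnk_rule2[l1 [l2 [/(IHt _ ot) H [/(IHu _ ou) H' ->]]]].
  case/lvU=> [/H|/H'] [z tz cz].
  + have [sz|nz] := boolP (sub2 false r z); last by exists z; rewrite // tz nz orbT.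
    by have [p pp cp] := cone_sub2 sz cz; exists p; rewrite ?pp.
  + have [sz|nz] := boolP (sub2 true r z); last by exists z; rewrite // tz nz !orbT.
    by have [p pp cp] := cone_sub2 sz cz; exists p; rewrite ?pp.
- move=> /= [ot [ou _]] /lnk_with[/(IHt _ ot) H /H|/(IHu _ ou) H /H] [z tz cz].
  + have [sz|nz] := eqVneq z (inl (child false a)); last by exists z; rewrite // tz nz orbT.
    by exists (inl a); rewrite ?eqxx //; rewrite sz in cz; apply: cone_child cz.
  + have [sz|nz] := eqVneq z (inl (child true a)); last by exists z; rewrite // tz nz !orbT.
    by exists (inl a); rewrite ?eqxx //; rewrite sz in cz; apply: cone_child cz.
Qed.

Lemma sub1_ex r : exists2 z, sub1 r z & is_vertex z.
Proof. by case: r => [a|b a]; [exists (inl (child false a))|exists (inl (child b a))]; rewrite /= ?eqxx. Qed.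

Lemma sub2_ex k r p : prin2 r p ->
  exists2 z, sub2 k r z & is_vertex z /\ forall w, cone z w -> cone p w.
Proof.
case: r => [a|c A|] //= /eqP->.
  by exists (inl (child k a)); rewrite ?eqxx //; split=> // w; apply: cone_child.
exists (inl (cut_vertex c (if k then dual A else A))); rewrite ?eqxx //; split=> // w.
by rewrite /cone => /andP[/= /eqP<-].
Qed.

(** Both premises of a with contain the whole formula context, so no choice of branches can miss a
    formula. It can miss a cut, hence the restriction to vertices. *)
Lemma lnk_cov t l z : ok t -> lnk t l -> res t z -> is_vertex z -> exists2 w, lv l w & cone z w.
Proof.
elim: t l z => [x y|r t IH|r t IHt u IHu|a t IHt u IHu] l z.
- move=> _ /lnk_ax-> /= /orP[]/eqP-> _; [exists x|exists y]; rewrite /= ?eqxx ?cone_refl //;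
  by exists [fset x; y]; rewrite !inE ?eqxx ?orbT.
- move=> /= [o [_ [S _]]] /lnk_rule1 /(IH _ _ o) H /orP[/eqP-> _|/andP[h _]]; last exact: H.
  have [y sy vy] := sub1_ex r; have [w ? cw] := H _ (S _ sy) vy.
  by exists w => //; apply: cone_sub1 sy cw.
- move=> /= [ot [ou [_ [S _]]]] /lnk_rule2[l1 [l2 [/(IHt _ _ ot) H [/(IHu _ _ ou) H' ->]]]].
  case/or3P=> [pz vz|/andP[h _]|/andP[h _]].
  + have [y sy [vy cy]] := sub2_ex false pz; have [w lw cw] := H _ (S _ sy) vy.
    by exists w; [apply/lvU; left|apply: cy].
  + by move/H=> /(_ h)[w ? ?]; exists w => //; apply/lvU; left.
  + by move/H'=> /(_ h)[w ? ?]; exists w => //; apply/lvU; right.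
- move=> o; move: (with_child false o) (with_child true o) => /= c0 c1.
  move: (o) => /= [ot [ou [_ [_ [_ [_ [_ E]]]]]]] /lnk_with[/(IHt _ _ ot) H|/(IHu _ _ ou) H].
  + case/or3P=> [/eqP-> _|/andP[h _]|h].
    * by have [w ? cw] := H _ c0 isT; exists w => //; apply: cone_child cw.
    * exact: H.
    * by move=> vz; apply: H => //; move/addb_eq: (E _ vz); rewrite h => /andP[].
  + case/or3P=> [/eqP-> _|h|/andP[h _]].
    * by have [w ? cw] := H _ c1 isT; exists w => //; apply: cone_child cw.
    * by move=> vz; apply: H => //; move/addb_eq: (E _ vz); rewrite h => /esym/andP[].
    * exact: H.
Qed.

(** For a cut the linking has to be chosen, by keeping the branches in which the cut occurs. *)
Lemma lnk_tch t z : ok t -> res t z -> exists l, lnk t l /\ exists2 w, lv l w & cone z w.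
Proof.
move=> o tz; case vz: (is_vertex z).
  by have [l tl] := lnk_ex t; exists l; split => //; apply: lnk_cov tz vz.
elim: t o z tz vz => [x y|r t IH|r t IHt u IHu|a t IHt u IHu].
- by move=> _ z /= /orP[]/eqP->.
- move=> /= [o _] z /orP[/eqP-> //|/andP[h _]] /(IH o _ h)[l [? ?]].
  by exists l; rewrite lnk_rule1.
- move=> o; move: (o) => /= [ot [ou _]] z /or3P[pz|/andP[h _]|/andP[h _]] vz.
  + have [l tl] := lnk_ex (Rule2 r t u); exists l; split=> //.
    have [y sy [vy cy]] := sub2_ex false pz.
    move: (o) => /= [_ [_ [_ [S _]]]].
    case/lnk_rule2: tl => l1 [l2 [h1 [h2 ->]]].
    have [w ? ?] := lnk_cov ot h1 (S _ sy) vy.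
    by exists w; [apply/lvU; left|apply: cy].
  + have [l [? [w ? ?]]] := IHt ot z h vz; have [l' ?] := lnk_ex u.
    exists (l `|` l'); split; first by apply/lnk_rule2; exists l, l'.
    by exists w => //; apply/lvU; left.
  + have [l [? [w ? ?]]] := IHu ou z h vz; have [l' ?] := lnk_ex t.
    exists (l' `|` l); split; first by apply/lnk_rule2; exists l', l.
    by exists w => //; apply/lvU; right.
- move=> /= [ot [ou _]] z /or3P[/eqP-> //|/andP[h _]|/andP[h _]] vz.
  + by have [l [? ?]] := IHt ot z h vz; exists l; split=> //; apply/lnk_with; left.
  + by have [l [? ?]] := IHu ou z h vz; exists l; split=> //; apply/lnk_with; right.
Qed.

End Geometry.

(** * Permuting par, plus and with downwards *)

Section Inversion.
Variables (m : bool) (G : seq form).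
Notation ok := (ok m G).
Notation eqv := (eqv m G).

Lemma ok_sideL k r x y : ok (side k r x y) -> ok x.
Proof. by case/ok_side. Qed.

Lemma ok_sideR k r x y : ok (side k r x y) -> ok y.
Proof. by case/ok_side=> _ []. Qed.

(* A leaf below the discarded premise of a plus would betray that the plus is
   introduced on the other side. *)
Definition agrees (r : rule1) (t : tree) : Prop :=
  if r is RPlus b a then
    forall l w, lnk t l -> lv l w -> ~~ cone (inl (child (~~ b) a)) w
  else True.

Lemma agrees_rule1 r s t : agrees r (Rule1 s t) -> agrees r t.
Proof. by case: r => //= b a H l w tl; apply: (H l); apply/lnk_rule1. Qed.

Lemma agrees_side r k s t u : agrees r (side k s t u) -> agrees r t.
Proof.
case: r => //= b a H l w tl lw; have [l' ul] := lnk_ex u.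
by apply: (H (l `|` l')); [apply/lnk_side; exists l, l'|apply/lvU; left].
Qed.

Lemma agrees_with r a t u : agrees r (RWith a t u) -> agrees r t /\ agrees r u.
Proof.
by case: r => //= b a' H; split=> l w tl; apply: (H l); apply/lnk_with; [left|right].
Qed.

(** The connective at the common vertex determines the kind of rule; for a plus, [agrees] settles
    the side. *)
Lemma agrees_eq r s t : ok (Rule1 s t) -> form1 G r -> prin1 s = prin1 r ->
  agrees r (Rule1 s t) -> s = r.
Proof.
move=> /= [ot [f [S _]]] fr E; case: r s E f fr S => [a|b a] [a'|b' a'] /= ->;
  rewrite /form1 /=; case: (form_at G a) => // -[] //= _ _ _ _ S H.
have [->//|nb] := eqVneq b' b.
have [l tl] := lnk_ex t.
have [w lw cw] := lnk_cov ot tl (S _ (eqxx _)) isT.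
have := H l w _ lw; rewrite lnk_rule1 => /(_ tl).
have -> : ~~ b = b' by case: b b' nb {H S cw} => [] [].
by rewrite cw.
Qed.

(** [G] fixes the connective at every vertex. This and the next lemmas exclude that rules of
    different kinds, or a rule and an axiom, meet at one vertex. *)
Lemma form1_tensor r : form1 G r -> (if form_at G (prin1 r) is Some (Tensor _ _) then true else false) = false.
Proof. by case: r => [a|b a]; rewrite /form1 /=; case: (form_at G a) => // -[]. Qed.

Lemma form1_with r : form1 G r -> formW G (prin1 r) = false.
Proof. by case: r => [a|b a]; rewrite /form1 /formW /=; case: (form_at G a) => // -[]. Qed.

Lemma form1_ax r x : form1 G r -> form0 G (prin1 r) x = false /\ form0 G x (prin1 r) = false.
Proof.
case: r => [a|b a]; rewrite /form1 /form0 /=; case: (form_at G a) => // -[] // *;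
by split=> //; case: form_at => // -[] // [].
Qed.

Lemma formW_ax a x : formW G a -> form0 G a x = false /\ form0 G x a = false.
Proof.
rewrite /formW /form0; case: (form_at G a) => // -[] // *.
by split=> //; case: form_at => // -[] // [].
Qed.

Lemma formW_tensor a : formW G a -> (if form_at G a is Some (Tensor _ _) then true else false) = false.
Proof. by rewrite /formW /=; case: (form_at G a) => // -[]. Qed.

Lemma with_shared a t u v : ok (RWith a t u) -> res (RWith a t u) (inl v) -> v != a ->
  [/\ res t (inl v), res u (inl v), v != child false a & v != child true a].
Proof.
move=> /= [_ [_ [_ [_ [_ [_ [_ D]]]]]]] + nv; have := addb_eq (D (inl v) isT).
have E w : (inl v == inl w :> resource) = (v == w) by [].
rewrite !E (negPf nv) /= => EE; rewrite EE orbb => h; move: EE; rewrite h => /andP[-> ->].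
by case/andP: h => -> ->.
Qed.

(** The rule introducing the formula is brought down by induction. Below a with it is found in both
    premises, and [agrees] makes both occurrences equal to [r], so that they merge into one. *)
Lemma inv_rule1 r t : ok t -> form1 G r -> res t (inl (prin1 r)) -> agrees r t ->
  exists2 t', eqv t (Rule1 r t') & (tsize t' < tsize t)%N.
Proof.
move=> o fr; elim: t o => [x y|s t IH|s t IHt u IHu|a t IHt u IHu].
- by move=> /= + /orP[]/eqP[] E; rewrite -E; [case: (form1_ax y fr) => ->|case: (form1_ax x fr) => _ ->].
- move=> o rt ag; have [E|ne] := eqVneq (prin1 s) (prin1 r).
    exists t => //=; rewrite (agrees_eq o fr E ag); exact: eqv_refl.
  move: (o) => /= [ot [fs [S P]]].
  move: rt => /= /orP[/eqP[E]|/andP[rt ns]]; first by rewrite E eqxx in ne.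
  have [t' e lt] := IH ot rt (agrees_rule1 ag).
  have e1 := eqv_rule1 e o.
  have o1 := eqv_ok e1 o.
  exists (Rule1 s t') => //; apply: (eqv_trans e1); apply: eqv_swap11 => // z sz.
  move: (S _ sz); rewrite (eqv_res e) /= => /orP[/eqP E|/andP[] //].
  by rewrite -E sz in ns.
- have K k x y : (ok x -> res x (inl (prin1 r)) -> agrees r x ->
      exists2 t', eqv x (Rule1 r t') & (tsize t' < tsize x)%N) ->
      ok (side k s x y) -> res x (inl (prin1 r)) -> ~~ sub2 k s (inl (prin1 r)) ->
      agrees r (side k s x y) ->
      exists2 t', eqv (side k s x y) (Rule1 r t') & (tsize t' < tsize (side k s x y))%N.
    move=> IH o rx ns ag; have [x' e lt] := IH (ok_sideL o) rx (agrees_side ag).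
    have e1 := eqv_side e o; have o1 := eqv_ok e1 o.
    exists (side k s x' y); last by rewrite !tsize_side ltn_add2r.
    by apply: (eqv_trans e1); apply: eqv_swap12A => // z /eqP->.
  move=> o /= /or3P[ps|/andP[rt ns]|/andP[ru ns]] ag.
  + by case: s ps o {K ag} => //= a /eqP[<-] [_ [_ [+ _]]]; rewrite (form1_tensor fr).
  + exact: (K false t u).
  + exact: (K true u t).
- move=> o rt ag; move: (o) => /= [ot [ou [fa [S1 [S2 [P1 [P2 D]]]]]]].
  have na : prin1 r != a.
    by apply/eqP => E; move: fa; rewrite -E form1_with.
  have [r1 r2 n1 n2] := with_shared o rt na.
  have [agt agu] := agrees_with ag.
  have [t' e lt] := IHt ot r1 agt; have [u' e' lt'] := IHu ou r2 agu.
  have e1 := eqv_with e e' o; have o1 := eqv_ok e1 o.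
  exists (RWith a t' u'); last by rewrite /= ltnS -addSn leq_add // ltnW.
  apply: (eqv_trans e1); apply: eqv_swapW1A => // z /eqP->.
  + have := S1 _ (eqxx _); rewrite (eqv_res e) /= => /orP[/eqP[E]|/andP[] //].
    by rewrite E eqxx in n1.
  + have := S2 _ (eqxx _); rewrite (eqv_res e') /= => /orP[/eqP[E]|/andP[] //].
    by rewrite E eqxx in n2.
Qed.

(** Passing a binary rule copies its other premise, so each of the two new premises is smaller than
    [t], although their total size need not be. *)
Lemma inv_with a t : ok t -> formW G a -> res t (inl a) ->
  exists t1 t2, eqv t (RWith a t1 t2) /\ (tsize t1 < tsize t)%N /\ (tsize t2 < tsize t)%N.
Proof.
move=> o fa; elim: t o => [x y|s t IH|s t IHt u IHu|b t IHt u IHu].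
- by move=> /= + /orP[]/eqP[] E; rewrite -E; [case: (formW_ax y fa) => ->|case: (formW_ax x fa) => _ ->].
- move=> o rt; move: (o) => /= [ot [fs [S P]]].
  move: rt => /= /orP[/eqP[E]|/andP[rt ns]].
    by move: fa; rewrite E form1_with.
  have [t1 [t2 [e [l1 l2]]]] := IH ot rt.
  have e1 := eqv_rule1 e o; have o1 := eqv_ok e1 o.
  exists (Rule1 s t1), (Rule1 s t2); split; last by [].
  by apply: (eqv_trans e1); apply: eqv_swapW1B => // z /eqP->.
- have K k x y : (ok x -> res x (inl a) ->
      exists t1 t2, eqv x (RWith a t1 t2) /\ (tsize t1 < tsize x)%N /\ (tsize t2 < tsize x)%N) ->
      ok (side k s x y) -> res x (inl a) -> ~~ sub2 k s (inl a) ->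
      exists t1 t2, eqv (side k s x y) (RWith a t1 t2) /\
        (tsize t1 < tsize (side k s x y))%N /\ (tsize t2 < tsize (side k s x y))%N.
    move=> IH o rx ns; have [x1 [x2 [e [l1 l2]]]] := IH (ok_sideL o) rx.
    have e1 := eqv_side e o; have o1 := eqv_ok e1 o.
    exists (side k s x1 y), (side k s x2 y); rewrite !tsize_side !ltn_add2r; split=> //.
    by apply: (eqv_trans e1); apply: eqv_swapW2B => // z /eqP->.
  move=> o /= /or3P[ps|/andP[rt ns]|/andP[ru ns]].
  + by case: s ps o {K} => //= c /eqP[<-] [_ [_ [+ _]]]; rewrite (formW_tensor fa).
  + exact: (K false t u).
  + exact: (K true u t).
- move=> o rt; move: (o) => /= [ot [ou [fb [S1 [S2 [P1 [P2 D]]]]]]].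
  have [ab|nab] := eqVneq a b.
    exists t, u; rewrite ab /= !ltnS leq_addr leq_addl; split=> //; exact: eqv_refl.
  have [r1 r2 n1 n2] := with_shared o rt nab.
  have [t1 [t2 [e [l1 l2]]]] := IHt ot r1; have [u1 [u2 [e' [l1' l2']]]] := IHu ou r2.
  have e1 := eqv_with e e' o; have o1 := eqv_ok e1 o.
  exists (RWith b t1 u1), (RWith b t2 u2); split; last first.
    by rewrite /= !ltnS -!addSn !leq_add // ltnW.
  apply: (eqv_trans e1); apply: eqv_swapWW => // z /eqP->.
  + have := S1 _ (eqxx _); rewrite (eqv_res e) => h.
    by have [|-> ->] := with_shared (eqv_ok e ot) h; rewrite // eq_sym.
  + have := S2 _ (eqxx _); rewrite (eqv_res e') => h.
    by have [|-> ->] := with_shared (eqv_ok e' ou) h; rewrite // eq_sym.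
Qed.

End Inversion.

(** * Colourings of vertices *)

Definition col (chi : vertex -> bool) (k : bool) (x : resource) : Prop :=
  forall w, cone x w -> chi w = k.

Definition colt (chi : vertex -> bool) (k : bool) (t : tree) : Prop :=
  forall x, res t x -> col chi k x.

Definition slice (chi : vertex -> bool) (k : bool) (l : linking) : linking :=
  [fset e in l | all (fun w => chi w == k) (enum_fset e)].

Lemma in_slice chi k (l : linking) e :
  e \in slice chi k l <-> e \in l /\ forall w, w \in e -> chi w = k.
Proof.
rewrite /slice !inE /=; split.
- by case/andP=> -> /allP H; split=> // w /H/eqP.
- by case=> -> H; apply/allP => w /H ->.
Qed.

Lemma col_disj chi k j x : col chi k x -> col chi j x -> k = j.
Proof. by have [w cw] := cone_inhab x; move=> /(_ _ cw) <- /(_ _ cw). Qed.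

Lemma col_neq chi k x : col chi k x -> col chi (~~ k) x -> False.
Proof. by move=> H /(col_disj H); case: k {H}. Qed.

Lemma sliceU chi k l l' : slice chi k (l `|` l') = slice chi k l `|` slice chi k l'.
Proof. by apply/fsetP => e; rewrite /slice !inE andb_orl. Qed.

Lemma lv_slice chi k l w : lv (slice chi k l) w -> lv l w.
Proof. by case=> e /in_slice[? _]; exists e. Qed.

Lemma slice_id chi k (l : linking) : (forall w, lv l w -> chi w = k) -> slice chi k l = l.
Proof.
move=> H; apply/fsetP => e; apply/idP/idP => [/in_slice[]//|h].
by apply/in_slice; split=> // w we; apply: H; exists e.
Qed.

Lemma slice_none chi k (l : linking) : (forall e, e \in l -> exists w, w \in e) ->
  (forall w, lv l w -> chi w = ~~ k) -> slice chi k l = fset0.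
Proof.
move=> N H; apply/fsetP => e; rewrite inE; apply/negP => /in_slice[h H'].
have [w we] := N _ h; have := H' _ we; rewrite (H w); first by case: k {H H'}.
by exists e.
Qed.

Definition mono (chi : vertex -> bool) (l : linking) : Prop :=
  forall e, e \in l -> exists k, forall w, w \in e -> chi w = k.

Lemma slice_mono chi k l : mono chi l -> slice chi k l `|` slice chi (~~ k) l = l.
Proof.
move=> H; apply/fsetP => e; rewrite inE; apply/orP/idP => [[]/in_slice[]//|h].
have [j hj] := H _ h; have [->|nk] := eqVneq k j; [left|right]; apply/in_slice; split=> //.
by move=> w /hj ->; case: k j nk {hj} => [] [].
Qed.

(* What the linkings of a proof ending with a binary rule retain of the way this
   rule splits its context. *)
Definition splits chi (t : tree) : Prop :=
  (forall l, lnk t l -> mono chi l) /\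
  (forall k l l', lnk t l -> lnk t l' ->
    lnk t (slice chi k l `|` slice chi (~~ k) l')).

Notation untag := (map (snd : bool * tree -> tree)).

Section Splitting.
Variables (m : bool) (G : seq form).
Notation ok := (ok m G).
Notation eqv := (eqv m G).

Lemma colt_lv chi k t l w : ok t -> colt chi k t -> lnk t l -> lv l w -> chi w = k.
Proof. by move=> o C tl lw; have [x /C] := lnk_sup o tl lw; apply. Qed.

Lemma colt_slice chi k t l : ok t -> colt chi k t -> lnk t l -> slice chi k l = l.
Proof. by move=> o C tl; apply: slice_id => w; apply: colt_lv o C tl. Qed.

Lemma colt_sliceN chi k t l : ok t -> colt chi (~~ k) t -> lnk t l -> slice chi k l = fset0.
Proof.
move=> o C tl; apply: slice_none => [e|w]; last exact: colt_lv o C tl.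
exact: lnk_link tl.
Qed.

(** In a union of linkings of premises of opposite colours, slicing keeps one summand and erases the
    other. *)
Lemma lnk_split chi j k r x y l : ok x -> ok y -> colt chi j x -> colt chi (~~ j) y ->
  lnk (side k r x y) l ->
  lnk x (slice chi j l) /\ lnk y (slice chi (~~ j) l).
Proof.
move=> ox oy Cx Cy /lnk_side[l1 [l2 [h1 [h2 ->]]]]; rewrite !sliceU.
rewrite (colt_slice ox Cx h1) (colt_sliceN oy Cy h2).
rewrite (colt_sliceN (k := ~~ j) ox _ h1) ?negbK // (colt_slice oy Cy h2).
by rewrite fsetU0 fset0U.
Qed.

Lemma above_colt k r x y : ok (side k r x y) -> anti (res (side k r x y)) ->
  colt (above y) true y /\ colt (above y) false x.
Proof.
move=> o H; split=> z hz w cw; first by apply/aboveP; exists z.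
apply/negbTE/aboveP => -[z' hz' cw']; exact: (sep_side o H hz hz' cw cw').
Qed.

Lemma splits_colt k j r chi x y : ok (side k r x y) -> colt chi j x -> colt chi (~~ j) y ->
  splits chi (side k r x y).
Proof.
move=> o Cx Cy; have [ox oy] := (ok_sideL o, ok_sideR o); split.
- move=> l /lnk_side[l1 [l2 [h1 [h2 ->]]]] e; rewrite inE => /orP[h|h].
  + by exists j => w we; apply: (colt_lv ox Cx h1); exists e.
  + by exists (~~ j) => w we; apply: (colt_lv oy Cy h2); exists e.
- move=> i l l' h h'.
  have [hx hy] := lnk_split ox oy Cx Cy h; have [hx' hy'] := lnk_split ox oy Cx Cy h'.
  have [->|ni] := eqVneq i j.
    by apply/lnk_side; exists (slice chi j l), (slice chi (~~ j) l').
  have -> : i = ~~ j by case: i j ni {Cx Cy hx hy hx' hy'} => [] [].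
  rewrite negbK fsetUC.
  by apply/lnk_side; exists (slice chi j l'), (slice chi (~~ j) l).
Qed.

(** A fixed linking [u] of the other premise turns linkings of [x] into linkings of the whole tree.
    Recombination along [chi] gives back all of [u], and the colouring [above y] then removes it. *)
Lemma splits_side k r x y chi : ok (side k r x y) -> anti (res (side k r x y)) ->
  splits chi (side k r x y) -> splits chi x.
Proof.
move=> o H [M P]; have [Cy Cx] := above_colt o H.
have [ox oy] := (ok_sideL o, ok_sideR o); have [u hu] := lnk_ex y.
have U l : lnk x l -> lnk (side k r x y) (l `|` u) by move=> h; apply/lnk_side; exists l, u.
split=> [l /U/M h e he|j l l' h h']; first by apply: h; rewrite inE he.
have := P j _ _ (U _ h) (U _ h'); rewrite !sliceU.
have -> : slice chi j l `|` slice chi j u `|` (slice chi (~~ j) l' `|` slice chi (~~ j) u)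
  = (slice chi j l `|` slice chi (~~ j) l') `|` u.
  by rewrite fsetUACA slice_mono // => e he; apply: (M _ (U _ h)); rewrite inE he orbT.
case/(lnk_split (j := false) ox oy Cx Cy) => + _.
rewrite sliceU [slice (above y) false u](colt_sliceN (k := false) oy Cy hu) fsetU0.
rewrite slice_id // => w /lvU[] /lv_slice; exact: colt_lv ox Cx _.
Qed.

Lemma splits_side2 k r x y chi : ok (side k r x y) -> anti (res (side k r x y)) ->
  splits chi (side k r x y) -> splits chi y.
Proof. by rewrite sideC; apply: splits_side. Qed.

Lemma splits_lnk chi t u : (forall l, lnk t l <-> lnk u l) -> splits chi t -> splits chi u.
Proof.
move=> E [M P]; split=> [l /E/M //|k l l' /E h /E h'].
by apply/E; apply: P.
Qed.

Lemma with_cross chi i j k a t u l l' : ok (RWith a t u) -> anti (res (RWith a t u)) ->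
  col chi k (inl a) -> splits chi (RWith a t u) ->
  lnk (if i then u else t) l -> lnk (if j then u else t) l' ->
  lnk (if j then u else t) (slice chi k l' `|` slice chi (~~ k) l).
Proof.
move=> o H C [M P] h h'.
have K b l0 : lnk (if b then u else t) l0 -> lnk (RWith a t u) l0.
  by case: b => ?; apply/lnk_with; [right|left].
have oj b : ok (if b then u else t) by case: b; case: o => ? [].
have [w lw cw] := lnk_cov (oj j) h' (with_child j o) isT.
have lL : lv (slice chi k l' `|` slice chi (~~ k) l) w.
  apply/lvU; left; case: lw => e he we; exists e => //; apply/in_slice; split=> // w' we'.
  have [c hc] := M _ (K _ _ h') _ he; rewrite (hc _ we') -(hc _ we).
  by apply: C; apply: cone_child cw.
have N : ~ lnk (if ~~ j then u else t) (slice chi k l' `|` slice chi (~~ k) l).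
  move=> hN; have [x rx cx] := lnk_sup (oj (~~ j)) hN lL.
  by have := sep_with o H rx cx; rewrite negbK cw.
have := P k _ _ (K _ _ h') (K _ _ h) => /lnk_with[]; case: j N {h' lw cw lL} => //= N h'; by case: N.
Qed.

Lemma splits_with chi j k a t u : ok (RWith a t u) -> anti (res (RWith a t u)) ->
  col chi k (inl a) -> splits chi (RWith a t u) -> splits chi (if j then u else t).
Proof.
move=> o H C S; have K := with_cross (i := j) (j := j) o H C S; split=> [l h|i l l' h h'].
  by apply: (proj1 S); apply/lnk_with; case: j {K} h; [right|left].
have [->|ni] := eqVneq i k; first exact: K.
have -> : i = ~~ k by case: i k ni {C K} => [] [].
by rewrite negbK fsetUC; apply: K.
Qed.

(** * Mixes of several proofs *)

Definition dummy : tree := Ax (Concl 0, [::]) (Concl 0, [::]).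

Fixpoint mix1 (x : tree) (l : seq tree) : tree :=
  if l is y :: l' then Rule2 RMix x (mix1 y l') else x.

Definition mix (l : seq tree) : tree := if l is x :: l' then mix1 x l' else dummy.

(** The empty mix is [dummy], an axiom linking a vertex to itself, which is never valid. *)
Lemma ok_mix_neq0 l : ok (mix l) -> l <> [::].
Proof. by move=> + E; rewrite E /= /form0; case: (form_at G _) => // -[] // []. Qed.

Lemma mix_cons x y l : mix (x :: y :: l) = side false RMix x (mix (y :: l)).
Proof. by []. Qed.

Lemma eqv_sideR k r x y y' : eqv y y' -> ok (side k r x y) -> eqv (side k r x y) (side k r x y').
Proof. by move=> e o; apply: eqv_side2 => //; apply: eqv_refl. Qed.

Lemma eqv_assoc x y z : ok (Rule2 RMix (Rule2 RMix x y) z) ->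
  eqv (Rule2 RMix (Rule2 RMix x y) z) (Rule2 RMix x (Rule2 RMix y z)).
Proof. by move=> o; apply: (eqv_swap22 (j := false) (k := true)). Qed.

Lemma eqv_assocV x y z : ok (Rule2 RMix x (Rule2 RMix y z)) ->
  eqv (Rule2 RMix x (Rule2 RMix y z)) (Rule2 RMix (Rule2 RMix x y) z).
Proof. by move=> o; apply: (eqv_swap22 (j := true) (k := false) (x := y)). Qed.

Lemma mix_cat x l y l' : ok (Rule2 RMix (mix (x :: l)) (mix (y :: l'))) ->
  eqv (Rule2 RMix (mix (x :: l)) (mix (y :: l'))) (mix (x :: l ++ y :: l')).
Proof.
elim: l x => [|z l IH] x o; first exact: eqv_refl.
have e := eqv_assoc (x := x) (y := mix (z :: l)) o; have o' := eqv_ok e o.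
apply: (eqv_trans e); apply: (eqv_sideR (k := false)) => //; apply: IH.
exact: (ok_sideR (k := false) o').
Qed.

Lemma mix_catV x l y l' : ok (mix (x :: l ++ y :: l')) ->
  eqv (mix (x :: l ++ y :: l')) (Rule2 RMix (mix (x :: l)) (mix (y :: l'))).
Proof.
elim: l x => [|z l IH] x o; first exact: eqv_refl.
have e := eqv_sideR (k := false) (IH z (ok_sideR (k := false) o)) o.
apply: (eqv_trans e); apply: (eqv_assocV (y := mix (z :: l))).
exact: (eqv_ok e o).
Qed.

(** If [m] fails, validity of [mix l] leaves only singletons; working with valid mixes thus covers
    the systems with and without the mix rule at once. *)
Lemma mix_perm l l' : Permutation l l' -> ok (mix l) -> eqv (mix l) (mix l').
Proof.
elim=> {l l'} [|x l l' p IH|x y l|l1 l2 l3 _ IH1 _ IH2] o.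
- exact: eqv_refl.
- case: l p IH o => [/Permutation_nil-> _ _|y l p IH o]; first exact: eqv_refl.
  case: l' p IH => [/Permutation_sym/Permutation_nil//|y' l' p IH].
  by apply: (eqv_sideR (k := false)) => //; apply: IH; apply: (ok_sideR (k := false) o).
- case: l o => [|z l] o; first exact: (eqv_flip (k := false)).
  exact: (eqv_swap22 (j := true) (k := true) (x := mix (z :: l))).
- by apply: (eqv_trans (IH1 o)); apply: IH2; apply: eqv_ok (IH1 o) o.
Qed.

Lemma mix_head x x' l : eqv x x' -> ok (mix (x :: l)) -> eqv (mix (x :: l)) (mix (x' :: l)).
Proof. by case: l => [|y l] e o //; apply: (eqv_side (k := false)). Qed.

(** The summands other than [x] contribute nothing active to [s], so they can be mixed in below
    it. *)
Lemma float j s x y l : ok (side j s (mix (x :: l)) y) -> (forall z, sub2 j s z -> res x z) ->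
  eqv (side j s (mix (x :: l)) y) (mix (side j s x y :: l)).
Proof.
case: l => [|t l] o H; first exact: eqv_refl.
exact: (eqv_swap22 (k := false)).
Qed.

Lemma floatV j s x y l : ok (mix (side j s x y :: l)) ->
  eqv (mix (side j s x y :: l)) (side j s (mix (x :: l)) y).
Proof.
case: l => [|t l] o; first exact: eqv_refl.
exact: (eqv_swap22 (j := false)).
Qed.

Lemma mix_flat x l l' : ok (mix (mix (x :: l) :: l')) ->
  eqv (mix (mix (x :: l) :: l')) (mix (x :: l ++ l')).
Proof. by case: l' => [|y l'] o; [rewrite cats0; apply: eqv_refl|apply: mix_cat]. Qed.

Lemma mix_flatV x l l' : ok (mix (x :: l ++ l')) ->
  eqv (mix (x :: l ++ l')) (mix (mix (x :: l) :: l')).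
Proof. by case: l' => [|y l'] o; [rewrite cats0; apply: eqv_refl|apply: mix_catV]. Qed.

Lemma float2 j s x y l l' : ok (side j s (mix (x :: l)) (mix (y :: l'))) ->
  (forall z, sub2 j s z -> res x z) -> (forall z, sub2 (~~ j) s z -> res y z) ->
  eqv (side j s (mix (x :: l)) (mix (y :: l'))) (mix (side j s x y :: l' ++ l)).
Proof.
move=> o H H'; have e := float o H; have o1 := eqv_ok e o; apply: (eqv_trans e).
have e1 : eqv (mix (side j s x (mix (y :: l')) :: l)) (mix (mix (side j s x y :: l') :: l)).
  apply: mix_head => //; rewrite sideC [side j s x y]sideC; apply: float => //.
  rewrite -sideC; move: o1; case: l {o e} => [//|t l].
  exact: (ok_sideL (k := false)).
by apply: (eqv_trans e1); apply: mix_flat; apply: eqv_ok e1 o1.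
Qed.

Lemma float2V j s x y l l' : ok (mix (side j s x y :: l' ++ l)) ->
  eqv (mix (side j s x y :: l' ++ l)) (side j s (mix (x :: l)) (mix (y :: l'))).
Proof.
move=> o; have e := mix_flatV o; have o1 := eqv_ok e o; apply: (eqv_trans e).
have e1 : eqv (mix (mix (side j s x y :: l') :: l)) (mix (side j s x (mix (y :: l')) :: l)).
  apply: mix_head => //; rewrite sideC [side j s x (mix _)]sideC; apply: floatV.
  rewrite -sideC; move: o1; case: l {o e} => [//|t l].
  exact: (ok_sideL (k := false)).
by apply: (eqv_trans e1); apply: floatV; apply: eqv_ok e1 o1.
Qed.

Lemma res_mix x l z : res (mix (x :: l)) z <-> exists2 t, List.In t (x :: l) & res t z.
Proof.
elim: l x => [|y l IH] x.
  by split=> [h|[t [<-|[]]]] //; exists x => //; left.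
rewrite mix_cons res_side /= !andbT; split=> [/orP[h|/IH[t h ?]]|[t [<- ->|h ?]] //].
- by exists x => //; left.
- by exists t => //; right.
- by apply/orP; right; apply/IH; exists t.
Qed.

Lemma tsize_mix x l : tsize (mix (x :: l)) = sumn (map tsize (x :: l)).
Proof. by elim: l x => [|y l IH] x; [rewrite /= addn0|rewrite mix_cons tsize_side IH]. Qed.

Lemma ok_mix l x : ok (mix l) -> List.In x l -> ok x.
Proof.
case: l => [//|y l]; elim: l y => [|z l IH] y o; first by case=> [<-|[]].
by case=> [<-|]; [apply: (ok_sideL (k := false) o)|apply: IH; apply: (ok_sideR (k := false) o)].
Qed.

(** * Decompositions into monochromatic pieces *)

Definition coloured chi (l : seq (bool * tree)) := forall p, List.In p l -> colt chi p.1 p.2.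

Definition weight (l : seq tree) := sumn (map tsize l).

(** A list is used because a colour may own several pieces or none. The size bound is an inequality,
    since merging two copies of a piece across a with discards one of them. *)
Definition decomposes chi t (l : seq (bool * tree)) :=
  eqv t (mix (untag l)) /\ coloured chi l /\ (weight (untag l) <= tsize t)%N.

Lemma weight_perm l l' : Permutation l l' -> weight l = weight l'.
Proof.
rewrite /weight; elim=> //= [x {}l {}l' _ ->|x y {}l|l1 l2 l3 _ -> _ ->] //.
by rewrite addnCA.
Qed.

Lemma weight_cat l l' : weight (l ++ l') = (weight l + weight l')%N.
Proof. by rewrite /weight map_cat sumn_cat. Qed.

Lemma perm_filter (T : Type) (P : pred T) (l : seq T) :
  Permutation l (filter P l ++ filter (predC P) l).
Proof.
elim: l => //= x l IH; case: (P x) => /=; first exact: perm_skip.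
exact: Permutation_trans (perm_skip x IH) (Permutation_middle _ _ _).
Qed.

Lemma in_filter (T : Type) (P : pred T) (l : seq T) x :
  List.In x (filter P l) -> List.In x l /\ P x.
Proof.
elim: l => //= y l IH; case Py: (P y) => /=; last by move/IH=> [? ?]; split=> //; right.
by case=> [<-|/IH[? ?]]; split=> //; [left|right].
Qed.

Lemma in_perm (T : Type) (x : T) l : List.In x l -> exists l', Permutation l (x :: l').
Proof.
move=> /(List.in_split _ _)[l1 [l2 ->]]; exists (l1 ++ l2).
exact/Permutation_sym/Permutation_middle.
Qed.

Lemma in_untag x l : List.In x (untag l) -> exists k, List.In (k, x) l.
Proof.
elim: l => //= -[k y] l IH [/= <-|/IH[j ?]]; first by exists k; left.
by exists j; right.
Qed.

Lemma dec_pick chi k t l e : decomposes chi t l -> ok t -> res t e -> col chi k e ->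
  exists x l', Permutation l ((k, x) :: l') /\ res x e.
Proof.
move=> [E [C _]] o te ce; move: te; rewrite (eqv_res E) => te.
have [x xl xe] : exists2 x, List.In x (untag l) & res x e.
  by case: l E C te => [/eqv_ok/(_ o)/ok_mix_neq0//|p l _ _ /res_mix].
have [j jl] := in_untag xl; have [l' p] := in_perm jl.
exists x, l'; split=> //; rewrite (col_disj ce (C _ jl _ xe)) //.
Qed.

Lemma dec_perm chi t l l' : ok t -> Permutation l l' -> decomposes chi t l -> decomposes chi t l'.
Proof.
move=> o p [E [C W]]; have p' := Permutation_map (snd : bool * tree -> tree) p.
split; first by apply: (eqv_trans E); apply: mix_perm => //; apply: eqv_ok E o.
split; first by move=> q /(Permutation_in _ (Permutation_sym p))/C.
by rewrite -(weight_perm p').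
Qed.

End Splitting.

(** * Gathering pieces of equal colour *)

Section Coherence.
Variables (m : bool) (G : seq form).
Notation ok := (ok m G).
Notation eqv := (eqv m G).
Notation decomposes := (decomposes m G).

Definition part k (l : seq (bool * tree)) := untag (filter (fun p => p.1 == k) l).

Lemma part_perm k l : Permutation (untag l) (part k l ++ part (~~ k) l).
Proof.
rewrite /part -map_cat; apply: Permutation_map.
have -> : [seq p <- l | p.1 == ~~ k] = [seq p <- l | predC (fun p => p.1 == k) p].
  by apply: eq_filter => p /=; case: (p.1) k => [] [].
exact: perm_filter.
Qed.

Lemma part_colt chi k l x : coloured chi l -> List.In x (part k l) -> colt chi k x.
Proof.
move=> C; rewrite /part => h; have [j h'] := in_untag h.
by have [jl /= /eqP <-] := in_filter h'; apply: C jl.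
Qed.

Lemma mix_colt chi k l : l <> [::] -> (forall x, List.In x l -> colt chi k x) -> colt chi k (mix l).
Proof. by case: l => [//|x l] _ H z /res_mix[t /H]; apply. Qed.

Lemma colt_side chi k j r x y : colt chi k x -> colt chi k y ->
  (forall p, prin2 r p -> col chi k p) -> colt chi k (side j r x y).
Proof. by move=> Cx Cy P z; rewrite res_side => /or3P[/P|/andP[/Cx]|/andP[/Cy]]. Qed.

(** Par, plus and with have a single colour and act on one premise of that colour; at most one
    remainder, of the other colour, is left to be moved past the rule. *)
Lemma dec_merge chi k t l e : decomposes chi t l -> ok t -> res t e -> col chi k e ->
  exists x ys, eqv t (mix (x :: ys)) /\ colt chi k x /\
    (ys = [::] \/ exists2 y, ys = [:: y] & colt chi (~~ k) y) /\
    (weight (x :: ys) <= tsize t)%N.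
Proof.
move=> D o te ce; have [x0 [l' [p _]]] := dec_pick D o te ce.
have {D te ce e} [E [C W]] := dec_perm o p D; move: {l p}l' E C W => l' E C W.
set l := (k, x0) :: l' in E C W.
have [z [lk Ek]] : exists z lk, part k l = z :: lk by rewrite /part /l /= eqxx; do 2 eexists.
have e1 : eqv t (mix (part k l ++ part (~~ k) l)).
  by apply: (eqv_trans E); apply: mix_perm (part_perm _ _) _; apply: eqv_ok E o.
have w1 : (weight (part k l ++ part (~~ k) l) <= tsize t)%N by rewrite -(weight_perm (part_perm k l)).
have Ck : colt chi k (mix (part k l)).
  by apply: mix_colt => [|x]; [rewrite Ek|apply: part_colt C].
case En : (part (~~ k) l) e1 w1 => [|y ln] e1 w1.
  rewrite cats0 in e1 w1; exists (mix (part k l)), [::]; split=> //; split=> //; split; first by left.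
  by move: w1; rewrite Ek /weight /= tsize_mix addn0.
have Cn : colt chi (~~ k) (mix (part (~~ k) l)).
  by apply: mix_colt => [|x]; [rewrite En|apply: part_colt C].
exists (mix (part k l)), [:: mix (part (~~ k) l)]; split; last first.
  split=> //; split; first by right; exists (mix (part (~~ k) l)).
  by move: w1; rewrite weight_cat Ek En /weight /= !tsize_mix addn0.
apply: (eqv_trans e1); rewrite En Ek /=; apply: mix_catV.
by rewrite -[mix _]/(mix ((z :: lk) ++ y :: ln)) -Ek; apply: eqv_ok e1 o.
Qed.

(** Each stray piece is absorbed by the premise of its own colour, so that the mixes disappear into
    the premises and [r] becomes the last rule. *)
Lemma collect chi k r x y l : ok (mix (side k r x y :: untag l)) -> coloured chi l ->
  colt chi k x -> colt chi (~~ k) y ->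
  exists X Y, eqv (mix (side k r x y :: untag l)) (side k r X Y) /\
    colt chi k X /\ colt chi (~~ k) Y /\
    (tsize X + tsize Y = weight (x :: y :: untag l))%N.
Proof.
move=> o C Cx Cy; have p := part_perm (~~ k) l; rewrite negbK in p.
have e1 := mix_perm (perm_skip (side k r x y) p) o.
exists (mix (x :: part k l)), (mix (y :: part (~~ k) l)); split.
  by apply: (eqv_trans e1); apply: float2V; apply: eqv_ok e1 o.
split; first by apply: mix_colt => // z [<-//|]; apply: part_colt.
split; first by apply: mix_colt => // z [<-//|]; apply: part_colt.
rewrite !tsize_mix -!/(weight _) -[weight (x :: y :: _)]/(tsize x + (tsize y + weight (untag l)))%N.
rewrite (weight_perm p) weight_cat -[weight (x :: _)]/(tsize x + weight _)%N.
by rewrite -[weight (y :: _)]/(tsize y + weight _)%N -!addnA; congr addn; rewrite addnCA; congr addn; rewrite addnC.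
Qed.

(** The induction hypothesis of [coherent], isolated here because the rearrangement of one proof
    needs it for the subproofs on both sides of a with. *)
Definition coherent_below n := forall p q, (tsize p + tsize q < n)%N ->
  ok p -> ok q -> anti (res p) -> res p =1 res q -> (forall l, lnk p l <-> lnk q l) -> eqv p q.

Lemma anti_ext (S S' : resource -> bool) : S =1 S' -> anti S -> anti S'.
Proof. by move=> E H x y w; rewrite -!E; apply: H. Qed.

Lemma eqv_anti t u : eqv t u -> anti (res t) -> anti (res u).
Proof. by move/eqv_res; apply: anti_ext. Qed.

(* By recombination of monochromatic parts, what is linked away from the principal
   formula of a with does not depend on the chosen premise. *)
Lemma with_factor chi k j r b t1 t2 x1 y1 x2 y2 :
  ok (RWith b t1 t2) -> anti (res (RWith b t1 t2)) -> col chi k (inl b) ->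
  splits chi (RWith b t1 t2) -> (forall p, prin2 r p -> res (RWith b t1 t2) p) ->
  eqv t1 (side j r x1 y1) -> eqv t2 (side j r x2 y2) ->
  colt chi k x1 -> colt chi (~~ k) y1 -> colt chi k x2 -> colt chi (~~ k) y2 ->
  (forall l, lnk y1 l <-> lnk y2 l) /\ res y1 =1 res y2.
Proof.
move=> o H Cb S P e1 e2 Cx1 Cy1 Cx2 Cy2.
have [o1 o2] : ok t1 /\ ok t2 by case: o => ? [].
have os1 := eqv_ok e1 o1; have os2 := eqv_ok e2 o2.
pose T i := if i then t2 else t1; pose X i := if i then x2 else x1; pose Y i := if i then y2 else y1.
have e i : eqv (T i) (side j r (X i) (Y i)) by case: i.
have CX i : colt chi k (X i) by case: i.
have CY i : colt chi (~~ k) (Y i) by case: i.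
have oS i : ok (side j r (X i) (Y i)) by case: i.
have oT i : ok (T i) by case: i.
(* In a linking of [T i'], the part of colour [~~ k] is replaced by [l]; by [with_cross] the result
   is still a linking of [T i']. *)
have L i i' l : lnk (Y i) l -> lnk (Y i') l.
  move=> hl; have [l1 hl1] := lnk_ex (X i); have [l2 hl2] := lnk_ex (X i').
  have [l3 hl3] := lnk_ex (Y i').
  have h : lnk (T i) (l1 `|` l) by apply/(eqv_lnk (e i))/lnk_side; exists l1, l.
  have h' : lnk (T i') (l2 `|` l3) by apply/(eqv_lnk (e i'))/lnk_side; exists l2, l3.
  have := with_cross o H Cb S h h'; rewrite !sliceU.
  rewrite (colt_slice (ok_sideL (oS i')) (CX i') hl2).
  rewrite (colt_sliceN (ok_sideR (oS i')) (CY i') hl3) fsetU0.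
  rewrite (colt_sliceN (k := ~~ k) (ok_sideL (oS i)) _ hl1) ?negbK // fset0U.
  rewrite (colt_slice (ok_sideR (oS i)) (CY i) hl) => /(eqv_lnk (e i')).
  case/(lnk_split (ok_sideL (oS i')) (ok_sideR (oS i')) (CX i') (CY i')) => _.
  rewrite sliceU (colt_slice (ok_sideR (oS i)) (CY i) hl).
  by rewrite (colt_sliceN (k := ~~ k) (ok_sideL (oS i')) _ hl2) ?negbK // fset0U.
split=> [l|z]; first by split; [apply: (L false true)|apply: (L true false)].
have R i i' w : res (Y i) w -> res (Y i') w.
  move=> hw; have [sw|nw] := boolP (sub2 (~~ j) r w).
    by move: (oS i') => /ok_side[_ [_ [_ [_ [S2 _]]]]]; apply: S2.
  have Tw : res (T i) w by rewrite (eqv_res (e i)) res_side hw nw !orbT.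
  have wb c : w != inl (child c b).
    apply/eqP => E; apply: (@col_neq chi k w); last exact: CY hw.
    by rewrite E => v cv; apply: Cb; apply: cone_child cv.
  have wS : res (RWith b t1 t2) w.
    by move: Tw; rewrite /T /=; case: (i) => ->; rewrite !wb ?orbT.
  case vw : (is_vertex w).
    have Tw' : res (T i') w.
      move: (o) => [_ [_ [_ [_ [_ [_ [_ D]]]]]]]; have := addb_eq (D w vw); rewrite !wb // !andbT.
      by move: Tw; rewrite /T; case: (i) (i') => [] [] ->.
    move: Tw'; rewrite (eqv_res (e i')) res_side => /or3P[pw|/andP[/(CX i') h _]|/andP[]//].
      by move: (oS i) => /ok_side[_ [_ [_ [_ [_ [_ [P2 _]]]]]]]; move: (P2 _ pw); rewrite res_foot.
    by case: (col_neq h); apply: CY hw.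
  (* The cut [w] could occur in one premise only. Through the common linkings, a leaf above it also
     lies above some [w'] on the other side, and [anti] identifies [w] with [w']. *)
  have [l [hl [v lv_ cv]]] := lnk_tch (ok_sideR (oS i)) hw.
  have [w' hw' cv'] := lnk_sup (ok_sideR (oS i')) (L _ i' _ hl) lv_.
  suff -> : w = w' by [].
  have [sw|nw'] := boolP (sub2 (~~ j) r w').
    have [p pp cp] := cone_sub2 sw cv'.
    have E := H _ _ _ wS (P _ pp) cv cp.
    move: (oS i) => /ok_side[_ [_ [_ [_ [_ [_ [P2 _]]]]]]]; move: (P2 _ pp).
    by rewrite -E res_foot.
  apply: (H _ _ _ wS _ cv cv').
  have Tw' : res (T i') w' by rewrite (eqv_res (e i')) res_side hw' nw' !orbT.
  have wb' c : w' != inl (child c b).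
    apply/eqP => E; apply: (@col_neq chi k w'); last exact: CY hw'.
    by rewrite E => u cu; apply: Cb; apply: cone_child cu.
  by move: Tw'; rewrite /T /=; case: (i') => ->; rewrite !wb' ?orbT.
by apply/idP/idP; [apply: (R false true)|apply: (R true false)].
Qed.

End Coherence.

(** * Splitting a proof along a colouring *)

Section Rearrangement.
Variables (m : bool) (G : seq form).
Notation ok := (ok m G).
Notation eqv := (eqv m G).
Notation decomposes := (decomposes m G).
Notation coherent_below := (coherent_below m G).

Lemma coloured_sub1 chi k r z : col chi k (inl (prin1 r)) -> sub1 r z -> col chi k z.
Proof. by move=> H sz w cw; apply: H; apply: cone_sub1 sz cw. Qed.

Lemma coloured_sub2 chi j k r p z : col chi k p -> prin2 r p -> sub2 j r z -> col chi k z.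
Proof.
move=> H pp sz w cw; apply: H; have [q pq cq] := cone_sub2 sz cw.
by rewrite (prin2_uniq pp pq).
Qed.

Lemma prin2_nonempty r : r <> RMix -> exists p, prin2 r p.
Proof. by case: r => [a|c A|] // _; eexists; apply: eqxx. Qed.

Lemma sub2_nonempty j r : r <> RMix -> exists p, sub2 j r p.
Proof. by case: r => [a|c A|] // _; eexists; apply: eqxx. Qed.

Lemma mix_ex chi k x ys z : res (mix (x :: ys)) z -> col chi k z ->
  (ys = [::] \/ exists2 y, ys = [:: y] & colt chi (~~ k) y) -> res x z.
Proof.
move=> h cz [E|[y E Cy]]; rewrite E in h => //; move: h => /res_mix[t [<- //|[<-|[]]]] h.
by case: (col_neq cz); apply: Cy.
Qed.

(** The principal resource gives each rule except mix a colour of its own; the rule acts on pieces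
    of that colour, and the others are moved past it. Under a with, the pieces of the other colour
    have the same conclusion and linkings in both premises, so [coherent_below] makes them
    convertible and they merge. *)
Lemma mix_split chi n t : coherent_below n -> (tsize t <= n)%N -> ok t -> anti (res t) ->
  (forall z, res t z -> exists k, col chi k z) -> splits chi t -> exists l, decomposes chi t l.
Proof.
move=> IHn; elim: t => [x y|r t IH|r t IHt u IHu|b t IHt u IHu] le o H C S.
- have [k ck] : exists k, col chi k (inl x) by apply: C; rewrite /= eqxx.
  exists [:: (k, Ax x y)]; split; first exact: eqv_refl.
  split; last by rewrite /weight /=.
  move=> p [<-|[]] z /= /orP[]/eqP-> //.
  have [j cj] : exists k, col chi k (inl y) by apply: C; rewrite /= eqxx orbT.
  have [i hi] : exists k, forall w, w \in [fset x; y] -> chi w = k.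
    by apply: (proj1 S [fset [fset x; y]]); [apply/lnk_ax|rewrite inE].
  suff <- : j = k by [].
  rewrite -(cj y (cone_refl y)) -(ck x (cone_refl x)) !hi // !inE ?eqxx ?orbT //.
- have [k ck] : exists k, col chi k (inl (prin1 r)) by apply: C; rewrite /= eqxx.
  have oo := o; move: (oo) => [ot [_ [Sr _]]].
  have [|||l D] := IH _ ot (anti_rule1 o H).
  + by move: le => /=; lia.
  + move=> z tz; have [sz|nz] := boolP (sub1 r z); first by exists k; apply: coloured_sub1 sz.
    by apply: C; rewrite /= tz nz orbT.
  + by apply: splits_lnk S => l; rewrite lnk_rule1.
  have [e se _] := sub1_ex r.
  have [x [ys [E [Cx [Cy W]]]]] := dec_merge D ot (Sr _ se) (coloured_sub1 ck se).
  have e1 := eqv_rule1 E o; have o1 := eqv_ok e1 o.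
  have Sx z : sub1 r z -> res x z.
    move=> sz; apply: mix_ex Cy; last exact: coloured_sub1 ck sz.
    by rewrite -(eqv_res E); apply: Sr.
  have C1 : colt chi k (Rule1 r x) by move=> z /= /orP[/eqP-> //|/andP[/Cx]].
  case: Cy E W e1 o1 => [->|[y -> Cy]] E W e1 o1.
  + exists [:: (k, Rule1 r x)]; split; first exact: e1.
    split; first by move=> p [<-|[]].
    by move: W; rewrite /weight /=; lia.
  + exists [:: (k, Rule1 r x); (~~ k, y)]; split.
      by apply: (eqv_trans e1); apply: (eqv_swap12B (k := false)).
    split; first by move=> p [<-|[<-|[]]].
    by move: W; rewrite /weight /=; lia.
- have [ot ou] := (ok_sideL (k := false) o, ok_sideR (k := false) o).
  have Cp q : prin2 r q -> exists k, col chi k q by move=> h; apply: C; rewrite /= h.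
  have [|||l D] := IHt _ ot (anti_side (k := false) o H).
  + by move: le => /=; lia.
  + move=> z tz; have [sz|nz] := boolP (sub2 false r z); last by apply: C; rewrite /= tz nz orbT.
    have [w cw] := cone_inhab z; have [q pq _] := cone_sub2 sz cw.
    by have [k ck] := Cp _ pq; exists k; apply: coloured_sub2 ck pq sz.
  + exact: (splits_side (k := false) o H S).
  have [|||l' D'] := IHu _ ou (anti_side2 (k := false) o H).
  + by move: le => /=; lia.
  + move=> z tz; have [sz|nz] := boolP (sub2 true r z); last by apply: C; rewrite /= tz nz !orbT.
    have [w cw] := cone_inhab z; have [q pq _] := cone_sub2 sz cw.
    by have [k ck] := Cp _ pq; exists k; apply: coloured_sub2 ck pq sz.
  + exact: (splits_side2 (k := false) o H S).
  have [rm|rn] : r = RMix \/ r <> RMix by case: (r) => *; [right|right|left].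
    subst r; have e1 := eqv_side2 (k := false) (proj1 D) (proj1 D') o.
    have o1 := eqv_ok e1 o.
    exists (l ++ l'); split; last split.
    + apply: (eqv_trans e1); rewrite map_cat; move: o1.
      have := ok_mix_neq0 (ok_sideL (k := false) (eqv_ok e1 o)).
      have := ok_mix_neq0 (ok_sideR (k := false) (eqv_ok e1 o)).
      case: (untag l) => // x xs; case: (untag l') => // y ys _ _ o1.
      exact: mix_cat.
    + by move=> p /(List.in_app_or _ _ _)[]; [apply: (proj1 (proj2 D))|apply: (proj1 (proj2 D'))].
    + move: (proj2 (proj2 D)) (proj2 (proj2 D')); rewrite map_cat weight_cat /=; lia.
  have [q pq] := prin2_nonempty rn; have [k ck] := Cp _ pq.
  have [e se] := sub2_nonempty false rn; have [e' se'] := sub2_nonempty true rn.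
  move: (o) => [_ [_ [_ [S1 [S2 _]]]]].
  have [x [xs [px xe]]] := dec_pick D ot (S1 _ se) (coloured_sub2 ck pq se).
  have [y [ys [py ye]]] := dec_pick D' ou (S2 _ se') (coloured_sub2 ck pq se').
  have [E [Cl W]] := dec_perm ot px D; have [E' [Cl' W']] := dec_perm ou py D'.
  have e1 := eqv_side2 (k := false) E E' o.
  have e2 : eqv (side false r (mix (untag ((k, x) :: xs))) (mix (untag ((k, y) :: ys))))
     (mix (side false r x y :: untag ys ++ untag xs)).
    apply: float2; first exact: eqv_ok e1 o.
    + by move=> z /(sub2_uniq se) <-.
    + by move=> z /(sub2_uniq se') <-.
  exists ((k, side false r x y) :: ys ++ xs); split; last split.
  + by apply: (eqv_trans e1); rewrite /= map_cat.
  + move=> p [<-|/(List.in_app_or _ _ _)[h|h]]; last 2 first.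
      by apply: Cl'; right.
    by apply: Cl; right.
    apply: colt_side; first by apply: (Cl (k, x)); left.
      by apply: (Cl' (k, y)); left.
    by move=> p' /(prin2_uniq pq) <-.
  + move: W W'; rewrite /= map_cat /weight /= !map_cat !sumn_cat; lia.
- have [k ck] : exists k, col chi k (inl b) by apply: C; rewrite /= eqxx.
  have Ck j : col chi k (inl (child j b)) by move=> w cw; apply: ck; apply: cone_child cw.
  move: (o) => [ot [ou [_ [S1 [S2 _]]]]].
  have [|||l D] := IHt _ ot (anti_with_prem (k := false) o H).
  + by move: le => /=; lia.
  + move=> z tz; have [->|nz] := eqVneq z (inl (child false b)); first by exists k; apply: Ck.
    by apply: C; rewrite /= tz nz orbT.
  + exact: (splits_with false o H ck S).
  have [|||l' D'] := IHu _ ou (anti_with_prem (k := true) o H).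
  + by move: le => /=; lia.
  + move=> z tz; have [->|nz] := eqVneq z (inl (child true b)); first by exists k; apply: Ck.
    by apply: C; rewrite /= tz nz !orbT.
  + exact: (splits_with true o H ck S).
  have [x1 [ys1 [E1 [Cx1 [Cy1 W1]]]]] := dec_merge D ot (S1 _ (eqxx _)) (Ck false).
  have [x2 [ys2 [E2 [Cx2 [Cy2 W2]]]]] := dec_merge D' ou (S2 _ (eqxx _)) (Ck true).
  have Cw : colt chi k (RWith b x1 x2).
    by move=> z /= /or3P[/eqP->|/andP[/Cx1]|/andP[/Cx2]].
  pose T j := if j then u else t.
  have oT j : ok (T j) by case: j.
  (* If only one premise had a part of colour [~~ k], recombination would graft links of that part
     onto a linking of the other premise, all of whose leaves have colour [k]. *)
  have K i j x y x' : eqv (T i) (mix [:: x; y]) -> colt chi (~~ k) y ->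
      eqv (T j) x' -> colt chi k x' -> False.
    move=> E Cy E' Cx'; have o1 := eqv_ok E (oT i); have o2 := eqv_ok E' (oT j).
    have [l1 h1] := lnk_ex x; have [l2 h2] := lnk_ex y; have [l3 h3] := lnk_ex (T j).
    have h : lnk (T i) (l1 `|` l2) by apply/(eqv_lnk E)/lnk_rule2; exists l1, l2.
    have [a al] := lnk_nonempty h2; have [w wa] := lnk_link h2 al.
    have := with_cross o H ck S h h3 => /(eqv_lnk E') h4.
    have := colt_lv o2 Cx' h4 (w := w).
    have Ew : chi w = ~~ k.
      by apply: (colt_lv (ok_sideR (k := false) o1) Cy h2); exists a.
    rewrite Ew => EE; suff : ~~ k = k by case: (k).
    apply: EE; apply/lvU; right; exists a => //; apply/in_slice; split.
      by rewrite inE al orbT.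
    by move=> v va; apply: (colt_lv (ok_sideR (k := false) o1) Cy h2); exists a.
  case: Cy1 E1 W1 => [->|[y1 -> Cy1]] E1 W1; case: Cy2 E2 W2 => [->|[y2 -> Cy2]] E2 W2.
  + have e1 := eqv_with E1 E2 o.
    exists [:: (k, RWith b x1 x2)]; split; first exact: e1.
    split; first by move=> p [<-|[]].
    by move: W1 W2; rewrite /weight /=; lia.
  + by case: (K true false _ _ _ E2 Cy2 E1 Cx1).
  + by case: (K false true _ _ _ E1 Cy1 E2 Cx2).
  + have [L R] := with_factor (j := false) (r := RMix) o H ck S (fun p h => False_ind _ (notF h))
      E1 E2 Cx1 Cy1 Cx2 Cy2.
    have o1 := eqv_ok E1 ot; have o2 := eqv_ok E2 ou.
    have ey : eqv y2 y1.
      apply/eqv_sym/IHn => //.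
      * by move: le W1 W2; rewrite /weight /=; lia.
      * exact: (ok_sideR (k := false) o1).
      * exact: (ok_sideR (k := false) o2).
      * apply: (anti_side2 (k := false) o1); apply: (eqv_anti E1).
        exact: (anti_with_prem (k := false) o H).
    have e1 : eqv (RWith b t u) (RWith b (side false RMix x1 y1) (side false RMix x2 y1)).
      apply: eqv_with o => //; apply: (eqv_trans E2).
      exact: (eqv_sideR (k := false) ey o2).
    exists [:: (k, RWith b x1 x2); (~~ k, y1)]; split; last split.
    * apply: (eqv_trans e1); apply: eqv_swapW2A; first exact: eqv_ok e1 o.
        move=> z /eqP->; have := S1 _ (eqxx _); rewrite (eqv_res E1) => h.
        by apply: mix_ex h (Ck false) _; right; exists y1.
      move=> z /eqP->; have := S2 _ (eqxx _); rewrite (eqv_res E2) => h.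
      by apply: mix_ex h (Ck true) _; right; exists y2.
    * by move=> p [<-|[<-|[]]].
    * by move: W1 W2; rewrite /weight /=; lia.
Qed.

(* A cut on [A] and a cut on [dual A] have the same principal resource. *)
Lemma prin2_same r s p t u : prin2 r p -> prin2 s p -> ok (Rule2 s t u) ->
  exists t' u', eqv (Rule2 s t u) (Rule2 r t' u') /\ (tsize t' + tsize u' = tsize t + tsize u)%N /\
    ((t' = t /\ u' = u) \/ (t' = u /\ u' = t)).
Proof.
case: r => [a|c A|] // /eqP->; case: s => [b|d B|] //=.
  by move=> /eqP[->] o; exists t, u; split; [apply: eqv_refl|split=> //; left].
move=> /eqP[<- E] o.
have : B \in [fset A; dual A] by rewrite E !inE eqxx.
rewrite !inE => /orP[]/eqP EB.
  by exists t, u; rewrite EB; split; [apply: eqv_refl|split=> //; left].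
exists u, t; split; last by rewrite addnC; split=> //; right.
by have := eqv_flip_cut o; rewrite EB dualK.
Qed.

Lemma sub2_other chi k r p X Y : prin2 r p -> ok (side k r X Y) ->
  colt chi (~~ k) Y -> forall z, res (side k r X Y) z -> z != p -> col chi k z -> res X z.
Proof.
move=> pp o CY z; rewrite res_side => /or3P[/(prin2_uniq pp)->|/andP[]//|/andP[h _]]; first by rewrite eqxx.
by move=> _ cz; case: (col_neq cz); apply: CY.
Qed.

(** Both values of [k] are offered, so that a user can let [X] be the premise with the colour of the
    rule to be exchanged with [r]. *)
Definition split_at chi r t := forall k, exists X Y, eqv t (side k r X Y) /\
  colt chi k X /\ colt chi (~~ k) Y /\ (tsize X + tsize Y <= tsize t)%N.

Lemma split_at_any chi r t k X Y : eqv t (side k r X Y) -> colt chi k X -> colt chi (~~ k) Y ->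
  (tsize X + tsize Y <= tsize t)%N -> split_at chi r t.
Proof.
move=> E CX CY W j; have [->|nj] := eqVneq j k; first by exists X, Y.
have -> : j = ~~ k by case: j k nj {E CX CY} => [] [].
by exists Y, X; rewrite negbK -sideC addnC.
Qed.

Lemma collect_at chi k r t x y l : ok t -> eqv t (mix (side k r x y :: untag l)) -> coloured chi l ->
  colt chi k x -> colt chi (~~ k) y -> (weight (x :: y :: untag l) <= tsize t)%N ->
  split_at chi r t.
Proof.
move=> o E C Cx Cy W; have [X [Y [E' [CX [CY EW]]]]] := collect (eqv_ok E o) C Cx Cy.
by apply: split_at_any (eqv_trans E E') CX CY _; rewrite EW.
Qed.

Lemma rule2_rule1 r p s : prin2 r p -> form2 m G r -> form1 G s -> inl (prin1 s) != p.
Proof.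
move=> pp fr fs; apply/eqP => E.
by case: r pp fr => [a|c A|] //=; rewrite -E => /eqP // [<-]; rewrite (form1_tensor fs).
Qed.

Lemma rule2_with r p b : prin2 r p -> form2 m G r -> formW G b -> inl b != p.
Proof.
move=> pp fr fs; apply/eqP => E.
by case: r pp fr => [a|c A|] //=; rewrite -E => /eqP // [<-]; rewrite (formW_tensor fs).
Qed.

(** Only the principal resource [p] may straddle the two colours. A rule other than mix that [r]
    meets on its way down has one colour and is pushed into the premise of [r] with that colour.
    That every linking has a leaf above [p] matters when [p] is a cut: it ensures that both premises
    of a with contain [p]. *)
Lemma rule_split chi n r p t : coherent_below n -> prin2 r p -> form2 m G r ->
  (forall k z, sub2 k r z -> col chi k z) ->
  (tsize t <= n)%N -> ok t -> anti (res t) -> res t p ->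
  (forall l, lnk t l -> exists2 w, lv l w & cone p w) ->
  (forall z, res t z -> z != p -> exists k, col chi k z) -> splits chi t ->
  split_at chi r t.
Proof.
move=> IHn pp fr Cr; elim: t => [x y|s t IH|s t IHt u IHu|b t IHt u IHu] le o H tp Tch C S.
- case: r pp fr {Cr IHn} => [a|c A|] //= /eqP E; rewrite E in tp; last by [].
  move: tp o => /= /orP[]/eqP[<-]; rewrite /form0; case: (form_at G a) => // -[] //.
  by case: form_at => // -[] // [].
- have np := rule2_rule1 pp fr (proj1 (proj2 o)).
  move: (tp) => /=; rewrite eq_sym (negPf np) /= => /andP[tp' nsp].
  have [k ck] : exists k, col chi k (inl (prin1 s)) by apply: C => //; rewrite /= eqxx.
  have oo := o; move: (oo) => [ot [_ [Sr _]]].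
  have [||||X [Y [E [CX [CY W]]]]] := IH _ ot (anti_rule1 o H) tp' _ _ _ k.
  + by move: le => /=; lia.
  + by move=> l hl; apply: Tch; apply/lnk_rule1.
  + move=> z tz nz; have [sz|nsz] := boolP (sub1 s z); first by exists k; apply: coloured_sub1 sz.
    by apply: C => //; rewrite /= tz nsz orbT.
  + by apply: splits_lnk S => l; rewrite lnk_rule1.
  have e1 := eqv_rule1 E o; have o1 := eqv_ok e1 o.
  apply: (@split_at_any _ _ _ k (Rule1 s X) Y) => //.
  + apply: (eqv_trans e1); apply: eqv_swap12B => // z sz.
    apply: (sub2_other (k := k) pp (eqv_ok E ot) CY).
    * by rewrite -(eqv_res E); apply: Sr.
    * by apply/eqP => Ez; rewrite -Ez sz in nsp.
    * exact: coloured_sub1 ck sz.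
  + by move=> z /= /orP[/eqP-> //|/andP[/CX]].
- have [ps|ns] := boolP (prin2 s p).
    (* Here the last rule is [r] itself, up to the orientation of a cut. Its premises fall into
       pieces; those carrying the active formulas stay under [r], and the others are collected by
       colour. *)
    have [t' [u' [E [sz tu]]]] := prin2_same pp ps o.
    have o' := eqv_ok E o; have H' := eqv_anti E H.
    have S' : splits chi (Rule2 r t' u') by apply: splits_lnk S; apply: eqv_lnk E.
    have [ot' ou'] := (ok_sideL (k := false) o', ok_sideR (k := false) o').
    move: (o') => [_ [_ [_ [S1 [S2 [P1 [P2 _]]]]]]].
    have C' z : res (Rule2 r t' u') z -> z != p -> exists k, col chi k z.
      by rewrite -(eqv_res E); apply: C.
    have [||l D] := mix_split IHn _ ot' (anti_side (k := false) o' H') _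
       (splits_side (k := false) o' H' S').
    + by move: le (tsize_gt0 u') => /=; lia.
    + move=> z tz; have [sz'|nz] := boolP (sub2 false r z); first by exists false; apply: Cr sz'.
      apply: C'; first by rewrite /= tz nz orbT.
      by apply/eqP => Ez; move: (P1 _ pp); rewrite -Ez res_foot.
    have [||l' D'] := mix_split IHn _ ou' (anti_side2 (k := false) o' H') _
       (splits_side2 (k := false) o' H' S').
    + by move: le (tsize_gt0 t') => /=; lia.
    + move=> z tz; have [sz'|nz] := boolP (sub2 true r z); first by exists true; apply: Cr sz'.
      apply: C'; first by rewrite /= tz nz !orbT.
      by apply/eqP => Ez; move: (P2 _ pp); rewrite -Ez res_foot.
    have rn : r <> RMix by move=> E'; rewrite E' in pp.
    have [e se] := sub2_nonempty false rn; have [e' se'] := sub2_nonempty true rn.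
    have [x [xs [px xe]]] := dec_pick D ot' (S1 _ se) (Cr _ _ se).
    have [y [ys [py ye]]] := dec_pick D' ou' (S2 _ se') (Cr _ _ se').
    have [E1 [Cl W]] := dec_perm ot' px D; have [E1' [Cl' W']] := dec_perm ou' py D'.
    have e1 := eqv_side2 (k := false) E1 E1' o'.
    have e2 : eqv (side false r (mix (untag ((false, x) :: xs))) (mix (untag ((true, y) :: ys))))
       (mix (side false r x y :: untag ys ++ untag xs)).
      apply: float2; first exact: eqv_ok e1 o'.
      + by move=> z /(sub2_uniq se) <-.
      + by move=> z /(sub2_uniq se') <-.
    apply: (@collect_at _ false _ _ x y (ys ++ xs)) => //.
    + by rewrite map_cat; apply: (eqv_trans E); apply: (eqv_trans e1).
    + move=> q /(List.in_app_or _ _ _)[h|h]; first by apply: Cl'; right.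
      by apply: Cl; right.
    + by apply: (Cl (false, x)); left.
    + by apply: (Cl' (true, y)); left.
    + move: W W' sz; rewrite /= map_cat /weight /= !map_cat !sumn_cat; lia.
  have K j x y : ((tsize x <= n)%N -> ok x -> anti (res x) -> res x p ->
        (forall l, lnk x l -> exists2 w, lv l w & cone p w) ->
        (forall z, res x z -> z != p -> exists k, col chi k z) -> splits chi x -> split_at chi r x) ->
      (tsize (side j s x y) <= n)%N -> ok (side j s x y) -> anti (res (side j s x y)) ->
      res x p -> ~~ sub2 j s p ->
      (forall l, lnk (side j s x y) l -> exists2 w, lv l w & cone p w) ->
      (forall z, res (side j s x y) z -> z != p -> exists k, col chi k z) ->
      splits chi (side j s x y) -> split_at chi r (side j s x y).
    move=> {IHt IHu t u le o H tp Tch C S} IH le o H xp nsp Tch C S.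
    have [ox oy] := (ok_sideL o, ok_sideR o); rewrite tsize_side in le.
    move: (o) => /ok_side[_ [_ [_ [S1 [S2 [P1 [P2 D]]]]]]].
    have Cp q : prin2 s q -> exists k, col chi k q.
      move=> sq; apply: C; first by rewrite res_side sq.
      by apply/eqP => Eq; rewrite -Eq sq in ns.
    have SA : split_at chi r x.
      apply: IH => //; first by move: le; lia.
      + exact: anti_side o H.
      + move=> l hl; have [l' hl'] := lnk_ex y.
        have [w /lvU[|lw] cw] : exists2 w, lv (l `|` l') w & cone p w.
          by apply: Tch; apply/lnk_side; exists l, l'.
        by exists w.
        have [z yz cz] := lnk_sup oy hl' lw.
        by case: (sep_side o H xp yz cw cz).
      + move=> z xz nz; have [sz|nsz] := boolP (sub2 j s z); last first.
          by apply: C; rewrite // res_side xz nsz orbT.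
        have [w cw] := cone_inhab z; have [q pq _] := cone_sub2 sz cw.
        by have [k ck] := Cp _ pq; exists k; apply: coloured_sub2 ck pq sz.
      + exact: splits_side o H S.
    have [||l Dy] := mix_split (t := y) IHn _ oy (anti_side2 o H) _ (splits_side2 o H S).
    + by move: le; lia.
    + move=> z yz; have [sz|nsz] := boolP (sub2 (~~ j) s z); last first.
        apply: C; first by rewrite res_side yz nsz !orbT.
        apply/eqP => Ez; move: (D _ (res_foot xp)); rewrite -Ez res_foot //.
      have [w cw] := cone_inhab z; have [q pq _] := cone_sub2 sz cw.
      by have [k ck] := Cp _ pq; exists k; apply: coloured_sub2 ck pq sz.
    have [sm|sn] : s = RMix \/ s <> RMix by case: (s) => *; [right|right|left].
      (* A mix has no active formula: the pieces of [y] join the premises of [r] according to their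
         colours. *)
      subst s; have [X [Y [E [CX [CY W]]]]] := SA false.
      have e1 := eqv_side2 E (proj1 Dy) o; have o1 := eqv_ok e1 o.
      have {}e1 : eqv (side j RMix x y) (side false RMix (side false r X Y) (mix (untag l))).
        apply: (eqv_trans e1); case: (j) o1 => o1; last exact: eqv_refl.
        exact: eqv_flip.
      have {}o1 := eqv_ok e1 o.
      apply: (@collect_at _ false _ _ X Y l) => //; last 2 first.
      + exact: (proj1 (proj2 Dy)).
      + move: (proj2 (proj2 Dy)); rewrite tsize_side /weight /=; lia.
      apply: (eqv_trans e1); move: (ok_mix_neq0 (ok_sideR o1)).
      by case: (untag l) => // *; apply: eqv_refl.
    have [q pq] := prin2_nonempty sn; have [k ck] := Cp _ pq.
    have [e se] := sub2_nonempty j sn; have [e' se'] := sub2_nonempty (~~ j) sn.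
    have [X [Y [E [CX [CY W]]]]] := SA k.
    have [z [zs [pz ze]]] := dec_pick Dy oy (S2 _ se') (coloured_sub2 ck pq se').
    have [E' [Cl W']] := dec_perm oy pz Dy.
    have e1 := eqv_side2 E E' o; have o1 := eqv_ok e1 o.
    have e2 : eqv (side j s (side k r X Y) (mix (untag ((k, z) :: zs))))
        (mix (side j s (side k r X Y) z :: untag zs)).
      rewrite sideC [side j s (side _ _ _ _) z]sideC; apply: float; first by rewrite -sideC.
      by move=> v /(sub2_uniq se') <-.
    have o2 := eqv_ok e2 o1.
    have ok2 : ok (side j s (side k r X Y) z) by apply: ok_mix o2 _; left.
    have e3 : eqv (side j s (side k r X Y) z) (side k r (side j s X z) Y).
      apply: eqv_swap22 => // v sv; apply: (sub2_other (k := k) pp (eqv_ok E ox) CY).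
      + by rewrite -(eqv_res E); apply: S1.
      + by apply/eqP => Ev; rewrite -Ev sv in nsp.
      + exact: coloured_sub2 ck pq sv.
    apply: (@collect_at _ k _ _ (side j s X z) Y zs) => //.
    + apply: (eqv_trans e1); apply: (eqv_trans e2); exact: mix_head.
    + by move=> v h; apply: Cl; right.
    + apply: colt_side => //; first by apply: (Cl (k, z)); left.
      by move=> p' /(prin2_uniq pq) <-.
    + move: W W'; rewrite /weight /= !tsize_side; lia.
  move: tp => /= /or3P[ps|/andP[tp nsp]|/andP[tp nsp]]; first by rewrite ps in ns.
  + exact: (K false t u).
  + by apply: (K true u t) => //; move: le => /=; rewrite addnC.
- have nb := rule2_with pp fr (proj1 (proj2 (proj2 o))).
  have [k ck] : exists k, col chi k (inl b) by apply: C => //; rewrite /= eqxx.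
  have Ck j : col chi k (inl (child j b)) by move=> w cw; apply: ck; apply: cone_child cw.
  pose T j := if j then u else t.
  have oT j : ok (T j) by case: j; case: o => ? [].
  have aT j : anti (res (T j)) := anti_with_prem (k := j) o H.
  have ST j z : res (T j) z -> z != inl (child j b) -> res (RWith b t u) z.
    by case: j => /= -> ->; rewrite ?orbT.
  have bp j : inl (child j b) != p.
    apply/eqP => Ep; have [E|ne] := eqVneq (child j b) b.
      by move: nb; rewrite -Ep E eqxx.
    by rewrite -Ep in tp; have [_ _] := with_shared o tp ne; case: (j); rewrite eqxx.
  have Tl j l : lnk (T j) l -> exists2 w, lv l w & cone p w.
    by move=> hl; apply: Tch; apply/lnk_with; case: j hl; [right|left].
  (* A leaf above [p] lies above some resource of the premise [T j]. This resource is not the active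
     formula, as the principal formula [b] does not meet [p]; so it persists in the conclusion and
     equals [p]. *)
  have pT j : res (T j) p.
    have [l hl] := lnk_ex (T j); have [w lw cw] := Tl _ _ hl.
    have [z tz cz] := lnk_sup (oT j) hl lw.
    have [Ez|nz] := eqVneq z (inl (child j b)).
      have bS : res (RWith b t u) (inl b) by rewrite /= eqxx.
      have := H (inl b) p w bS tp; rewrite cw => /(_ _ isT) E; move: nb; rewrite E ?eqxx //.
      by apply: (@cone_child j); rewrite -Ez.
    by rewrite (H _ _ _ tp (ST _ _ tz nz) cw cz).
  have CT j z : res (T j) z -> z != p -> exists k, col chi k z.
    move=> tz np; have [->|nz] := eqVneq z (inl (child j b)); first by exists k; apply: Ck.
    by apply: C => //; apply: ST nz.
  have sT j : splits chi (T j) := splits_with j o H ck S.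
  have [|X1 [Y1 [E1 [CX1 [CY1 W1]]]]] := IHt _ (oT false) (aT false) (pT false) (Tl false) (CT false) (sT false) k.
    by move: le => /=; lia.
  have [|X2 [Y2 [E2 [CX2 [CY2 W2]]]]] := IHu _ (oT true) (aT true) (pT true) (Tl true) (CT true) (sT true) k.
    by move: le => /=; lia.
  have [|L R] := with_factor o H ck S _ E1 E2 CX1 CY1 CX2 CY2.
    by move=> q /(prin2_uniq pp) <-.
  have o1 := eqv_ok E1 (oT false); have o2 := eqv_ok E2 (oT true).
  have ey : eqv Y2 Y1.
    apply/eqv_sym/IHn => //.
    + by move: le W1 W2 => /=; lia.
    + exact: ok_sideR o1.
    + exact: ok_sideR o2.
    + exact: (anti_side2 o1 (eqv_anti E1 (aT false))).
  have e1 : eqv (RWith b t u) (RWith b (side k r X1 Y1) (side k r X2 Y1)).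
    by apply: eqv_with o => //; apply: (eqv_trans E2); apply: eqv_sideR.
  have cX j X Y : eqv (T j) (side k r X Y) -> colt chi (~~ k) Y -> res X (inl (child j b)).
    move=> E CY; apply: (sub2_other pp (eqv_ok E (oT j)) CY) => //.
    by rewrite -(eqv_res E); apply: with_child o.
  apply: (@split_at_any _ _ _ k (RWith b X1 X2) Y1) => //.
  + apply: (eqv_trans e1); apply: eqv_swapW2A; first exact: eqv_ok e1 o.
    * by move=> z /eqP->; apply: (cX false) E1 CY1.
    * by move=> z /eqP->; apply: (cX true) E2 CY2.
  + by move=> z /= /or3P[/eqP->|/andP[/CX1]|/andP[/CX2]].
  + by move: W1 W2 => /=; lia.
Qed.

End Rearrangement.

(** * Star proofs with the same linkings *)

Section SameLinkings.
Variables (m : bool) (G : seq form).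
Notation ok := (ok m G).
Notation eqv := (eqv m G).
Notation coherent_below := (coherent_below m G).

Lemma form0_anti x y : form0 G x y -> form0 G y x -> False.
Proof.
by rewrite /form0; case: (form_at G x) => // -[] // [] // P; case: (form_at G y) => // -[] // [].
Qed.

Lemma form0_eq x y x' : form0 G x y -> form0 G y x' -> False.
Proof. by rewrite /form0; case: (form_at G x) => // -[] // [] // P; case: (form_at G y) => // -[] // []. Qed.

Lemma tensor_ax a x : form2 m G (RTensor a) -> form0 G a x = false /\ form0 G x a = false.
Proof.
rewrite /form0 /=; case: (form_at G a) => // -[] // *.
by split=> //; case: form_at => // -[] // [].
Qed.

(** Par, plus, with and tensor are excluded by the literals at [x] and [y], a cut by the conclusion.
    A mix would need links in two premises without common leaves, but [[fset x; y]] is the only link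
    available. *)
Lemma coherent_ax p x y : ok p -> ok (Ax x y) -> anti (res p) -> res p =1 res (Ax x y) ->
  (forall l, lnk p l <-> lnk (Ax x y) l) -> p = Ax x y.
Proof.
case: p => [x' y'|s t|s t u|b t u] o /= f H R L.
- have := R (inl x'); rewrite /= eqxx /= => /esym/orP[]/eqP[Ex]; last first.
    by subst x'; case: (form0_eq f o).
  have := R (inl y'); rewrite /= eqxx orbT => /esym/orP[]/eqP[Ey]; last by rewrite Ex Ey.
  by subst x' y'; case: (form0_anti o o).
- have := R (inl (prin1 s)); rewrite /= eqxx /= => /esym/orP[]/eqP[E];
  have [_ [fs _]] := o; rewrite -E in f.
  + by have [] := form1_ax y fs; rewrite f.
  + by have [_] := form1_ax x fs; rewrite f.
- have rm : s = RMix.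
    case: s o H R L => [a|c A|] // o H R L.
      have := R (inl a); rewrite /= eqxx /= => /esym/orP[]/eqP[E];
        have [_ [_ [fs _]]] := o; rewrite -E in f.
      * by have [] := tensor_ax y fs; rewrite f.
      * by have [_] := tensor_ax x fs; rewrite f.
    by have := R (inr (c, [fset A; dual A])); rewrite /= eqxx.
  subst s; have [l1 h1] := lnk_ex t; have [l2 h2] := lnk_ex u.
  have /L/lnk_ax E : lnk (Rule2 RMix t u) (l1 `|` l2) by apply/lnk_rule2; exists l1, l2.
  have [e1 he1] := lnk_nonempty h1; have [e2 he2] := lnk_nonempty h2.
  have E1 : e1 = [fset x; y] by apply/eqP; rewrite -[_ == _]in_fset1 -E inE he1.
  have E2 : e2 = [fset x; y] by apply/eqP; rewrite -[_ == _]in_fset1 -E inE he2 orbT.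
  have [ot ou] := (ok_sideL (k := false) o, ok_sideR (k := false) o).
  have [z tz cz] : exists2 z, res t z & cone z x.
    by apply: (lnk_sup ot h1); exists e1; rewrite // E1 !inE eqxx.
  have [z' tz' cz'] : exists2 z, res u z & cone z x.
    by apply: (lnk_sup ou h2); exists e2; rewrite // E2 !inE eqxx.
  by case: (sep_side (k := false) o H tz tz' cz cz').
- have := R (inl b); rewrite /= eqxx /= => /esym/orP[]/eqP[E];
  have [_ [_ [fs _]]] := o; rewrite -E in f.
  + by have [] := formW_ax y fs; rewrite f.
  + by have [_] := formW_ax x fs; rewrite f.
Qed.

Lemma rule1_res r t u : ok (Rule1 r t) -> ok (Rule1 r u) ->
  res (Rule1 r t) =1 res (Rule1 r u) -> res t =1 res u.
Proof.
have K t' u' : ok (Rule1 r t') -> ok (Rule1 r u') ->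
  res (Rule1 r t') =1 res (Rule1 r u') -> forall z, res t' z -> res u' z.
  move=> [_ [_ [_ P]]] [_ [_ [S _]]] R z tz; have [/S//|nz] := boolP (sub1 r z).
  have := R z; rewrite /= tz nz orbT => /esym/orP[Ez|/andP[]//].
  by move: (P _ Ez); rewrite res_foot.
by move=> o o' R z; apply/idP/idP; apply: K => // z'; rewrite R.
Qed.

(** A leaf above the active formula tells from which premise a linking comes, so the linkings of the
    whole tree determine those of each premise. *)
Lemma with_lnk j a t1 t2 u1 u2 l : ok (RWith a t1 t2) -> ok (RWith a u1 u2) ->
  anti (res (RWith a u1 u2)) ->
  (forall l, lnk (RWith a t1 t2) l <-> lnk (RWith a u1 u2) l) ->
  lnk (if j then t2 else t1) l -> lnk (if j then u2 else u1) l.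
Proof.
move=> o o' H L h.
have /L/lnk_with hl : lnk (RWith a t1 t2) l by apply/lnk_with; case: j h; [right|left].
have oT : ok (if j then t2 else t1) by case: (j); case: o => ? [].
have [w lw cw] := lnk_cov oT h (with_child j o) isT.
have N : ~ lnk (if ~~ j then u2 else u1) l.
  move=> hN; have oU : ok (if ~~ j then u2 else u1) by case: (j); case: o' => ? [].
  have [x rx cx] := lnk_sup oU hN lw.
  by have := sep_with o' H rx cx; rewrite negbK cw.
by case: j N hl {h oT cw} => /= N [].
Qed.

Lemma with_res j a t1 t2 u1 u2 z : ok (RWith a t1 t2) -> ok (RWith a u1 u2) ->
  anti (res (RWith a t1 t2)) -> res (RWith a t1 t2) =1 res (RWith a u1 u2) ->
  (forall l, lnk (RWith a t1 t2) l <-> lnk (RWith a u1 u2) l) ->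
  res (if j then t2 else t1) z -> res (if j then u2 else u1) z.
Proof.
move=> o o' H R L h.
have oT : ok (if j then t2 else t1) by case: (j); case: o => ? [].
have oU : ok (if j then u2 else u1) by case: (j); case: o' => ? [].
have [->|nz] := eqVneq z (inl (child j a)); first exact: (with_child j o').
have zS : res (RWith a t1 t2) z by case: j h nz {oT oU} => /= -> ->; rewrite /= ?orbT.
have za : z != inl a.
  apply/eqP => E; move: o => [_ [_ [_ [_ [_ [P1 [P2 _]]]]]]].
  by case: j h {nz oT oU} => /res_foot; rewrite E; [rewrite (negPf (P2 _ _))|rewrite (negPf (P1 _ _))].
case: z h nz zS za => [v|c] h nz zS za.
  by rewrite R in zS; have [] := with_shared o' zS za; case: (j).
(* The remaining resources are cuts, which the context does not determine; they are traced through a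
   leaf above them. *)
have [l [hl [w lw cw]]] := lnk_tch oT h.
have H' := anti_ext R H.
have hl' := with_lnk o o' H' L hl; have [x rx cx] := lnk_sup oU hl' lw.
rewrite R in zS.
have [E|nx] := eqVneq x (inl (child j a)).
  have : inl a = inr c :> resource.
    by apply: (H' _ _ w) zS _ cw; rewrite /= ?eqxx //; apply: (@cone_child j); rewrite -E.
  by [].
suff <- : x = inr c by [].
apply: (H' _ _ w) => //.
by case: j rx nx {oT oU h nz hl hl'} => /= -> ->; rewrite /= ?orbT.
Qed.

(** A resource of [x] missing from [x'] would have to come from [y'], which has the other colour. *)
Lemma split_res chi k r x y x' y' : ok (side k r x y) -> ok (side k r x' y') ->
  res (side k r x y) =1 res (side k r x' y') ->
  colt chi k x -> colt chi (~~ k) y' -> forall z, res x z -> res x' z.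
Proof.
move=> /ok_side[_ [_ [_ [_ [_ [P1 _]]]]]] /ok_side[_ [_ [_ [S1 _]]]] R Cx Cy z xz.
have [/S1//|nz] := boolP (sub2 k r z).
have := R z; rewrite !res_side xz nz orbT => /esym/or3P[pz|/andP[]//|/andP[yz _]].
  by move: (P1 _ pz); rewrite res_foot.
by case: (@col_neq chi k z); [apply: Cx|apply: Cy].
Qed.

Lemma split_lnk chi k r x y x' y' l : ok (side k r x y) -> ok (side k r x' y') ->
  (forall l, lnk (side k r x y) l <-> lnk (side k r x' y') l) ->
  colt chi k x -> colt chi (~~ k) y -> colt chi k x' -> colt chi (~~ k) y' ->
  lnk x l -> lnk x' l.
Proof.
move=> o o' L Cx Cy Cx' Cy' h; have [l' h'] := lnk_ex y.
have /L : lnk (side k r x y) (l `|` l') by apply/lnk_side; exists l, l'.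
case/(lnk_split (ok_sideL o') (ok_sideR o') Cx' Cy') => + _.
rewrite sliceU (colt_slice (ok_sideL o) Cx h).
by rewrite (colt_sliceN (ok_sideR o) Cy h') fsetU0.
Qed.

Lemma coherent n : coherent_below n.
Proof.
elim: n => [|n IH] p q lt op oq H R L; first by [].
case: q lt oq R L => [x y|r q|r q1 q2|a q1 q2] lt oq R L.
- by rewrite (coherent_ax op oq H R L); apply: eqv_refl.
- have Hq := anti_ext R H.
  have [|||p' E lt'] := inv_rule1 op (r := r).
  + by case: oq => _ [].
  + by rewrite R /= eqxx.
  (* In [q], which ends with the plus, no leaf lies above the discarded premise; [p] has the same
     linkings. *)
  + case: r oq R L Hq {lt} => //= b a oq R L Hq l w hl lw; apply/negP => cw.
    move: (oq) => /= [oq' [_ [_ P]]].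
    have /L/lnk_rule1 hq := hl; have [z rz cz] := lnk_sup oq' hq lw.
    have [Ez|nz] := eqVneq z (inl (child b a)).
      rewrite Ez in cz; case: b cw cz {oq R L Hq Ez} => cw cz;
      [have := cone_child_disj cw|have := cone_child_disj cz]; by rewrite ?cw ?cz.
    have Ea : inl a = z.
      by apply: (Hq _ _ w) (cone_child cw) cz; rewrite /= ?eqxx // rz nz orbT.
    by move: (P z); rewrite -Ea eqxx => /(_ isT); rewrite res_foot // Ea.
  have o' := eqv_ok E op; have R' : res (Rule1 r p') =1 res (Rule1 r q).
    by move=> z; rewrite -(eqv_res E).
  apply: (eqv_trans E); apply: eqv_rule1 => //; apply: IH.
  + by move: lt => /=; lia.
  + by case: o'.
  + by case: oq.
  + by apply: anti_rule1 o' _; apply: eqv_anti E H.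
  + exact: rule1_res R'.
  + by move=> l; rewrite -(lnk_rule1 r) -(eqv_lnk E) L lnk_rule1.
- have Hq := anti_ext R H; have [C2 C1] := above_colt (k := false) oq Hq.
  set chi := above q2 in C1 C2.
  have Sq : splits chi (Rule2 r q1 q2) := splits_colt (k := false) (j := false) oq C1 C2.
  have Sp : splits chi p by apply: splits_lnk Sq => l; rewrite L.
  have Cpr z : res p z -> ~~ prin2 r z -> exists k, col chi k z.
    rewrite R /= => /or3P[->//|/andP[h _]|/andP[h _]] _; [exists false|exists true].
      exact: C1.
    exact: C2.
  (* [q] has positive size, so the induction hypothesis reaches all pairs of total size below
     [tsize p]. *)
  have np : coherent_below (tsize p).
    by move=> p1 p2 h; apply: IH; move: lt h (tsize_gt0 (Rule2 r q1 q2)); lia.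
  have [x [y [E [Cx [Cy W]]]]] : exists x y, eqv p (side false r x y) /\ colt chi false x /\
      colt chi (~~ false) y /\ (tsize x + tsize y <= tsize p)%N.
    have [rm|rn] : r = RMix \/ r <> RMix by case: (r) => *; [right|right|left].
      subst r; have [|l [E [C W]]] := mix_split np (leqnn _) op H _ Sp.
        by move=> z /Cpr; apply.
      have ol := eqv_ok E op; have p1 := part_perm false l; have E1 := mix_perm p1 ol.
      (* Both colours occur: a linking of [p] is one of [q], and has leaves above each premise of
         its last mix. *)
      have ne k : part k l <> [::].
        move=> En; have C' x : List.In x (untag l) -> colt chi (~~ k) x.
          move=> /(Permutation_in _ (part_perm (~~ k) l)); rewrite negbK En cats0.
          exact: part_colt.
        have Cl : colt chi (~~ k) (mix (untag l)) := mix_colt (ok_mix_neq0 ol) C'.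
        have oQ : ok (if k then q2 else q1) by case: (k); case: oq => ? [].
        have CQ : colt chi k (if k then q2 else q1) by case: (k).
        have [l0 h0] := lnk_ex p.
        have hq : lnk (Rule2 RMix q1 q2) l0 by apply/L.
        have [l1 [h1 sub]] : exists l1, lnk (if k then q2 else q1) l1 /\ forall w, lv l1 w -> lv l0 w.
          case/lnk_rule2: hq => l1 [l2 [h1 [h2 ->]]].
          by case: (k); [exists l2|exists l1]; split=> // w hw; apply/lvU; [right|left].
        have [e he] := lnk_nonempty h1; have [w we] := lnk_link h1 he.
        have lw : lv l1 w by exists e.
        have := colt_lv oQ CQ h1 lw.
        have /(eqv_lnk E) h0' := h0; rewrite (colt_lv ol Cl h0' (sub _ lw)).
        by case: (k).
      have o1 := eqv_ok E1 ol.
      have Cm k : colt chi k (mix (part k l)).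
        by apply: mix_colt => // x; apply: part_colt.
      exists (mix (part false l)), (mix (part true l)).
      move: W; rewrite (weight_perm p1) weight_cat => W.
      split; last first.
        split; first exact: (Cm false). split; first exact: (Cm true).
        move: W (ne false) (ne true); case: (part false l) => // a s; case: (part true l) => // b s' W _ _.
        by rewrite !tsize_mix.
      apply: (eqv_trans E); apply: (eqv_trans E1); move: o1 (ne false) (ne true).
      by case: (part false l) => // a s; case: (part true l) => // b s' o1 _ _; apply: mix_catV.
    have [pr pp] := prin2_nonempty rn; suff SA : split_at m G chi r p by exact: (SA false).
    apply: (rule_split np pp) => //.
    + by case: oq => _ [_ []].
    + move=> k z sz; have : res (if k then q2 else q1) z.
        by case: oq => _ [_ [_ [S1 [S2 _]]]]; case: (k) sz; [apply: S2|apply: S1].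
      by case: (k); [apply: C2|apply: C1].
    + by rewrite R /= pp.
    + move=> l /L hl; have [z sz [vz cz]] := sub2_ex false pp.
      case/lnk_rule2: hl => l1 [l2 [h1 [h2 ->]]].
      have oq1 := ok_sideL (k := false) oq.
      have [w lw cw] : exists2 w, lv l1 w & cone z w.
        by apply: (lnk_cov oq1 h1) => //; case: oq => _ [_ [_ [S1 _]]]; apply: S1.
      by exists w; [apply/lvU; left|apply: cz].
    + move=> z pz nz; apply: Cpr => //; apply/negP => /(prin2_uniq pp) Ez.
      by rewrite Ez eqxx in nz.
  have o' := eqv_ok E op.
  have R' : res (side false r x y) =1 res (side false r q1 q2) by move=> z; rewrite -(eqv_res E).
  have L' l : lnk (side false r x y) l <-> lnk (side false r q1 q2) l by rewrite -(eqv_lnk E) L.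
  have Rs z : res (side false r q1 q2) z = res (side false r x y) z by rewrite R'.
  have Ls l : lnk (side false r q1 q2) l <-> lnk (side false r x y) l by rewrite L'.
  have H' := eqv_anti E H.
  have [ox oy] := (ok_sideL o', ok_sideR o').
  have [oq1 oq2] := (ok_sideL (k := false) oq, ok_sideR (k := false) oq).
  apply: (eqv_trans E); apply: (eqv_side2 (k := false)) => //; apply: IH => //.
  + by move: lt W (tsize_gt0 y) => /=; lia.
  + exact: anti_side o' H'.
  + move=> z; apply/idP/idP; first exact: (split_res o' oq R' Cx C2).
    exact: (split_res (k := false) oq o' Rs C1 Cy).
  + move=> l; split; first exact: (split_lnk (k := false) o' oq L' Cx Cy C1 C2).
    exact: (split_lnk (k := false) oq o' Ls C1 C2 Cx Cy).
  + by move: lt W (tsize_gt0 x) => /=; lia.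
  + exact: anti_side2 o' H'.
  + rewrite sideC in o' R' Rs L' Ls; rewrite [side _ _ q1 _]sideC in R' Rs L' Ls.
    have oq' : ok (side true r q2 q1) by [].
    move=> z; apply/idP/idP; first exact: (split_res (k := true) o' oq' R' Cy C1).
    exact: (split_res (k := true) oq' o' Rs C2 Cx).
  + rewrite sideC in o' L' Ls; rewrite [side _ _ q1 _]sideC in L' Ls.
    have oq' : ok (side true r q2 q1) by [].
    move=> l; split; first exact: (split_lnk (k := true) o' oq' L' Cy Cx C2 C1).
    exact: (split_lnk (k := true) oq' o' Ls C2 C1 Cy Cx).
- have Hq := anti_ext R H.
  have [||p1 [p2 [E [lt1 lt2]]]] := inv_with op (a := a).
  + by case: oq => _ [_ []].
  + by rewrite R /= eqxx.
  have o' := eqv_ok E op; have H' := eqv_anti E H.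
  have R' : res (RWith a p1 p2) =1 res (RWith a q1 q2) by move=> z; rewrite -(eqv_res E).
  have L' l : lnk (RWith a p1 p2) l <-> lnk (RWith a q1 q2) l by rewrite -(eqv_lnk E) L.
  have Rs z : res (RWith a q1 q2) z = res (RWith a p1 p2) z by rewrite R'.
  have Ls l : lnk (RWith a q1 q2) l <-> lnk (RWith a p1 p2) l by rewrite L'.
  have RR j : res (if j then p2 else p1) =1 res (if j then q2 else q1).
    move=> z; apply/idP/idP; first exact: (with_res o' oq H' R' L').
    exact: (with_res oq o' Hq Rs Ls).
  have LL j l : lnk (if j then p2 else p1) l <-> lnk (if j then q2 else q1) l.
    split; first exact: (with_lnk o' oq Hq L').
    exact: (with_lnk oq o' H' Ls).
  apply: (eqv_trans E); apply: eqv_with => //; apply: IH.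
  + by move: lt => /=; lia.
  + by case: o'.
  + by case: oq.
  + exact: (anti_with_prem (k := false) o' H').
  + exact: (RR false).
  + exact: (LL false).
  + by move: lt => /=; lia.
  + by case: o' => _ [].
  + by case: oq => _ [].
  + exact: (anti_with_prem (k := true) o' H').
  + exact: (RR true).
  + exact: (LL true).
Qed.

End SameLinkings.

(** * From sequents to sets of resources *)

Definition named (c : nat) (v : vertex) : bool :=
  if v.1 is CutRoot d _ then d == c else false.

Section Bridge.
Variables (m : bool) (G : seq form).
Notation ok := (ok m G).

Definition fresh_cut (r : rule2) (v : vertex) : bool :=
  if r is RCut c _ then ~~ named c v else true.

(* Validity of a MALL proof. Contrary to [ok], cuts in different premises may have
   the same name. *)
Fixpoint okm (t : tree) : Prop :=
  match t with
  | Ax x y => form0 G x y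
  | Rule1 r t => okm t /\ form1 G r /\ (forall v, sub1 r (inl v) -> res t (inl v)) /\
      ~~ res t (inl (prin1 r))
  | Rule2 r t u => okm t /\ okm u /\ form2 m G r /\
      (forall v, sub2 false r (inl v) -> res t (inl v)) /\
      (forall v, sub2 true r (inl v) -> res u (inl v)) /\
      (forall v, prin2 r (inl v) -> ~~ res t (inl v) && ~~ res u (inl v)) /\
      (forall v, res t (inl v) && ~~ sub2 false r (inl v) ->
         ~~ (res u (inl v) && ~~ sub2 true r (inl v))) /\
      (forall v, res (Rule2 r t u) (inl v) -> fresh_cut r v)
  | RWith a t u => okm t /\ okm u /\ formW G a /\
      res t (inl (child false a)) /\ res u (inl (child true a)) /\
      ~~ res t (inl a) /\ ~~ res u (inl a) /\
      (forall v, res t (inl v) && (v != child false a) = res u (inl v) && (v != child true a))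
  end.

Definition cons_form (T : sequent) := forall x, x \in T -> form_at G x.1 = Some x.2.

Definition dom (T : sequent) (v : vertex) : bool := v \in unzip1 T.

Definition spec (T : sequent) (P : vertex -> bool) := forall v, dom T v = P v.

Lemma cons_form_in T v : cons_form T -> dom T v ->
  exists2 A, form_at G v = Some A & (v, A) \in T.
Proof. by move=> C /mapP[[w A] h /= ->]; exists A => //; apply: (C _ h). Qed.

(** With the formula fixed by its vertex, a duplicate-free sequent is determined up to order by its
    set of vertices. *)
Lemma is_sequentP T S : uniq (unzip1 T) -> cons_form T -> uniq (unzip1 S) -> cons_form S ->
  dom T =1 dom S -> is_sequent T S.
Proof.
move=> uT CT uS CS E; rewrite /is_sequent uT; apply: uniq_perm.
- exact: map_uniq uT.
- exact: map_uniq uS.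
have K T1 T2 : cons_form T1 -> cons_form T2 -> dom T1 =1 dom T2 -> {subset T1 <= T2}.
  move=> C1 C2 E' [v A] h; have : dom T1 v by apply/mapP; exists (v, A).
  rewrite E' => /(cons_form_in C2)[B fB].
  by have := C1 _ h; rewrite /= fB => -[->].
move=> x; apply/idP/idP; apply: K => // v; by rewrite E.
Qed.

Lemma sequent_inv T S : is_sequent T S -> cons_form T ->
  uniq (unzip1 S) /\ cons_form S /\ dom T =1 dom S.
Proof.
case/andP=> u p C; have p' : perm_eq (unzip1 T) (unzip1 S) by apply: perm_map.
split; first by rewrite -(perm_uniq p').
by split=> [x|v]; [rewrite -(perm_mem p); apply: C|apply: perm_mem].
Qed.

Lemma sequent_uniq T S : is_sequent T S -> uniq (unzip1 T).
Proof. by case/andP. Qed.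

Definition select (P : vertex -> bool) (T : sequent) : sequent := [seq x <- T | P x.1].

Lemma unzip1_select P T : unzip1 (select P T) = [seq v <- unzip1 T | P v].
Proof. by rewrite /select /unzip1 filter_map. Qed.

Lemma cons_select P T : cons_form T -> cons_form (select P T).
Proof. by move=> C x; rewrite mem_filter => /andP[_ /C]. Qed.

Lemma cons_form_cons v A T : cons_form ((v, A) :: T) <-> form_at G v = Some A /\ cons_form T.
Proof.
split=> [C|[f C] x].
  by split=> [|x h]; [apply: (C (v, A)); rewrite inE eqxx|apply: C; rewrite inE h orbT].
by rewrite inE => /predU1P[->|/C].
Qed.

Lemma cons_form_cat T S : cons_form (T ++ S) <-> cons_form T /\ cons_form S.
Proof.
split=> [C|[C1 C2] x]; last by rewrite mem_cat => /orP[/C1|/C2].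
by split=> x h; apply: C; rewrite mem_cat h ?orbT.
Qed.

Lemma cut_freeP c T : cut_free_name c T = all (fun v => ~~ named c v) (unzip1 T).
Proof.
rewrite /cut_free_name /unzip1 all_map; apply: eq_all => -[[[i|d A] s] B] //=.
Qed.

Lemma inl_eq (v w : vertex) : (inl v == inl w :> resource) = (v == w).
Proof. by []. Qed.

Lemma mall_uniq T t : mall m T t -> uniq (unzip1 T).
Proof. by case=> *; apply: sequent_uniq; eassumption. Qed.

Lemma cat_disj (l l' : seq vertex) v : uniq (l ++ l') -> v \in l -> v \notin l'.
Proof. by rewrite cat_uniq => /and3P[_ /hasPn h _] vl; apply/negP => /h; rewrite vl. Qed.

Lemma child_eq b a v : v == a -> v != child b a.
Proof.
move/eqP->; apply/eqP => /(congr1 (size \o snd)); rewrite /= size_rcons.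
by move/eqP; rewrite eqn_leq ltnn andbF.
Qed.

Lemma child_eq2 a (v : vertex) : v == child false a -> v != child true a.
Proof. exact: (@child_neq a (inl v)). Qed.

Ltac toimp2 :=
  lazymatch goal with
  | |- is_true _ -> _ =>
      let h := fresh in move=> h; toimp2; move: h; apply: (elimT implyP)
  | |- (is_true _ -> is_true _) -> _ =>
      let h := fresh in move=> /(introT implyP) h; toimp2; move: h; apply: (elimT implyP)
  | |- _ => idtac
  end.

Ltac taut := toimp2; repeat match goal with
  | |- context [dom ?T ?x] => batom (dom T x)
  | |- context [res ?t ?z] => batom (res t z)
  | |- context [@eq_op ?T ?x ?y] => batom (@eq_op T x y)
  end; vm_compute; reflexivity.

Arguments dom T v : simpl never.

Lemma in_unzip_cons w A T (v : vertex) : dom ((w, A) :: T) v = (v == w) || dom T v.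
Proof. by rewrite /dom inE. Qed.

Lemma in_unzip_cat (T S : sequent) (v : vertex) :
  dom (T ++ S) v = dom T v || dom S v.
Proof. by rewrite /dom /unzip1 map_cat mem_cat. Qed.

Lemma in_unzip_nil (v : vertex) : dom [::] v = false.
Proof. by []. Qed.

Definition in_unzip := (in_unzip_cons, in_unzip_cat, in_unzip_nil).

Lemma uniq_unzip_cons w A T (v : vertex) : uniq (unzip1 ((w, A) :: T : sequent)) ->
  (v == w -> ~~ dom T v) /\ uniq (unzip1 T).
Proof. by move=> /= /andP[h ->]; split=> // /eqP->. Qed.

Lemma uniq_unzip_cat T S (v : vertex) : uniq (unzip1 (T ++ S : sequent)) ->
  dom T v -> ~~ dom S v.
Proof. by rewrite /dom /unzip1 map_cat => /cat_disj; apply. Qed.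

Lemma mall_uniq_cons w A T t (v : vertex) : mall m ((w, A) :: T) t ->
  (v == w -> ~~ dom T v) /\ uniq (unzip1 T).
Proof. by move/mall_uniq; apply: (uniq_unzip_cons (A := A)). Qed.

Definition child_facts a v := (child_eq false (v := v) (a := a), child_eq true (v := v) (a := a),
  child_eq2 (v := v) (a := a)).

Lemma cut_vertex_eq c A v : v == cut_vertex c A -> v != cut_vertex c (dual A).
Proof. by move/eqP->; apply/eqP => -[E]; move: (dual_neq A); rewrite -E eqxx. Qed.

Lemma inlr_eq (v : vertex) x : (inl v == inr x :> resource) = false.
Proof. by []. Qed.

Definition res_eq := (inl_eq, inlr_eq).

(** Validity and the computation of the conclusion are proved together, since the side conditions of
    a rule speak of the conclusions of its premises. *)
Lemma mall_okm T t : mall m T t -> cons_form T ->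
  okm t /\ spec T (fun v => res t (inl v)).
Proof.
elim=> {T t} [T x y P s|T Ga D a A B t u mt IHt mu IHu s|T Ga a A B t mt IH s|
  T Ga a A B t u mt IHt mu IHu s|T Ga a b A B t mt IH s|T Ga D t u mm mt IHt mu IHu s|
  T Ga D c A t u mt IHt mu IHu fr s] C; have [uS [CS E]] := sequent_inv s C.
- move: CS; rewrite !cons_form_cons => -[fx [fy _]].
  split; first by rewrite /= /form0 fx fy.
  by move=> v; rewrite E /dom /= !inE !inl_eq.
- move: CS; rewrite cons_form_cons cons_form_cat => -[fa [CG CD]].
  have [|okt St] := IHt; first by apply/cons_form_cons; rewrite form_at_child fa.
  have [|oku Su] := IHu; first by apply/cons_form_cons; rewrite form_at_child fa.
  split; [split; [exact: okt|split; [exact: oku|split; [by rewrite /= fa|]]]|];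
  do ?split=> //; move=> v; rewrite ?E ?in_unzip; try apply: addb_eq;
  rewrite /= ?res_eq -?St -?Su ?in_unzip;
  have [U1 _] := mall_uniq_cons v mt;
  have [U2 _] := mall_uniq_cons v mu;
  have [U3 /uniq_unzip_cat U4] := uniq_unzip_cons (A := Tensor A B) v uS; move: U1 U2 U3 (U4 v);
  case: (child_facts a v) => -[]; rewrite ?in_unzip; by taut.
- move: CS; rewrite cons_form_cons => -[fa CG].
  have [|okt St] := IH; first by rewrite !cons_form_cons !form_at_child fa.
  split; [split; [exact: okt|split; [by rewrite /form1 /= fa|]]|].
  + have [U1 U2'] := mall_uniq_cons a mt; have [U2 _] := uniq_unzip_cons (A := B) a U2'.
    have [U3 _] := uniq_unzip_cons (A := Parr A B) a uS.
    split; first by move=> v; rewrite -St !in_unzip /= !res_eq; taut.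
    by rewrite -St !in_unzip /=; move: U1 U2 U3; case: (child_facts a a) => -[]; rewrite ?in_unzip ?eqxx; taut.
  + move=> v; rewrite E !in_unzip; apply: addb_eq; rewrite /= !res_eq -St !in_unzip.
    have [U1 U2'] := mall_uniq_cons v mt; have [U2 _] := uniq_unzip_cons (A := B) v U2'.
    have [U3 _] := uniq_unzip_cons (A := Parr A B) v uS; move: U1 U2 U3.
    by case: (child_facts a v) => -[]; rewrite ?in_unzip; taut.
- move: CS; rewrite cons_form_cons => -[fa CG].
  have [|okt St] := IHt; first by apply/cons_form_cons; rewrite form_at_child fa.
  have [|oku Su] := IHu; first by apply/cons_form_cons; rewrite form_at_child fa.
  have F v : [/\ v == child false a -> ~~ dom Ga v, v == child true a -> ~~ dom Ga v
      & v == a -> ~~ dom Ga v].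
    have [U1 _] := mall_uniq_cons v mt.
    have [U2 _] := mall_uniq_cons v mu.
    by have [U3 _] := uniq_unzip_cons (A := With A B) v uS.
  split; [split; [exact: okt|split; [exact: oku|split; [by rewrite /formW fa|]]]|].
    rewrite -!St -!Su !in_unzip !eqxx; split=> //; split=> //.
    split; first by case: (F a); case: (child_facts a a) => -[]; rewrite eqxx; taut.
    split; first by case: (F a); case: (child_facts a a) => -[]; rewrite eqxx; taut.
    by move=> v; apply: addb_eq; rewrite -St -Su !in_unzip; case: (F v); case: (child_facts a v) => -[]; taut.
  move=> v; rewrite E !in_unzip; apply: addb_eq; rewrite /= !res_eq -St -Su !in_unzip.
  by case: (F v); case: (child_facts a v) => -[]; taut.
- move: CS; rewrite cons_form_cons => -[fa CG].
  have [|okt St] := IH; first by rewrite !cons_form_cons !form_at_child fa; case: (b).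
  have F v : (v == child b a -> ~~ dom Ga v) /\ (v == a -> ~~ dom Ga v).
    have [U1 _] := mall_uniq_cons v mt.
    by have [U3 _] := uniq_unzip_cons (A := Plus A B) v uS.
  split; [split; [exact: okt|split; [by rewrite /form1 /= fa|]]|].
  + split; first by move=> v; rewrite -St !in_unzip /= !res_eq => ->.
    rewrite -St.
    by rewrite /= in_unzip; case: (F a); move: (@child_eq b a a); rewrite eqxx; taut.
  + move=> v; rewrite E !in_unzip; apply: addb_eq; rewrite /= !res_eq -St !in_unzip.
    by case: (F v); move: (@child_eq b a v); taut.
- move: CS; rewrite cons_form_cat => -[CG CD].
  have [okt St] := IHt CG; have [oku Su] := IHu CD.
  split.
    do !split=> //; move=> v; rewrite /= ?andbT -?St -?Su //.
    exact: uniq_unzip_cat uS.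
  by move=> v; rewrite E in_unzip /= !andbT St Su.
- move: CS; rewrite cons_form_cat => -[CG CD].
  have [|okt St] := IHt; first by apply/cons_form_cons.
  have [|oku Su] := IHu; first by apply/cons_form_cons.
  have SS : spec T (fun v => res (Rule2 (RCut c A) t u) (inl v)).
    move=> v; rewrite E !in_unzip; apply: addb_eq; rewrite /= !res_eq -St -Su !in_unzip.
    have [U1 _] := mall_uniq_cons v mt.
    have [U2 _] := mall_uniq_cons v mu.
    have U4 := uniq_unzip_cat (v := v) uS; move: U1 U2 U4 (@cut_vertex_eq c A v).
    by taut.
  split=> //; split; [exact: okt|split; [exact: oku|]].
  do !split=> //; move=> v; rewrite ?[sub2 _ _ _]/= ?[prin2 _ _]/= ?res_eq -?St -?Su ?in_unzip //.
  + by move=> ->.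
  + by move=> ->.
  + have [U1 _] := mall_uniq_cons v mt.
    have [U2 _] := mall_uniq_cons v mu.
    have U4 := uniq_unzip_cat (v := v) uS; move: U1 U2 U4 (@cut_vertex_eq c A v).
    by taut.
  + by rewrite -SS => h; move: fr; rewrite cut_freeP => /allP/(_ _ h).
Qed.

(** The disjointness of cuts that MALL* demands of binary rules. A with adds no demand, because
    equal cuts of its premises are superimposed. That different cuts have different names is left to
    [cut_spec]. *)
Fixpoint named_apart (t : tree) : Prop :=
  match t with
  | Ax _ _ => True
  | Rule1 _ t => named_apart t
  | Rule2 r t u => named_apart t /\ named_apart u /\
      (forall x, prin2 r (inr x) -> ~~ res t (inr x) && ~~ res u (inr x)) /\
      (forall x, res t (inr x) -> ~~ res u (inr x))
  | RWith _ t u => named_apart t /\ named_apart u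
  end.

Lemma dom_select P T v : dom (select P T) v = dom T v && P v.
Proof. by rewrite /dom unzip1_select mem_filter andbC. Qed.

Lemma uniq_select P T : uniq (unzip1 T) -> uniq (unzip1 (select P T)).
Proof. by rewrite unzip1_select; apply: filter_uniq. Qed.

Lemma uniq_cons w A T : ~~ dom T w -> uniq (unzip1 T) -> uniq (unzip1 ((w, A) :: T : sequent)).
Proof. by move=> h u; rewrite /= u andbT. Qed.

Lemma uniq_cat T S : uniq (unzip1 T) -> uniq (unzip1 S) -> (forall v, dom T v -> ~~ dom S v) ->
  uniq (unzip1 (T ++ S : sequent)).
Proof.
move=> uT uS D; rewrite /unzip1 map_cat cat_uniq uT uS /= andbT.
by apply/hasPn => v vS; apply/negP => /D; rewrite /dom vS.
Qed.

Lemma is_cutsP (O S : cuts) : uniq (unzip1 O) -> uniq S -> O =i S -> is_cuts O S.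
Proof. by move=> uO uS E; rewrite /is_cuts uO; apply: uniq_perm => //; apply: map_uniq uO. Qed.

Lemma uniq_map_inj (K L : eqType) (f : K -> L) (O : seq K) : uniq (map f O) -> {in O &, injective f}.
Proof.
elim: O => // x O IH /= /andP[nx uO] y z; rewrite !inE => /predU1P[->|yO] /predU1P[->|zO] // E.
- by case/negP: nx; rewrite E; apply: map_f.
- by case/negP: nx; rewrite -E; apply: map_f.
- exact: IH.
Qed.

Lemma uniq_names (O S : cuts) : uniq (unzip1 O) -> uniq S -> {subset S <= O} -> uniq (unzip1 S).
Proof.
move=> uO uS sub; rewrite map_inj_in_uniq // => y z /sub yO /sub zO.
exact: (uniq_map_inj uO).
Qed.

Lemma uniq_filter_cat (O : cuts) (P Q : pred (nat * {fset form})) : uniq O ->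
  (forall x, P x -> ~~ Q x) -> uniq (filter P O ++ filter Q O).
Proof.
move=> u D; rewrite cat_uniq !filter_uniq //= andbT.
apply/hasPn => x; rewrite !mem_filter => /andP[Qx _]; apply/negP => /andP[/D].
by rewrite Qx.
Qed.

Definition cut_spec (O : cuts) (P : resource -> bool) :=
  uniq (unzip1 O) /\ forall x, (x \in O) = P (inr x).

Lemma cut_spec_sub (O S : cuts) P : uniq (unzip1 O) -> uniq S ->
  (forall x, (x \in S) = P (inr x)) -> {subset S <= O} -> cut_spec S P.
Proof. by move=> uO uS E sub; split=> //; apply: uniq_names sub. Qed.

(** The contexts of the premises are selected from [T], from which they inherit distinct vertices
    and the right formulas. The same contexts serve for MALL and for MALL*, where the list of cuts
    is split by filtering [O]. *)
Lemma okm_derivable t : okm t -> forall T, uniq (unzip1 T) -> cons_form T ->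
  spec T (fun v => res t (inl v)) ->
  mall m T t /\ (named_apart t -> forall O, cut_spec O (res t) -> star m O T t).
Proof.
elim: t => [x y|r t IH|r t IHt u IHu|a t IHt u IHu].
- move=> o T uT CT E; suff [P S] : exists P, is_sequent T [:: (x, Lit true P); (y, Lit false P)].
    split; first exact: mall_ax S.
    move=> _ O [_ EO]; have -> : O = [::]; last exact: star_ax S.
    by case: O EO => // z O /(_ z); rewrite inE eqxx /=.
  move: o => /=; rewrite /form0; case fx: (form_at G x) => [[[] P||||]|] //.
  case fy: (form_at G y) => [[[] Q||||]|] // /eqP EQ; subst Q; exists P.
  have ne : x != y by apply/eqP => Exy; rewrite Exy fy in fx.
  apply: is_sequentP => //.
  + by rewrite /= inE ne.
  + by move=> z; rewrite !inE => /orP[]/eqP->.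
  + by move=> v; rewrite E !in_unzip /= !res_eq orbF.
- move=> /= [o [f [S P]]] T uT CT E.
  pose Ga := select (fun v => res t (inl v) && ~~ sub1 r (inl v)) T.
  have uG : uniq (unzip1 Ga) by apply: uniq_select.
  have CG : cons_form Ga by apply: cons_select.
  have DG v : dom Ga v = res t (inl v) && ~~ sub1 r (inl v).
    rewrite dom_select E /=; apply: addb_eq; rewrite !res_eq.
    by case: (v == _); case: (res t _); case: (sub1 _ _).
  have Ta : dom T (prin1 r) by rewrite E /= eqxx.
  have Pa v : v == prin1 r -> ~~ res t (inl v) by move/eqP->.
  have [A fa TA] := cons_form_in CT Ta.
  case: r f S P Ga uG CG DG fa TA E Ta Pa => [a|b a]; rewrite /form1 /= => f S P Ga uG CG DG fa TA E Ta Pa;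
  rewrite fa in f; case: A f fa TA => // A B _ fa TA.
  + have [] := IH o ((child false a, A) :: (child true a, B) :: Ga).
    * apply: uniq_cons; last apply: uniq_cons => //.
        rewrite in_unzip DG /= !res_eq eqxx /= andbF orbF.
        by have := @child_eq2 a _ (eqxx (child false a)).
      by rewrite DG /= !res_eq eqxx orbT andbF.
    * by rewrite !cons_form_cons !form_at_child fa.
    * move=> v; rewrite !in_unzip DG; apply: addb_eq; move: (S v); rewrite /= !res_eq; taut.
    move=> h1 h2; have s : is_sequent T ((a, Parr A B) :: Ga).
      apply: is_sequentP => //; first by apply: uniq_cons => //; rewrite DG (negPf P).
        by apply/cons_form_cons.
      by move=> v; rewrite in_unzip DG E.
    split; first exact: mall_parr h1 s.
    move=> n O [uO EO]; apply: (star_parr (O1 := O)) s; last first.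
      by apply: is_cutsP => //; apply: map_uniq uO.
    by apply: h2 => //; split=> // x; rewrite EO /= andbT.
  + have [] := IH o ((child b a, if b then B else A) :: Ga).
    * by apply: uniq_cons => //; rewrite DG /= !res_eq eqxx andbF.
    * by rewrite !cons_form_cons !form_at_child fa; split=> //; case: (b).
    * move=> v; rewrite !in_unzip DG; apply: addb_eq; move: (S v); rewrite /= !res_eq; taut.
    move=> h1 h2; have s : is_sequent T ((a, Plus A B) :: Ga).
      apply: is_sequentP => //; first by apply: uniq_cons => //; rewrite DG (negPf P).
        by apply/cons_form_cons.
      by move=> v; rewrite in_unzip DG E.
    split; first exact: mall_plus h1 s.
    move=> n O [uO EO]; apply: (star_plus (O1 := O)) s; last first.
      by apply: is_cutsP => //; apply: map_uniq uO.
    by apply: h2 => //; split=> // x; rewrite EO /= andbT.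
- move=> /= [ot [ou [f [S1 [S2 [P [D F]]]]]]] T uT CT E.
  pose Ga := select (fun v => res t (inl v) && ~~ sub2 false r (inl v)) T.
  pose De := select (fun v => res u (inl v) && ~~ sub2 true r (inl v)) T.
  have uG : uniq (unzip1 Ga) by apply: uniq_select.
  have CG : cons_form Ga by apply: cons_select.
  have uD : uniq (unzip1 De) by apply: uniq_select.
  have CD : cons_form De by apply: cons_select.
  have DG v : dom Ga v = res t (inl v) && ~~ sub2 false r (inl v).
    by rewrite dom_select E /=; apply: addb_eq; case: (prin2 _ _); case: (res t _ && _);
      case: (res u _ && _).
  have DD v : dom De v = res u (inl v) && ~~ sub2 true r (inl v).
    by rewrite dom_select E /=; apply: addb_eq; case: (prin2 _ _); case: (res t _ && _);
      case: (res u _ && _).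
  have uGD : uniq (unzip1 (Ga ++ De)).
    by apply: uniq_cat => // v; rewrite DG DD; apply: D.
  have CGD : cons_form (Ga ++ De) by apply/cons_form_cat.
  have OO O : named_apart (Rule2 r t u) -> cut_spec O (res (Rule2 r t u)) ->
      let O1 := [seq x <- O | res t (inr x)] in let O2 := [seq x <- O | res u (inr x)] in
      [/\ cut_spec O1 (res t), cut_spec O2 (res u), uniq (O1 ++ O2) &
        forall x, (x \in O) = prin2 r (inr x) || (x \in O1 ++ O2)].
    move=> [_ [_ [np nd]]] [uO EO] O1 O2; have uO' := map_uniq uO.
    have ns k x : sub2 k r (inr x) = false by case: (r).
    have E1 x : (x \in O1) = res t (inr x).
      by rewrite mem_filter EO /= !ns !andbT; case: (res t _); rewrite ?orbT.
    have E2 x : (x \in O2) = res u (inr x).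
      by rewrite mem_filter EO /= !ns !andbT; case: (res u _); rewrite ?orbT.
    split.
    - by apply: (cut_spec_sub uO) => [|//|x]; [apply: filter_uniq|rewrite mem_filter => /andP[]].
    - by apply: (cut_spec_sub uO) => [|//|x]; [apply: filter_uniq|rewrite mem_filter => /andP[]].
    - exact: uniq_filter_cat nd.
    - by move=> x; rewrite mem_cat E1 E2 EO /= !ns !andbT.
  case: r f S1 S2 P D F E Ga De uG CG uD CD DG DD uGD CGD OO
    => [a|c A|] /= f S1 S2 P D F E Ga De uG CG uD CD DG DD uGD CGD OO.
  + have Ta : dom T a by rewrite E /= res_eq eqxx.
    have [A fa TA] := cons_form_in CT Ta; rewrite fa in f; case: A f fa TA => // A B _ fa TA.
    have [] := IHt ot ((child false a, A) :: Ga).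
    * by apply: uniq_cons => //; rewrite DG /= !res_eq eqxx andbF.
    * by apply/cons_form_cons; rewrite form_at_child fa.
    * by move=> v; rewrite in_unzip DG; apply: addb_eq; move: (S1 v); rewrite /= !res_eq; taut.
    have [] := IHu ou ((child true a, B) :: De).
    * by apply: uniq_cons => //; rewrite DD /= !res_eq eqxx andbF.
    * by apply/cons_form_cons; rewrite form_at_child fa.
    * by move=> v; rewrite in_unzip DD; apply: addb_eq; move: (S2 v); rewrite /= !res_eq; taut.
    move=> hu1 hu2 ht1 ht2; have s : is_sequent T ((a, Tensor A B) :: Ga ++ De).
      apply: is_sequentP => //.
      * apply: uniq_cons => //; move: (P a); rewrite res_eq eqxx => /(_ isT)/andP[n1 n2].
        by rewrite in_unzip DG DD (negPf n1) (negPf n2).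
      * by apply/cons_form_cons.
      * by move=> v; rewrite !in_unzip DG DD E /= !res_eq.
    split; first exact: mall_tensor ht1 hu1 s.
    move=> n O EO; have [c1 c2 uu EE] := OO O n EO.
    apply: star_tensor (ht2 _ _ c1) (hu2 _ _ c2) _ s; [by case: n|by case: n => _ []|].
    by apply: is_cutsP => //; case: EO.
  + have [] := IHt ot ((cut_vertex c A, A) :: Ga).
    * by apply: uniq_cons => //; rewrite DG /= !res_eq eqxx andbF.
    * by apply/cons_form_cons.
    * by move=> v; rewrite in_unzip DG; apply: addb_eq; move: (S1 v); rewrite /= !res_eq; taut.
    have [] := IHu ou ((cut_vertex c (dual A), dual A) :: De).
    * by apply: uniq_cons => //; rewrite DD /= !res_eq eqxx andbF.
    * by apply/cons_form_cons.
    * by move=> v; rewrite in_unzip DD; apply: addb_eq; move: (S2 v); rewrite /= !res_eq; taut.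
    move=> hu1 hu2 ht1 ht2; have s : is_sequent T (Ga ++ De).
      by apply: is_sequentP => // v; rewrite !in_unzip DG DD E /= !res_eq.
    have fr : cut_free_name c T.
      by rewrite cut_freeP; apply/allP => v vT; apply: F; rewrite -/(res (Rule2 (RCut c A) t u) (inl v)) -E.
    split; first exact: mall_cut ht1 hu1 fr s.
    move=> n O EO; have [c1 c2 uu EE] := OO O n EO.
    apply: star_cut (ht2 _ _ c1) (hu2 _ _ c2) _ fr s; [by case: n|by case: n => _ []|].
    apply: is_cutsP; [by case: EO| |by move=> x; rewrite EE inE].
    rewrite /= uu andbT mem_cat !mem_filter; case: n => _ [_ [np _]].
    by move: (np (c, [fset A; dual A])); rewrite eqxx => /(_ isT)/andP[/negPf-> /negPf->].
  + have [] := IHt ot Ga uG CG; first by move=> v; rewrite DG andbT.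
    have [] := IHu ou De uD CD; first by move=> v; rewrite DD andbT.
    move=> hu1 hu2 ht1 ht2; have s : is_sequent T (Ga ++ De).
      by apply: is_sequentP => // v; rewrite !in_unzip DG DD E /=.
    split; first exact: mall_mix f ht1 hu1 s.
    move=> n O EO; have [c1 c2 uu EE] := OO O n EO.
    apply: star_mix f (ht2 _ _ c1) (hu2 _ _ c2) _ s; [by case: n|by case: n => _ []|].
    by apply: is_cutsP => //; case: EO.
- move=> /= [ot [ou [f [S1 [S2 [P1 [P2 D]]]]]]] T uT CT E.
  pose Ga := select (fun v => res t (inl v) && (v != child false a)) T.
  have uG : uniq (unzip1 Ga) by apply: uniq_select.
  have CG : cons_form Ga by apply: cons_select.
  have ET v : dom T v = (v == a) || res t (inl v) && (v != child false a).
    by rewrite E /= !res_eq -D; case: (v == a); case: (_ && _).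
  have DG v : dom Ga v = res t (inl v) && (v != child false a).
    by rewrite dom_select ET; case: (v == a); case: (res t _); case: (v == _).
  have Ta : dom T a by rewrite E /= eqxx.
  have [A fa TA] := cons_form_in CT Ta; rewrite /formW fa in f; case: A f fa TA => // A B _ fa TA.
  have [] := IHt ot ((child false a, A) :: Ga).
  + by apply: uniq_cons => //; rewrite DG eqxx andbF.
  + by apply/cons_form_cons; rewrite form_at_child fa.
  + move=> v; rewrite in_unzip DG; apply: addb_eq.
    have : v == child false a -> res t (inl v) by move/eqP->.
    by taut.
  have [] := IHu ou ((child true a, B) :: Ga).
  + by apply: uniq_cons => //; rewrite DG D eqxx andbF.
  + by apply/cons_form_cons; rewrite form_at_child fa.
  + move=> v; rewrite in_unzip DG D; apply: addb_eq.
    have : v == child true a -> res u (inl v) by move/eqP->.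
    by taut.
  move=> hu1 hu2 ht1 ht2; have s : is_sequent T ((a, With A B) :: Ga).
    apply: is_sequentP => //.
    * by apply: uniq_cons => //; rewrite DG (negPf P1).
    * by apply/cons_form_cons.
    * by move=> v; rewrite in_unzip DG ET.
  split; first exact: mall_with ht1 hu1 s.
  move=> [nt nu] O [uO EO]; have uO' := map_uniq uO.
  (* Cuts are superimposed exactly when both premises contain them; the distinct names in [O] leave
     no other possibility. *)
  pose O0 := [seq x <- O | res t (inr x) && res u (inr x)].
  pose O1 := [seq x <- O | res t (inr x) && ~~ res u (inr x)].
  pose O2 := [seq x <- O | ~~ res t (inr x) && res u (inr x)].
  have E0 x : (x \in O0) = res t (inr x) && res u (inr x).
    by rewrite mem_filter EO /= !andbT; case: (res t _); case: (res u _).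
  have E1 x : (x \in O1) = res t (inr x) && ~~ res u (inr x).
    by rewrite mem_filter EO /= !andbT; case: (res t _); case: (res u _).
  have E2 x : (x \in O2) = ~~ res t (inr x) && res u (inr x).
    by rewrite mem_filter EO /= !andbT; case: (res t _); case: (res u _).
  have c1 : cut_spec (O1 ++ O0) (res t).
    apply: (cut_spec_sub uO).
    - by apply: uniq_filter_cat => // x; case: (res t _); case: (res u _).
    - by move=> x; rewrite mem_cat E1 E0; case: (res t _); case: (res u _).
    - by move=> x; rewrite mem_cat !mem_filter => /orP[]/andP[].
  have c2 : cut_spec (O2 ++ O0) (res u).
    apply: (cut_spec_sub uO).
    - by apply: uniq_filter_cat => // x; case: (res t _); case: (res u _).
    - by move=> x; rewrite mem_cat E2 E0; case: (res t _); case: (res u _).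
    - by move=> x; rewrite mem_cat !mem_filter => /orP[]/andP[].
  apply: star_with (ht2 nt _ c1) (hu2 nu _ c2) _ s.
  apply: is_cutsP => //.
  + rewrite cat_uniq filter_uniq //= uniq_filter_cat //=; last first.
      by move=> x; case: (res t _); case: (res u _).
    rewrite andbT; apply/hasPn => x; rewrite mem_cat E1 E2 E0.
    by case: (res t _); case: (res u _).
  + move=> x; rewrite !mem_cat E0 E1 E2 EO /= !andbT.
    by case: (res t _); case: (res u _).
Qed.

Lemma star_named_apart O T t : star m O T t -> named_apart t /\ cut_spec O (res t).
Proof.
have K (O0 O1 : cuts) : is_cuts O0 O1 -> uniq (unzip1 O0) /\ O0 =i O1 /\ uniq O1.
  case/andP=> u p; split=> //; split; first exact: perm_mem.
  by rewrite -(perm_uniq p); apply: map_uniq u.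
have Q (O0 O1 : cuts) x : uniq (O0 ++ O1) -> x \in O0 -> x \notin O1.
  by rewrite cat_uniq => /and3P[_ /hasPn h _] x0; apply/negP => /h; rewrite x0.
elim=> {O T t} [T x y P s|O O1 O2 T Ga D a A B t u st [nt [ut Et]] su [nu [uu Eu]] /K[uO [EO u12]] s|
  O O1 T Ga a A B t st [nt [ut Et]] /K[uO [EO _]] s|
  O O0 O1 O2 T Ga a A B t u st [nt [ut Et]] su [nu [uu Eu]] /K[uO [EO u12]] s|
  O O1 T Ga a b A B t st [nt [ut Et]] /K[uO [EO _]] s|
  O O1 O2 T Ga D t u mm st [nt [ut Et]] su [nu [uu Eu]] /K[uO [EO u12]] s|
  O O1 O2 T Ga D c A t u st [nt [ut Et]] su [nu [uu Eu]] /K[uO [EO u12]] fr s].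
- by [].
- split; last by split=> // x; rewrite EO mem_cat Et Eu /= !andbT.
  by do !split=> //; move=> x; rewrite -Et -Eu; apply: Q.
- by split=> //; split=> // x; rewrite EO Et /= andbT.
- split=> //; split=> // x; move: (Et x) (Eu x); rewrite EO !mem_cat /= !andbT => <- <-.
  by case: (x \in O1); case: (x \in O2); case: (x \in O0).
- by split=> //; split=> // x; rewrite EO Et /= andbT.
- split; last by split=> // x; rewrite EO mem_cat Et Eu /= !andbT.
  by do !split=> //; move=> x; rewrite -Et -Eu; apply: Q.
- move: u12 => /= /andP[]; rewrite mem_cat negb_or => /andP[n1 n2] u12.
  split; last by split=> // x; rewrite EO inE mem_cat Et Eu /= !andbT.
  do !split=> //; move=> x; rewrite -Et -Eu; last exact: Q.
  by move=> /eqP[->]; rewrite n1 n2.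
Qed.

(** Freshness refers to [foot] in [ok] and to [res] in [okm]. The link between the two is that
    whatever occurs inside a tree lies above something in its conclusion. *)
Lemma foot_below t z : ok t -> foot t z ->
  exists2 y, res t y & forall w, cone z w -> cone y w.
Proof.
elim: t => [x y|r t IH|r t IHt u IHu|a t IHt u IHu].
- by move=> _ h; exists z.
- move=> /= [ot [_ [S _]]] /orP[/eqP->|/(IH ot)[y ty cy]].
    by exists (inl (prin1 r)); rewrite ?eqxx.
  have [sy|ny] := boolP (sub1 r y); last by exists y; rewrite // ty ny orbT.
  by exists (inl (prin1 r)); [rewrite eqxx|move=> w /cy; apply: cone_sub1].
- move=> o; have [ot ou] := (ok_sideL (k := false) o, ok_sideR (k := false) o).
  have K k y : sub2 k r y -> exists2 p, prin2 r p & forall w, cone y w -> cone p w.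
    move=> sy; have [w cw] := cone_inhab y; have [p pp _] := cone_sub2 sy cw.
    by exists p => // w' cw'; have [q pq cq] := cone_sub2 sy cw'; rewrite (prin2_uniq pp pq).
  move=> /= /or3P[pz|/(IHt ot)[y ty cy]|/(IHu ou)[y ty cy]].
  + by exists z; rewrite ?pz.
  + have [/K[p pp cp]|ny] := boolP (sub2 false r y); last by exists y; rewrite // ty ny orbT.
    by exists p; [rewrite pp|move=> w /cy/cp].
  + have [/K[p pp cp]|ny] := boolP (sub2 true r y); last by exists y; rewrite // ty ny !orbT.
    by exists p; [rewrite pp|move=> w /cy/cp].
- move=> /= [ot [ou _]] /or3P[/eqP->|/(IHt ot)[y ty cy]|/(IHu ou)[y ty cy]].
  + by exists (inl a); rewrite ?eqxx.
  + have [E|ny] := eqVneq y (inl (child false a)); last by exists y; rewrite // ty ny orbT.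
    by exists (inl a); [rewrite eqxx|move=> w /cy; rewrite E; apply: cone_child].
  + have [E|ny] := eqVneq y (inl (child true a)); last by exists y; rewrite // ty ny !orbT.
    by exists (inl a); [rewrite eqxx|move=> w /cy; rewrite E; apply: cone_child].
Qed.

Lemma child_cone b a : ~~ cone (inl (child b a)) a.
Proof. by rewrite /cone /= eqxx /=; apply/negP => /size_prefix; rewrite size_rcons ltnn. Qed.

(** Suppose the principal vertex of a unary rule or a with occurred higher up. Some resource of the
    premise lies below it and is not active, as no vertex is above its own child; it persists in the
    conclusion and clashes with the principal formula under [anti]. For a binary rule, such a
    resource would also meet the other branch if active. *)
Lemma okm_ok t : okm t -> named_apart t -> anti (res t) -> ok t.
Proof.
elim: t => [x y|r t IH|r t IHt u IHu|a t IHt u IHu].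
- by [].
- move=> /= [o [f [S P]]] n H.
  have P' z : z == inl (prin1 r) -> ~~ res t z by move/eqP->.
  have ot := IH o n (anti_rule1_weak P' H).
  split=> //; split=> //; split; first by case=> [v|c] h; [apply: S|case/sub1_vertex: h].
  move=> z /eqP->; apply/negP => /(foot_below ot)[y ty cy].
  have cp := cy _ (cone_refl _).
  have [sy|ny] := boolP (sub1 r y).
    case: r sy cp {f S P P' H cy} => [b|c b] /=; last by move/eqP->; rewrite (negPf (child_cone _ _)).
    by case/orP=> /eqP->; rewrite (negPf (child_cone _ _)).
  have E : y = inl (prin1 r).
    by apply: (H _ _ (prin1 r)) cp (cone_refl _); rewrite /= ?ty ?ny ?eqxx ?orbT.
  by move: P; rewrite -E ty.
- move=> [o1 [o2 [f [S1 [S2 [P [D _]]]]]]] [n1 [n2 [np nd]]] H.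
  have ns k x : sub2 k r (inr x) = false by case: (r).
  have dj : disjoint2 false r t u.
    split; first by case=> [v|x] h; [case/andP: (P _ h)|case/andP: (np _ h)].
    split; first by case=> [v|x] h; [case/andP: (P _ h)|case/andP: (np _ h)].
    case=> [v|x]; first exact: D.
    by rewrite !ns !andbT; apply: nd.
  have ot := IHt o1 n1 (anti_side_weak (k := false) dj H).
  have dj' := disjoint2C dj.
  have ou := IHu o2 n2 (anti_side_weak (k := true) dj' H).
  have Q k x y p : disjoint2 k r x y -> ok x -> anti (res (side k r x y)) -> prin2 r p -> ~~ foot x p.
    move=> {}dj ox {}H pp; apply/negP => /(foot_below ox)[z xz cz].
    have [sz|nz] := boolP (sub2 k r z).
      have [z' sz' [_ cz']] := sub2_ex (~~ k) pp; have [w cw] := cone_inhab z'.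
      exact: (cone_sub2_disj sz sz' (cz _ (cz' _ cw)) cw).
    have [w cw] := cone_inhab p.
    have E : z = p by apply: (H _ _ w) (cz _ cw) cw; rewrite res_side ?xz ?nz ?pp ?orbT.
    by case: dj => /(_ _ pp); rewrite -E xz.
  split=> //; split=> //; split=> //.
  split; first by case=> [v|x] h; [apply: S1|rewrite ns in h].
  split; first by case=> [v|x] h; [apply: S2|rewrite ns in h].
  split; first by move=> z; apply: Q dj ot H.
  split; first by move=> z; apply: (Q true) dj' ou H.
  move=> z /(foot_below ot)[y ty cy]; apply/negP => /(foot_below ou)[y' uy cy'].
  have [w cw] := cone_inhab z.
  exact: (sep_side_weak (k := false) dj H ty uy (cy _ cw) (cy' _ cw)).
- move=> [o1 [o2 [f [S1 [S2 [P1 [P2 D]]]]]]] [n1 n2] H.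
  have ot := IHt o1 n1 (anti_with_prem_weak (k := false) P1 P2 H).
  have ou := IHu o2 n2 (anti_with_prem_weak (k := true) P1 P2 H).
  have Q j : ok (if j then u else t) -> ~~ res (if j then u else t) (inl a) ->
      ~~ foot (if j then u else t) (inl a).
    move=> oj nj; apply/negP => /(foot_below oj)[y ty cy].
    have cp := cy _ (cone_refl _).
    have [E|ny] := eqVneq y (inl (child j a)).
      by rewrite E (negPf (child_cone _ _)) in cp.
    have E : y = inl a.
      apply: (H _ _ a) cp (cone_refl _); rewrite /= ?eqxx //.
      by case: (j) ty ny => -> ->; rewrite ?orbT.
    by rewrite -E ty in nj.
  do 3!split=> //; split; first by move=> z /eqP->.
  split; first by move=> z /eqP->.
  split; first by move=> z /eqP->; apply: (Q false).
  split; first by move=> z /eqP->; apply: (Q true).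
  by case=> [v|x] // _; rewrite !res_eq D addbb.
Qed.

(** Freshness of cut names is the one condition that [ok] does not express: an open vertex with the
    name of a cut would lie in the cone of that cut, against [anti]. *)
Lemma ok_okm t : ok t -> anti (res t) -> okm t.
Proof.
elim: t => [x y|r t IH|r t IHt u IHu|a t IHt u IHu].
- by [].
- move=> o H; have ot := IH (proj1 o) (anti_rule1 o H); move: o => [_ [f [S P]]].
  split=> //; split=> //; split=> [v|]; first exact: S.
  by apply: contra (P _ (eqxx _)); apply: res_foot.
- move=> o H; have H1 := anti_side (k := false) o H; have H2 := anti_side2 (k := false) o H.
  have [P1 [P2 D]] := ok_disjoint2 (k := false) o; move: o => [ot [ou [f [S1 [S2 _]]]]].
  split; first exact: IHt. split; first exact: IHu.
  split=> //; split; first by move=> v; apply: S1. split; first by move=> v; apply: S2.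
  split; first by move=> v h; rewrite P1 // P2.
  split; first by move=> v; apply: D.
  move=> v hv; case: r f S1 S2 P1 P2 D H hv {H1 H2} => // c A f S1 S2 P1 P2 D H hv.
  apply/negP => nv; have : inr (c, [fset A; dual A]) = inl v :> resource by
    apply: (H _ _ v) hv _ (cone_refl v) => //=; rewrite eqxx.
  by [].
- move=> o H; have [P1 P2] := with_prin o.
  have H1 := anti_with_prem (k := false) o H; have H2 := anti_with_prem (k := true) o H.
  move: o => [ot [ou [f [S1 [S2 [_ [_ D]]]]]]].
  split; first exact: IHt. split; first exact: IHu.
  split=> //; split; first exact: S1. split; first exact: S2.
  split=> //; split=> // v; exact: addb_eq (D (inl v) isT).
Qed.

End Bridge.

(** * The conclusion of a whole proof *)

Lemma conclusion_mem G x : x \in conclusion G -> exists2 i, x.1 = (Concl i, [::]) & ohead (drop i G) = Some x.2.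
Proof.
case/mapP=> -[i A] /= h ->; exists i => //=.
have [j + E] := nthP (0, A) h.
rewrite size_zip size_iota minnn => lt; move: E; rewrite nth_zip ?size_iota // => -[].
by rewrite nth_iota // add0n => <- <-; rewrite (drop_nth A) // nth_iota.
Qed.

Lemma conclusion_cons G : cons_form G (conclusion G).
Proof. by move=> x /conclusion_mem[i E f]; rewrite E /form_at /= f. Qed.

Lemma conclusion_uniq G : uniq (unzip1 (conclusion G)).
Proof.
rewrite /unzip1 /conclusion -map_comp (eq_map (g := (fun i => (Concl i, [::])) \o fst)) //.
rewrite map_comp -/(unzip1 _) unzip1_zip ?size_iota //.
by rewrite map_inj_uniq ?iota_uniq // => i j [].
Qed.

(** Formulas have distinct roots [Concl i], cuts have distinct names, and no root [Concl i] lies in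
    the cone of a cut. *)
Lemma conclusion_anti G O (S : resource -> bool) : spec (conclusion G) (fun v => S (inl v)) ->
  cut_spec O S -> anti S.
Proof.
move=> sp [uO EO].
have K v : S (inl v) -> exists i, v = (Concl i, [::]).
  by rewrite -sp => /mapP[x /conclusion_mem[i E _] ->]; exists i.
case=> [v|[c P]] [v'|[c' P']] w.
- by move=> /K[i ->] /K[j ->] /andP[/= /eqP E _] /andP[/= /eqP E' _]; move: E'; rewrite -E => -[->].
- by move=> /K[i ->] _ /andP[/= /eqP E _]; rewrite /cone -E.
- by move=> _ /K[i ->] + /andP[/= /eqP E _]; rewrite /cone -E.
- rewrite -!EO /cone => h h'; case: (w.1) => // d A /eqP E /eqP E'.
  by congr inr; apply: (uniq_map_inj uO) => //=; rewrite -E -E'.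
Qed.

Lemma in_context_or R1 R2 t u : in_context (fun t u => R1 t u \/ R2 t u) t u ->
  in_context R1 t u \/ in_context R2 t u.
Proof.
elim=> {t u} [t u [h|h]|r t u _ [h|h]|r t u v _ [h|h]|r t u v _ [h|h]|a t u v _ [h|h]|a t u v _ [h|h]];
  by [left; constructor|right; constructor].
Qed.

Lemma in_context_sub (R1 R2 : tree -> tree -> Prop) t u : (forall t u, R1 t u -> R2 t u) ->
  in_context R1 t u -> in_context R2 t u.
Proof. by move=> S; elim=> *; constructor; auto. Qed.

(** * Proof-net equivalence implies commutation *)

Section Forward.
Variables (m : bool) (G : seq form).

Lemma eqv_commutation t u : eqv m G t u -> ok m G t -> anti (res t) ->
  spec (conclusion G) (fun v => res t (inl v)) ->
  forall (Ht : mall m (conclusion G) t) (Hu : mall m (conclusion G) u),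
  commutation_equiv (exist (fun t => mall m (conclusion G) t) t Ht) (exist _ u Hu).
Proof.
elim=> {t u} [t u [_ [_ [_ [_ c]]]]|t|t u e IH|t u v e1 IH1 e2 IH2] o H sp Ht Hu.
- apply: rst_step; case: (in_context_or c) => h; [by right|left; apply: rst_step; right].
  apply: in_context_sub h => x y []; [exact: ident_mix|exact: ident_cut].
- by apply: rst_step; left; apply: rst_step; left.
- have E := eqv_res e; apply: rst_sym; apply: IH.
  + exact: eqv_okr e o.
  + by apply: anti_ext H => z; rewrite E.
  + by move=> w; rewrite sp E.
- have E := eqv_res e1; have ou := eqv_ok e1 o; have Hu' := eqv_anti e1 H.
  have sp' : spec (conclusion G) (fun v => res u (inl v)) by move=> w; rewrite sp E.
  have [Hm _] := okm_derivable (ok_okm ou Hu') (conclusion_uniq G) (@conclusion_cons G) sp'.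
  by apply: rst_trans (IH1 o H sp Ht Hm) (IH2 ou Hu' sp' Hm Hu).
Qed.

Lemma translates_commutation (p q : mall_proof m G) O theta :
  translates p O theta -> translates q O theta -> commutation_equiv p q.
Proof.
case=> [[t st] [/= sp tt]] [[u su] [/= sq tu]].
have same p1 p2 : @same_proof m G p1 p2 -> commutation_equiv p1 p2.
  by move=> h; apply: rst_step; left.
apply: (rst_trans _ _ _ _ _ (same _ _ sp)); apply: rst_trans (rst_sym _ _ _ _ (same _ _ sq)).
have [ot et] := mall_okm (star_mall st) (@conclusion_cons G).
have [ou eu] := mall_okm (star_mall su) (@conclusion_cons G).
have [nt ct] := star_named_apart st; have [nu cu] := star_named_apart su.
have At := conclusion_anti et ct; have Au := conclusion_anti eu cu.
have Ot := okm_ok ot nt At; have Ou := okm_ok ou nu Au.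
apply: eqv_commutation => //.
apply: (@coherent m G (tsize t + tsize u).+1) => //.
- by case=> [v|x]; [rewrite -et -eu|rewrite -(proj2 ct) -(proj2 cu)].
- by move=> l; rewrite /lnk tt tu.
Qed.

End Forward.

(** * Renaming of cuts *)

Lemma swapK c d : involutive (swap c d).
Proof.
move=> n; rewrite /swap; case: (eqVneq n c) => [->|nc].
  by rewrite eqxx; case: eqVneq.
by case: (eqVneq n d) => [->|nd]; rewrite ?eqxx // (negPf nc) (negPf nd).
Qed.

Lemma swapC c d : swap c d =1 swap d c.
Proof.
move=> n; rewrite /swap; case: (eqVneq n c) => [->|//].
by case: eqVneq.
Qed.

Lemma swap_vertexK c d : involutive (swap_vertex c d).
Proof. by case=> [[i|n A] s] //; rewrite /swap_vertex /= swapK. Qed.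

Lemma swap_vertexC c d : swap_vertex c d =1 swap_vertex d c.
Proof. by case=> [[i|n A] s] //; rewrite /swap_vertex /= swapC. Qed.

Lemma swap_treeK c d : involutive (swap_tree c d).
Proof.
elim=> [x y|[a|b a] t IH|[a|n A|] t IHt u IHu|a t IHt u IHu] /=;
by rewrite ?swap_vertexK ?swapK ?IH ?IHt ?IHu.
Qed.

Lemma swap_treeC c d : swap_tree c d =1 swap_tree d c.
Proof.
elim=> [x y|[a|b a] t IH|[a|n A|] t IHt u IHu|a t IHt u IHu] /=;
by rewrite ?[swap_vertex c d _]swap_vertexC ?[swap c d _]swapC ?IH ?IHt ?IHu // [swap_vertex c d y]swap_vertexC.
Qed.

Definition swap_res (c d : nat) (x : resource) : resource :=
  match x with inl v => inl (swap_vertex c d v) | inr (n, P) => inr (swap c d n, P) end.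

Lemma swap_resK c d : involutive (swap_res c d).
Proof. by case=> [v|[n P]] /=; rewrite ?swap_vertexK ?swapK. Qed.

Lemma swap_res_eq c d z x : (z == swap_res c d x) = (swap_res c d z == x).
Proof. by rewrite (inv_eq (@swap_resK c d)). Qed.

Lemma swap_vertex_named c d n v : named n (swap_vertex c d v) = named (swap c d n) v.
Proof. by case: v => [[i|k A] s] //=; rewrite /named /= (inv_eq (@swapK c d)). Qed.

Definition swap_rule1 (c d : nat) (r : rule1) : rule1 :=
  match r with RParr a => RParr (swap_vertex c d a) | RPlus b a => RPlus b (swap_vertex c d a) end.

Definition swap_rule2 (c d : nat) (r : rule2) : rule2 :=
  match r with
  | RTensor a => RTensor (swap_vertex c d a)
  | RCut n A => RCut (swap c d n) A
  | RMix => RMix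
  end.

Lemma swap_tree_rule1 c d r t : swap_tree c d (Rule1 r t) = Rule1 (swap_rule1 c d r) (swap_tree c d t).
Proof. by case: r. Qed.

Lemma swap_tree_rule2 c d r t u :
  swap_tree c d (Rule2 r t u) = Rule2 (swap_rule2 c d r) (swap_tree c d t) (swap_tree c d u).
Proof. by case: r. Qed.

Lemma sub1_swap c d r z : sub1 (swap_rule1 c d r) z = sub1 r (swap_res c d z).
Proof. by case: r => [a|b a] /=; rewrite -!swap_res_eq. Qed.

Lemma sub2_swap c d k r z : sub2 k (swap_rule2 c d r) z = sub2 k r (swap_res c d z).
Proof. by case: r => [a|n A|] //=; rewrite -!swap_res_eq. Qed.

Lemma prin2_swap c d r z : prin2 (swap_rule2 c d r) z = prin2 r (swap_res c d z).
Proof. by case: r => [a|n A|] //=; rewrite -!swap_res_eq. Qed.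

Lemma prin1_swap c d r : prin1 (swap_rule1 c d r) = swap_vertex c d (prin1 r).
Proof. by case: r. Qed.

(** Equivariance: a transposition is its own inverse, so the renaming of the tree moves to the
    argument. *)
Lemma res_swap c d t z : res (swap_tree c d t) z = res t (swap_res c d z).
Proof.
elim: t => [x y|r t IH|r t IHt u IHu|a t IHt u IHu].
- by rewrite /= -!swap_res_eq.
- by rewrite swap_tree_rule1 /= IH sub1_swap -swap_res_eq prin1_swap.
- by rewrite swap_tree_rule2 /= IHt IHu !sub2_swap prin2_swap.
- by rewrite /= IHt IHu -!swap_res_eq.
Qed.

Definition swap_link (c d : nat) (e : link) : link := [fset swap_vertex c d v | v in e].

Definition swap_linking (c d : nat) (l : linking) : linking := [fset swap_link c d e | e in l].

Lemma swap_linkingU c d l l' :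
  swap_linking c d (l `|` l') = swap_linking c d l `|` swap_linking c d l'.
Proof. by rewrite /swap_linking imfsetU. Qed.

Lemma swap_linkingK c d : involutive (swap_linking c d).
Proof.
have K : involutive (swap_link c d).
  move=> e; apply/fsetP => v; rewrite /swap_link; apply/imfsetP/idP => [[w /imfsetP[u /= h ->] ->]|h].
    by rewrite swap_vertexK.
  by exists (swap_vertex c d v); rewrite ?swap_vertexK //; apply/imfsetP; exists v.
move=> l; apply/fsetP => v; rewrite /swap_linking; apply/imfsetP/idP => [[w /imfsetP[u /= h ->] ->]|h].
  by rewrite K.
by exists (swap_link c d v); rewrite ?K //; apply/imfsetP; exists v.
Qed.

Lemma lnk_swap c d t l : lnk t l -> lnk (swap_tree c d t) (swap_linking c d l).
Proof.
elim: t l => [x y|r t IH|r t IHt u IHu|a t IHt u IHu] l.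
- by move/lnk_ax->; apply/lnk_ax; rewrite /swap_linking imfset_fset1 /swap_link imfset_fset2.
- by rewrite swap_tree_rule1 !lnk_rule1; apply: IH.
- rewrite swap_tree_rule2 !lnk_rule2 => -[l1 [l2 [h1 [h2 ->]]]].
  exists (swap_linking c d l1), (swap_linking c d l2); rewrite swap_linkingU.
  by split; [apply: IHt|split; [apply: IHu|]].
- by rewrite /= !lnk_with => -[h|h]; [left; apply: IHt|right; apply: IHu].
Qed.

Lemma lnk_swap_eq c d t u : (forall l, lnk t l <-> lnk u l) ->
  forall l, lnk (swap_tree c d t) l <-> lnk (swap_tree c d u) l.
Proof.
move=> E l; split=> /(lnk_swap c d); rewrite swap_treeK => /E /(lnk_swap c d);
by rewrite swap_linkingK.
Qed.

Section Renaming.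
Variables (m : bool) (G : seq form).
Notation okm := (okm m G).

Lemma form_at_swap c d v : form_at G (swap_vertex c d v) = form_at G v.
Proof. by case: v => [[i|n A] s]. Qed.

(** All conditions are equivariant, and the formula at a vertex does not depend on the name of its
    cut. *)
Lemma okm_swap c d t : okm t -> okm (swap_tree c d t).
Proof.
elim: t => [x y|r t IH|r t IHt u IHu|a t IHt u IHu].
- by rewrite /= /form0 !form_at_swap.
- rewrite swap_tree_rule1 /= => -[/IH ot [f [S P]]]; split=> //.
  split; first by case: r f {S P} => [a|b a]; rewrite /form1 /= form_at_swap.
  split=> [v|]; first by rewrite sub1_swap res_swap; apply: S.
  by rewrite res_swap prin1_swap /= swap_vertexK.
- rewrite swap_tree_rule2 => -[/IHt ot [/IHu ou [f [S1 [S2 [P [D F]]]]]]].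
  split=> //; split=> //.
  split; first by case: r f {S1 S2 P D F} => [a|n A|] //=; rewrite form_at_swap.
  split=> [v|]; first by rewrite sub2_swap res_swap; apply: S1.
  split=> [v|]; first by rewrite sub2_swap res_swap; apply: S2.
  split=> [v|]; first by rewrite prin2_swap !res_swap; apply: P.
  split=> v; first by rewrite !sub2_swap !res_swap; apply: D.
  rewrite -swap_tree_rule2 res_swap => /F.
  by case: r {f S1 S2 P D F} => [a|n A|] //=; rewrite swap_vertex_named.
- move=> /= [/IHt ot [/IHu ou [f [S1 [S2 [P1 [P2 D]]]]]]].
  split=> //; split=> //; rewrite /formW form_at_swap; split=> //.
  rewrite !res_swap /= swap_vertexK; split; first by rewrite -[X in inl X](swap_vertexK c d) in S1.
  split; first by rewrite -[X in inl X](swap_vertexK c d) in S2.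
  split=> //; split=> // v; rewrite !res_swap /=.
  have E b : (v == child b (swap_vertex c d a)) = (swap_vertex c d v == child b a).
    by rewrite (inv_eq (@swap_vertexK c d)).
  by rewrite !E; apply: D.
Qed.

Lemma named_apart_swap c d t : named_apart t -> named_apart (swap_tree c d t).
Proof.
elim: t => [x y|r t IH|r t IHt u IHu|a t IHt u IHu].
- by [].
- by rewrite swap_tree_rule1.
- rewrite swap_tree_rule2 => -[/IHt nt [/IHu nu [P D]]].
  split=> //; split=> //; split=> [[n Q]|[n Q]]; rewrite ?prin2_swap !res_swap; [apply: P|apply: D].
- by move=> [/IHt ? /IHu ?].
Qed.

Definition astep t u := okm t /\ okm u /\ (forall v, res t (inl v) = res u (inl v)) /\
  in_context ident t u.

(* A counterpart of [same_proof] on trees that keeps track of validity and of the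
   conclusion. *)
Definition aeq := clos_refl_sym_trans tree astep.

Lemma aeq_refl t : aeq t t. Proof. exact: rst_refl. Qed.
Lemma aeq_sym t u : aeq t u -> aeq u t. Proof. exact: rst_sym. Qed.
Lemma aeq_trans t u v : aeq t u -> aeq u v -> aeq t v. Proof. exact: rst_trans. Qed.

Lemma aeq_same t u : aeq t u -> (okm t <-> okm u) /\ (forall v, res t (inl v) = res u (inl v)).
Proof.
elim=> {t u} [t u [? [? [? _]]]|t|t u _ [E R]|t u v _ [E1 R1] _ [E2 R2]] //.
- by split=> // ; split=> /E.
- by rewrite E1; split=> // w; rewrite R1.
Qed.

Lemma aeq_okm t u : aeq t u -> okm t -> okm u.
Proof. by case/aeq_same=> E _ /E. Qed.

Lemma aeq_res t u v : aeq t u -> res t (inl v) = res u (inl v).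
Proof. by case/aeq_same. Qed.

Lemma aeq_context (C : tree -> tree) :
  (forall t u, in_context ident t u -> in_context ident (C t) (C u)) ->
  (forall t u, okm t -> okm u -> (forall v, res t (inl v) = res u (inl v)) ->
    okm (C t) -> okm (C u) /\ (forall v, res (C t) (inl v) = res (C u) (inl v))) ->
  forall t u, aeq t u -> okm (C t) -> okm t -> aeq (C t) (C u).
Proof.
move=> H1 H2 t u; elim=> {t u} [t u [ot' [ou [R c]]] o _|t _ _|t u e IH o ot|t u v e IH1 _ IH2 o ot].
- have [? ?] := H2 _ _ ot' ou R o.
  by apply: rst_step; do 3!split=> //; apply: H1.
- exact: aeq_refl.
- have [E R] := aeq_same e; apply/aeq_sym/IH; last exact/E.
  by apply: (proj1 (H2 u t _ _ _ o)) => //; exact/E.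
- apply: (aeq_trans (IH1 o ot)); apply: IH2; last exact: aeq_okm ot.
  exact: aeq_okm (IH1 o ot) o.
Qed.

Lemma aeq_rule1 r t u : aeq t u -> okm (Rule1 r t) -> aeq (Rule1 r t) (Rule1 r u).
Proof.
move=> e o; apply: (aeq_context (C := Rule1 r) _ _ e o); last by case: o.
  by move=> *; apply: ctx_rule1.
move=> x y ox oy R /= [_ [? [S P]]]; split; last by move=> v; rewrite R.
by split=> //; split=> //; split=> [v /S|]; rewrite -R.
Qed.

Lemma okm_side k r x y : okm (side k r x y) <->
  okm x /\ okm y /\ form2 m G r /\
      (forall v, sub2 k r (inl v) -> res x (inl v)) /\
      (forall v, sub2 (~~ k) r (inl v) -> res y (inl v)) /\
      (forall v, prin2 r (inl v) -> ~~ res x (inl v) && ~~ res y (inl v)) /\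
      (forall v, res x (inl v) && ~~ sub2 k r (inl v) ->
         ~~ (res y (inl v) && ~~ sub2 (~~ k) r (inl v))) /\
      (forall v, res (side k r x y) (inl v) -> fresh_cut r v).
Proof.
case: k; split=> //= -[? [? [? [? [? [P [D F]]]]]]]; do !split=> //; move=> v;
  by [move/P; rewrite andbC|move=> h; apply/negP => /D; rewrite h].
Qed.

Lemma aeq_side k r t t' u : aeq t t' -> okm (side k r t u) -> aeq (side k r t u) (side k r t' u).
Proof.
move=> e o; apply: (aeq_context (C := fun t => side k r t u) _ _ e o); last by case/okm_side: o.
  by move=> *; apply: ctx_side.
move=> x y ox oy R /okm_side[_ [ou [f [S1 [S2 [P [D F]]]]]]]; split; last first.
  by move=> v; rewrite !res_side R.
apply/okm_side; split=> //; split=> //; split=> //.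
split=> [v /S1|]; first by rewrite R.
split=> //; split=> [v /P|]; first by rewrite R.
split=> v; first by rewrite -R; apply: D.
by rewrite res_side -R -res_side; apply: F.
Qed.

Lemma aeq_side2 k r t t' u u' : aeq t t' -> aeq u u' -> okm (side k r t u) ->
  aeq (side k r t u) (side k r t' u').
Proof.
move=> e e' o; have e1 := aeq_side e o; apply: (aeq_trans e1).
rewrite sideC [side k r t' u']sideC; apply: aeq_side => //.
by rewrite -sideC; apply: aeq_okm e1 o.
Qed.

Lemma aeq_with a t t' u u' : aeq t t' -> aeq u u' -> okm (RWith a t u) ->
  aeq (RWith a t u) (RWith a t' u').
Proof.
move=> e e' o; have e1 : aeq (RWith a t u) (RWith a t' u).
  apply: (aeq_context (C := fun t => RWith a t u) _ _ e o); last by case: o.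
    by move=> *; apply: ctx_withl.
  move=> x y ox oy R /= [_ [? [? [S1 [S2 [P1 [P2 D]]]]]]]; split; last by move=> v; rewrite R.
  by rewrite -!R; do !split=> //; move=> v; rewrite -R.
apply: (aeq_trans e1); have {}o := aeq_okm e1 o.
apply: (aeq_context (C := RWith a t') _ _ e' o); last by case: o => _ [].
  by move=> *; apply: ctx_withr.
move=> x y ox oy R /= [? [_ [? [S1 [S2 [P1 [P2 D]]]]]]]; split; last by move=> v; rewrite R.
by rewrite -!R; do !split=> //; move=> v; rewrite -R.
Qed.

Lemma swap_unnamed c d v : ~~ named c v -> ~~ named d v -> swap_vertex c d v = v.
Proof. by case: v => [[i|n A] s] //; rewrite /named /swap_vertex /swap /= => /negPf-> /negPf->. Qed.

Lemma res_swap_unnamed c d t v : (forall v, res t (inl v) -> ~~ named c v && ~~ named d v) ->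
  res (swap_tree c d t) (inl v) = res t (inl v).
Proof.
move=> H; rewrite res_swap /=.
have [/andP[h h']|n] := boolP (~~ named c v && ~~ named d v); first by rewrite swap_unnamed.
have Sc : swap c d c = d by rewrite /swap eqxx.
have Sd : swap c d d = c by rewrite swapC /swap eqxx.
have -> : res t (inl v) = false by apply/negP => /H; rewrite (negPf n).
by apply/negP => /H; rewrite !swap_vertex_named Sc Sd andbC (negPf n).
Qed.

Lemma named_child n b a : named n (child b a) = named n a.
Proof. by []. Qed.

Lemma named_sub1 n r v : sub1 r (inl v) -> named n v = named n (prin1 r).
Proof. by case: r => [a|b a] /=; [case/orP|]; move=> /eqP[->]. Qed.

(** The renaming travels upwards through rules that mention neither name, until a cut binds [c] or
    [d]. There [ident_rename] renames both premises at once, whatever they contain. *)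
Lemma aeq_swap c d t : okm t -> (forall v, res t (inl v) -> ~~ named c v && ~~ named d v) ->
  aeq t (swap_tree c d t).
Proof.
elim: t => [x y|r t IH|r t IHt u IHu|a t IHt u IHu] o H.
- have /andP[h1 h2] : ~~ named c x && ~~ named d x by apply: H; rewrite /= eqxx.
  have /andP[h3 h4] : ~~ named c y && ~~ named d y by apply: H; rewrite /= eqxx orbT.
  rewrite /= !swap_unnamed //.
  exact: aeq_refl.
- have /andP[n1 n2] := H (prin1 r) (introT orP (or_introl (eqxx _))).
  rewrite swap_tree_rule1.
  have -> : swap_rule1 c d r = r by case: (r) n1 n2 => [a|b a] /= n1 n2; rewrite swap_unnamed.
  apply: aeq_rule1 => //; apply: IH; first by case: o.
  move=> v tv; have [sv|nv] := boolP (sub1 r (inl v)).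
    by rewrite !(named_sub1 _ sv) n1 n2.
  by apply: H; rewrite /= tv nv orbT.
- case: r o H => [a|n A|] o H.
  + have /andP[n1 n2] : ~~ named c a && ~~ named d a by apply: H; rewrite /= eqxx.
    rewrite swap_tree_rule2 /= swap_unnamed //; apply: (aeq_side2 (k := false)) => //.
      apply: IHt => [|v tv]; first by case: o.
      have [/eqP[->]|nv] := boolP (sub2 false (RTensor a) (inl v)); first by rewrite !named_child n1.
      by apply: H; rewrite /= tv nv orbT.
    apply: IHu => [|v tv]; first by case: o => _ [].
    have [/eqP[->]|nv] := boolP (sub2 true (RTensor a) (inl v)); first by rewrite !named_child n1.
    by apply: H; rewrite /= tv nv !orbT.
  + have [/orP ncd|] := boolP ((n == c) || (n == d)).
      have os : okm (swap_tree c d (Rule2 (RCut n A) t u)) by apply: okm_swap.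
      apply: rst_step; split=> //; split=> //; split.
        by move=> v; rewrite res_swap_unnamed.
      apply: ctx_here; rewrite swap_tree_rule2 /=; case: ncd => /eqP->.
        have -> : swap c d c = d by rewrite /swap eqxx.
        exact: ident_rename.
      have -> : swap c d d = c by rewrite swapC /swap eqxx.
      rewrite !(swap_treeC c d); exact: ident_rename.
    rewrite negb_or => /andP[nc nd].
    rewrite swap_tree_rule2 /= /swap (negPf nc) (negPf nd); apply: (aeq_side2 (k := false)) => //.
      apply: IHt => [|v tv]; first by case: o.
      have [/eqP[->]|nv] := boolP (sub2 false (RCut n A) (inl v)); first by rewrite /named /= nc.
      by apply: H; rewrite /= tv nv.
    apply: IHu => [|v tv]; first by case: o => _ [].
    have [/eqP[->]|nv] := boolP (sub2 true (RCut n A) (inl v)); first by rewrite /named /= nc.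
    by apply: H; rewrite /= tv nv !orbT.
  + apply: (aeq_side2 (k := false)) => //.
      by apply: IHt => [|v tv]; [case: o|apply: H; rewrite /= tv].
    by apply: IHu => [|v tv]; [case: o => _ []|apply: H; rewrite /= tv !orbT].
- have /andP[n1 n2] : ~~ named c a && ~~ named d a by apply: H; rewrite /= eqxx.
  rewrite /= swap_unnamed //; apply: aeq_with => //.
    apply: IHt => [|v tv]; first by case: o.
    have [->|nv] := eqVneq v (child false a); first by rewrite !named_child n1.
    by apply: H; rewrite /= tv res_eq nv orbT.
  apply: IHu => [|v tv]; first by case: o => _ [].
  have [->|nv] := eqVneq v (child true a); first by rewrite !named_child n1.
  by apply: H; rewrite /= tv res_eq nv !orbT.
Qed.

End Renaming.

(** * Names occurring in a tree *)

Definition res_name (x : resource) : option nat :=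
  match x with
  | inl v => if v.1 is CutRoot n _ then Some n else None
  | inr (n, _) => Some n
  end.

Definition names (t : tree) : seq nat := pmap res_name (resources t).

Lemma foot_names t z n : foot t z -> res_name z = Some n -> n \in names t.
Proof. by rewrite footE => h E; rewrite mem_pmap -E map_f. Qed.

Lemma names_foot t u : (forall z, foot t z -> foot u z) -> {subset names t <= names u}.
Proof.
move=> S n; rewrite mem_pmap => /mapP[z]; rewrite -footE => /S h E.
exact: foot_names h (esym E).
Qed.

Lemma named_names t v n : foot t (inl v) -> named n v -> n \in names t.
Proof.
move=> h; rewrite /named => E; apply: foot_names h _ => /=.
by case: (v.1) E => // k A /eqP->.
Qed.

Lemma cut_names t x : foot t (inr x) -> x.1 \in names t.
Proof. by case: x => n P h; apply: foot_names h _. Qed.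

Definition functional (P : pred (nat * {fset form})) :=
  forall x y, P x -> P y -> x.1 = y.1 -> x = y.

(** What makes a valid tree a MALL* proof. The last clause separates the names of cuts from those of
    open branches, so that a cut rule applied later cannot reuse the name of a cut already made. *)
Definition clean (t : tree) : Prop :=
  named_apart t /\ functional (fun x => res t (inr x)) /\
  (forall x v, res t (inr x) -> res t (inl v) -> ~~ named x.1 v).

Definition avoids (X : seq nat) (t : tree) := forall x, res t (inr x) -> x.1 \notin X.

Lemma avoids_sub X Y t : {subset Y <= X} -> avoids X t -> avoids Y t.
Proof. by move=> S H x /H; apply: contra; apply: S. Qed.

Lemma sub2_cut k r x : sub2 k r (inr x) = false.
Proof. by case: r. Qed.

Lemma sub1_cut r x : sub1 r (inr x) = false.
Proof. by case: r. Qed.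

Lemma res_side_cut k r x y c :
  res (side k r x y) (inr c) = [|| prin2 r (inr c), res x (inr c) | res y (inr c)].
Proof. by rewrite res_side !sub2_cut !andbT. Qed.

Lemma prin2_cut r x : prin2 r (inr x) -> exists A, r = RCut x.1 A.
Proof. by case: r => [a|c A|] //= /eqP[->]; exists A. Qed.

Lemma prin2_functional r : functional (fun x => prin2 r (inr x)).
Proof. by move=> x y hx hy _; case: (prin2_uniq hx hy). Qed.

(** * Representatives with the same linkings *)

Section Representatives.
Variables (m : bool) (G : seq form).
Notation okm := (okm m G).
Notation aeq := (aeq m G).

Lemma clean_swap c d t : clean t -> clean (swap_tree c d t).
Proof.
move=> [n [f u]]; split; first exact: named_apart_swap.
have E n' : swap c d (swap c d n') = n' := swapK c d n'.
split=> [[x P] [y Q]|[x P] v]; rewrite !res_swap /=.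
  by move=> h h' Exy; have /(_ (congr1 _ Exy)) [_ ->] := f _ _ h h'; rewrite Exy.
by move=> h h'; have := u _ _ h h'; rewrite swap_vertex_named E.
Qed.

Lemma clean_rule1 r t : okm (Rule1 r t) -> clean t -> clean (Rule1 r t).
Proof.
move=> [_ [_ [S _]]] [n [f u]]; split=> //; split=> [x y|x v] /=; rewrite ?sub1_cut ?andbT.
  exact: f.
move=> h; rewrite res_eq => /orP[/eqP->|/andP[h' _]]; last exact: u.
have [[v'|//] sv _] := sub1_ex r; rewrite -(named_sub1 _ sv).
by apply: u h _; apply: S.
Qed.

Lemma cut_sub2 k c A : sub2 k (RCut c A) (inl (cut_vertex c (if k then dual A else A))).
Proof. by rewrite /= eqxx. Qed.

(** The active vertex of the cut rule carries the name of the cut, and [clean] keeps this name away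
    from the cuts of the premise. *)
Lemma clean_prin2 r x k y : (forall v, sub2 k r (inl v) -> res y (inl v)) -> clean y ->
  prin2 r (inr x) -> forall z, res y (inr z) -> x.1 != z.1.
Proof.
move=> S [_ [_ u]] /prin2_cut[A E] z yz; apply/eqP => Exz; subst r.
have := u _ _ yz (S _ (cut_sub2 k x.1 A)); by rewrite /named /= -Exz eqxx.
Qed.

Lemma clean_side k r x y : okm (side k r x y) -> clean x -> clean y ->
  (forall a b, res x (inr a) -> res y (inr b) -> a.1 != b.1) ->
  (forall a v, res x (inr a) || res y (inr a) -> res (side k r x y) (inl v) -> ~~ named a.1 v) ->
  clean (side k r x y).
Proof.
move=> o cx cy D H; have [nx [fx ux]] := cx; have [ny [fy uy]] := cy.
move: (o) => /okm_side[_ [_ [_ [S1 [S2 [_ [_ F]]]]]]].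
have P1 a b : prin2 r (inr a) -> res x (inr b) -> a.1 != b.1.
  by move=> pa; apply: clean_prin2 S1 cx pa _.
have P2 a b : prin2 r (inr a) -> res y (inr b) -> a.1 != b.1.
  by move=> pa; apply: clean_prin2 S2 cy pa _.
have N : named_apart (side k r x y).
  have K a : prin2 r (inr a) -> ~~ res x (inr a) && ~~ res y (inr a).
    by move=> pa; apply/andP; split; apply/negP => h; [have := P1 _ _ pa h|have := P2 _ _ pa h]; rewrite eqxx.
  have L a : res x (inr a) -> ~~ res y (inr a).
    by move=> xa; apply/negP => /(D _ _ xa); rewrite eqxx.
  case: (k) => /=; do !split=> //; first by move=> a /K; rewrite andbC.
  by move=> a h; apply/negP => /L; rewrite h.
split=> //; split=> [a b|a v].
  rewrite !res_side_cut => /or3P[pa|xa|ya] /or3P[pb|xb|yb] E.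
  - exact: prin2_functional pa pb E.
  - by have := P1 _ _ pa xb; rewrite E eqxx.
  - by have := P2 _ _ pa yb; rewrite E eqxx.
  - by have := P1 _ _ pb xa; rewrite E eqxx.
  - exact: fx xa xb E.
  - by have := D _ _ xa yb; rewrite E eqxx.
  - by have := P2 _ _ pb ya; rewrite E eqxx.
  - by have := D _ _ xb ya; rewrite E eqxx.
  - exact: fy ya yb E.
rewrite res_side_cut => /or3P[pa|xa|ya] hv; last 2 first.
- by apply: H hv; rewrite xa.
- by apply: H hv; rewrite ya orbT.
by have [A E] := prin2_cut pa; have := F _ hv; rewrite E.
Qed.

Lemma clean_with a t u : okm (RWith a t u) -> clean t -> clean u ->
  (forall x y, res t (inr x) -> res u (inr y) -> x.1 = y.1 -> x = y) ->
  (forall x v, res t (inr x) || res u (inr x) -> res (RWith a t u) (inl v) -> ~~ named x.1 v) ->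
  clean (RWith a t u).
Proof.
move=> o [nt [ft ut]] [nu [fu uu]] D H; split=> //; split=> [x y|x v] /=; rewrite ?andbT.
  move=> /orP[h|h] /orP[h'|h'] E; [exact: ft E|exact: D E| |exact: fu E].
  by apply/esym; apply: D => //; rewrite E.
by move=> h h'; apply: H.
Qed.

(** [p'] and [q'] are other notations for the proofs [p] and [q], with the same cuts and linkings on
    both sides, so that one pair [O], [theta] serves as a translation of both. *)
Definition rep p q p' q' := aeq p p' /\ aeq q q' /\ clean p' /\ clean q' /\
  (forall x, res p' (inr x) = res q' (inr x)) /\ (forall l, lnk p' l <-> lnk q' l).

Lemma rep_swap p q p' q' c d : okm p -> okm q -> (forall v, res p (inl v) = res q (inl v)) ->
  rep p q p' q' -> (forall v, res p (inl v) -> ~~ named c v && ~~ named d v) ->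
  rep p q (swap_tree c d p') (swap_tree c d q').
Proof.
move=> op oq E [ep [eq [cp [cq [R L]]]]] H.
split; first by apply: (aeq_trans ep); apply: aeq_swap;
  [apply: aeq_okm ep op|move=> v; rewrite -(aeq_res _ ep); apply: H].
split; first by apply: (aeq_trans eq); apply: aeq_swap;
  [apply: aeq_okm eq oq|move=> v; rewrite -(aeq_res _ eq) -E; apply: H].
split; first exact: clean_swap. split; first exact: clean_swap.
split=> [x|]; first by rewrite !res_swap; case: x => n P /=; rewrite R.
exact: lnk_swap_eq.
Qed.

(** The names in [X] are freed one at a time, each being exchanged with a new one; the same
    transposition acts on both representatives. *)
Lemma rep_avoid p q p' q' X : okm p -> okm q -> (forall v, res p (inl v) = res q (inl v)) ->
  rep p q p' q' -> exists p'' q'', rep p q p'' q'' /\ avoids X p''.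
Proof.
move=> op oq E r0; elim: X => [|e X [p1 [q1 [r1 A1]]]]; first by exists p', q'.
have [/hasP[z zp /andP[z1 z2]]|n] :=
  boolP (has (fun z => res p1 z && (~~ is_vertex z && (res_name z == Some e))) (resources p1)); last first.
  exists p1, q1; split=> // x px; rewrite inE negb_or A1 // andbT.
  apply: contra n => /eqP Ex; apply/hasP; exists (inr x); first by rewrite -footE res_foot.
  by rewrite px /=; case: x Ex {px} => k P /= ->.
case: z zp z1 z2 => [//|[k P]] zp z1 /= /eqP[Ek]; rewrite {k}Ek in zp z1.
(* Larger than every name in sight, because a sum bounds each of its terms. *)
pose e' := (sumn (e :: names p1 ++ X)).+1.
have big n : n \in e :: names p1 ++ X -> n != e'.
  move=> h; rewrite neq_ltn /e' ltnS; apply/orP; left; elim: (_ :: _) h => //= k l IH.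
  by rewrite inE => /predU1P[->|/IH h]; [apply: leq_addr|apply: leq_trans h (leq_addl _ _)].
have [ep [_ [[_ [_ up]] _]]] := r1.
exists (swap_tree e e' p1), (swap_tree e e' q1); split.
  apply: rep_swap => // v; rewrite (aeq_res _ ep) => pv; rewrite (up _ _ z1 pv) /=.
  apply/negP => nv; have := big e'; rewrite eqxx inE mem_cat (named_names (res_foot pv) nv) orbT => /(_ isT) //.
move=> [k Q]; rewrite res_swap /= => h.
have hn := cut_names (res_foot h); have /= hX := A1 _ h.
have big' : swap e e' k != e' by apply: big; rewrite inE mem_cat hn orbT.
have ke : k != e.
  by apply: contra big' => /eqP->; rewrite /swap eqxx.
rewrite inE negb_or ke /=; have [E'|ke'] := eqVneq k e'.
  by apply/negP => kX; have := big k; rewrite E' eqxx inE mem_cat -E' kX !orbT => /(_ isT).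
by move: hX; rewrite /swap (negPf ke) (negPf ke').
Qed.

Lemma rep_rule1 r p q p' q' : okm (Rule1 r p) -> okm (Rule1 r q) -> rep p q p' q' ->
  rep (Rule1 r p) (Rule1 r q) (Rule1 r p') (Rule1 r q').
Proof.
move=> op oq [ep [eq [cp [cq [R L]]]]].
have e1 := aeq_rule1 ep op; have e2 := aeq_rule1 eq oq.
split=> //; split=> //; split; first exact: clean_rule1 (aeq_okm e1 op) cp.
split; first exact: clean_rule1 (aeq_okm e2 oq) cq.
by split=> [x|l]; [rewrite /= R|rewrite !lnk_rule1].
Qed.

Lemma foot_sideL k r x y z : foot x z -> foot (side k r x y) z.
Proof. by rewrite foot_side => ->; rewrite orbT. Qed.

(** The premise [u] receives a single representative for both sides. Its cuts avoid the names in
    [p'], and all cuts avoid the names in the surrounding tree. *)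
Lemma rep_side k r p q u : okm (side k r p u) -> okm (side k r q u) ->
  (forall v, res (side k r p u) (inl v) = res (side k r q u) (inl v)) ->
  (forall v, res p (inl v) = res q (inl v)) ->
  (exists p' q', rep p q p' q') -> (exists u' u'', rep u u u' u'') ->
  exists p' q', rep (side k r p u) (side k r q u) p' q'.
Proof.
move=> op oq ET E [p0 [q0 r0]] [u0 [u0' ru0]].
have [okp oku] : okm p /\ okm u by case/okm_side: op => ? [].
have okq : okm q by case/okm_side: oq.
have [p' [q' [[ep [eq [cp [cq [R L]]]]] Ap]]] := rep_avoid (names (side k r p u)) okp okq E r0.
have [u' [u'' [[eu [_ [cu _]]] Au]]] :=
  rep_avoid (names (side k r p u) ++ names p') oku oku (fun v => erefl) ru0.
have e1 := aeq_side2 ep eu op; have e2 := aeq_side2 eq eu oq.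
have Ap' : avoids (names (side k r p u)) q' by move=> x; rewrite -R; apply: Ap.
have Au' : avoids (names (side k r p u)) u' by apply: avoids_sub Au => n h; rewrite mem_cat h.
have D a b : res p' (inr a) -> res u' (inr b) -> a.1 != b.1.
  move=> pa ub; apply/eqP => Eab; have := Au _ ub.
  by rewrite mem_cat -Eab (cut_names (res_foot pa)) orbT.
have N a v : a \notin names (side k r p u) -> res (side k r p u) (inl v) -> ~~ named a v.
  by move=> na hv; apply: contra na => /(named_names (res_foot hv)).
exists (side k r p' u'), (side k r q' u'); split=> //; split=> //; split; last split; last split.
- apply: clean_side (aeq_okm e1 op) cp cu D _ => a v.
  by rewrite -(aeq_res _ e1) => /orP[/Ap|/Au'] h hv; apply: N hv.
- apply: clean_side (aeq_okm e2 oq) cq cu _ _ => [a b|a v]; first by rewrite -R; apply: D.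
  by rewrite -(aeq_res _ e2) -ET => /orP[/Ap'|/Au'] h hv; apply: N hv.
- by move=> x; rewrite !res_side_cut R.
- by move=> l; rewrite !lnk_side; split=> -[l1 [l2 [/L h1 h2]]]; exists l1, l2.
Qed.

Definition choose b (x y : tree) a := if b then RWith a y x else RWith a x y.

Lemma rep_with b a p q u : okm (choose b p u a) -> okm (choose b q u a) ->
  (forall v, res (choose b p u a) (inl v) = res (choose b q u a) (inl v)) ->
  (forall v, res p (inl v) = res q (inl v)) ->
  (exists p' q', rep p q p' q') -> (exists u' u'', rep u u u' u'') ->
  exists p' q', rep (choose b p u a) (choose b q u a) p' q'.
Proof.
move=> op oq ET E [p0 [q0 r0]] [u0 [u0' ru0]].
have [okp oku] : okm p /\ okm u by case: b op {oq ET} => -[? []].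
have okq : okm q by case: b oq {op ET} => -[? []].
set X := names (choose b p u a).
have [p' [q' [[ep [eq [cp [cq [R L]]]]] Ap]]] := rep_avoid X okp okq E r0.
have [u' [u'' [[eu [_ [cu _]]] Au]]] := rep_avoid (X ++ names p') oku oku (fun v => erefl) ru0.
have e1 : aeq (choose b p u a) (choose b p' u' a) by case: b op {oq ET X Ap Au} => op; apply: aeq_with.
have e2 : aeq (choose b q u a) (choose b q' u' a) by case: b oq {op ET X Ap Au e1} => oq; apply: aeq_with.
have Ap' : avoids X q' by move=> x; rewrite -R; apply: Ap.
have Au' : avoids X u' by apply: avoids_sub Au => n h; rewrite mem_cat h.
have D x y : res p' (inr x) -> res u' (inr y) -> x.1 = y.1 -> x = y.
  move=> pa ub Eab; have := Au _ ub.
  by rewrite mem_cat -Eab (cut_names (res_foot pa)) orbT.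
have N x v : x \notin X -> res (choose b p u a) (inl v) -> ~~ named x v.
  by move=> na hv; apply: contra na => /(named_names (res_foot hv)).
have C p1 : okm (choose b p1 u' a) -> clean p1 -> avoids X p1 ->
    (forall x y, res p1 (inr x) -> res u' (inr y) -> x.1 = y.1 -> x = y) ->
    (forall v, res (choose b p1 u' a) (inl v) -> res (choose b p u a) (inl v)) ->
    clean (choose b p1 u' a).
  move=> o1 c1 A1 D1 S1; case: b o1 {op oq ET e1 e2} @X Ap Au Ap' Au' N A1 S1
    => o1 X Ap Au Ap' Au' N A1 S1; apply: clean_with => //.
  - by move=> x y h h' Exy; apply/esym; apply: D1.
  - by move=> x v /orP[/Au'|/A1] h /S1 hv; apply: N hv.
  - by move=> x v /orP[/A1|/Au'] h /S1 hv; apply: N hv.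
exists (choose b p' u' a), (choose b q' u' a); split=> //; split=> //; split; last split; last split.
- by apply: (C _ (aeq_okm e1 op)) => // v; rewrite -(aeq_res _ e1).
- apply: (C _ (aeq_okm e2 oq)) => // [x y|v]; first by rewrite -R; apply: D.
  by rewrite -(aeq_res _ e2) ET.
- by move=> x; case: (b) => /=; rewrite R.
- by move=> l; case: (b); rewrite !lnk_with L.
Qed.

(** The diagonal case is phrased with [rep] so that the congruence lemmas above build it as well. *)
Lemma rep_exists t : okm t -> exists t' t'', rep t t t' t''.
Proof.
elim: t => [x y|r t IH|r t IHt u IHu|a t IHt u IHu] o.
- exists (Ax x y), (Ax x y); do !split=> //; exact: aeq_refl.
- by have [t' [t'' h]] := IH (proj1 o); exists (Rule1 r t'), (Rule1 r t''); apply: rep_rule1.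
- apply: (rep_side (k := false)) => //; first by apply: IHt; case: o.
  by apply: IHu; case: o => _ [].
- apply: (rep_with (b := false)) => //; first by apply: IHt; case: o.
  by apply: IHu; case: o => _ [].
Qed.

Lemma clean_exists t X : okm t -> exists t', aeq t t' /\ clean t' /\ avoids X t'.
Proof.
move=> o; have [t0 [t1 r0]] := rep_exists o.
have [t' [t'' [[e [_ [c _]]] A]]] := rep_avoid X o o (fun v => erefl) r0.
by exists t'.
Qed.

(** * Subproofs with cuts named apart *)

Definition apart (x y : tree) := forall a b, res x (inr a) -> res y (inr b) -> a.1 != b.1.

Lemma apartC x y : apart x y -> apart y x.
Proof. by move=> H a b ya xb; rewrite eq_sym; apply: H. Qed.

Lemma avoids_apart x y : avoids (names x) y -> apart x y.
Proof.
move=> H a b xa /H; apply: contra => /eqP <-.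
by apply: cut_names; apply: res_foot.
Qed.

Lemma avoids_cat X Y t : avoids (X ++ Y) t -> avoids X t /\ avoids Y t.
Proof. by split; apply: avoids_sub H => n h; rewrite mem_cat h ?orbT. Qed.

Definition instance X t t' := aeq t t' /\ clean t' /\ avoids X t'.

Lemma instance2 X x y : okm x -> okm y -> exists x' y',
  instance X x x' /\ instance X y y' /\ apart x' y'.
Proof.
move=> ox oy; have [x' [ex [cx ax]]] := clean_exists X ox.
have [y' [ey [cy /avoids_cat[ay /avoids_apart]]]] := clean_exists (X ++ names x') oy.
by exists x', y'.
Qed.

Lemma instance3 X x y t : okm x -> okm y -> okm t -> exists x' y' t',
  instance X x x' /\ instance X y y' /\ instance X t t' /\ apart x' y' /\ apart x' t' /\ apart y' t'.
Proof.
move=> ox oy ot; have [x' [y' [ix [iy axy]]]] := instance2 X ox oy.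
have [t' [et [ct /avoids_cat[aX /avoids_cat[/avoids_apart ax /avoids_apart ay]]]]] :=
  clean_exists (X ++ names x' ++ names y') ot.
by exists x', y', t'.
Qed.

Lemma instance4 X x y t u : okm x -> okm y -> okm t -> okm u -> exists x' y' t' u',
  instance X x x' /\ instance X y y' /\ instance X t t' /\ instance X u u' /\
  (apart x' y' /\ apart x' t' /\ apart y' t') /\ (apart x' u' /\ apart y' u' /\ apart t' u').
Proof.
move=> ox oy ot ou; have [x' [y' [t' [ix [iy [it a3]]]]]] := instance3 X ox oy ot.
have [u' [eu [cu]]] := clean_exists (X ++ names x' ++ names y' ++ names t') ou.
case/avoids_cat=> aX /avoids_cat[/avoids_apart ax /avoids_cat[/avoids_apart ay /avoids_apart at_]].
by exists x', y', t', u'.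
Qed.

Lemma avoid_named X w w' c a v : {subset names w <= X} -> aeq w w' -> avoids X c ->
  res c (inr a) -> res w' (inl v) -> ~~ named a.1 v.
Proof.
move=> S e A /A na; rewrite -(aeq_res _ e) => wv.
by apply: contra na => /(named_names (res_foot wv))/S.
Qed.

Lemma clean_instance_side k r x y x' y' X : {subset names (side k r x y) <= X} ->
  okm (side k r x y) -> instance X x x' -> instance X y y' -> apart x' y' ->
  aeq (side k r x y) (side k r x' y') /\ clean (side k r x' y').
Proof.
move=> S o [ex [cx ax]] [ey [cy ay]] D; have e := aeq_side2 ex ey o.
split=> //; apply: clean_side (aeq_okm e o) cx cy D _ => a v /orP[h|h] hv.
  exact: avoid_named S e ax h hv.
exact: avoid_named S e ay h hv.
Qed.

Lemma clean_instance_with a x y x' y' X : {subset names (RWith a x y) <= X} ->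
  okm (RWith a x y) -> instance X x x' -> instance X y y' -> apart x' y' ->
  aeq (RWith a x y) (RWith a x' y') /\ clean (RWith a x' y').
Proof.
move=> S o [ex [cx ax]] [ey [cy ay]] D; have e := aeq_with ex ey o.
split=> //; apply: clean_with (aeq_okm e o) cx cy _ _ => [b c xb yc E|b v /orP[h|h] hv].
- by move: (D _ _ xb yc); rewrite E eqxx.
- exact: avoid_named S e ax h hv.
- exact: avoid_named S e ay h hv.
Qed.

Lemma rep_redex p q p' q' : aeq p p' /\ clean p' -> aeq q q' /\ clean q' ->
  (forall x, res p' (inr x) = res q' (inr x)) -> redex p' q' -> rep p q p' q'.
Proof.
move=> [e c] [e' c'] R h; do 5!split=> //.
by apply: redex_lnk; apply: ctx_here.
Qed.

(** Validity of the inner rule [r] makes its cut name fresh for the inner conclusion only, whereas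
    [clean] needs it fresh for the outer one. This hypothesis is supplied by the other side of the
    commutation, where [r] is the last rule. *)
Lemma clean22 j s k r x y t x' y' t' X :
  okm (side j s (side k r x y) t) -> {subset names (side j s (side k r x y) t) <= X} ->
  (forall v, res (side j s (side k r x y) t) (inl v) -> fresh_cut r v) ->
  instance X x x' -> instance X y y' -> instance X t t' ->
  apart x' y' -> apart x' t' -> apart y' t' ->
  aeq (side j s (side k r x y) t) (side j s (side k r x' y') t') /\
  clean (side j s (side k r x' y') t').
Proof.
move=> o S F ix iy it axy axt ayt; have oi : okm (side k r x y) by case/okm_side: o.
have Si : {subset names (side k r x y) <= X}.
  by move=> n h; apply: S; apply: names_foot h => z; apply: foot_sideL.
have [ei ci] := clean_instance_side Si oi ix iy axy.
have [et [ct At]] := it; have e := aeq_side2 ei et o.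
split=> //; apply: clean_side (aeq_okm e o) ci ct _ _ => [a b|a v].
  rewrite res_side_cut => /or3P[pa tb|xa|ya]; [|exact: axt|exact: ayt].
  apply/eqP => E; have := At _ tb; rewrite -E S //.
  by apply: cut_names; apply: foot_sideL; rewrite foot_side pa.
rewrite res_side_cut => h hv; case/orP: h => [/or3P[pa|xa|ya]|ta].
- rewrite -(aeq_res _ e) in hv; have [A E] := prin2_cut pa.
  by have := F _ hv; rewrite E.
- exact: avoid_named S e (proj2 (proj2 ix)) xa hv.
- exact: avoid_named S e (proj2 (proj2 iy)) ya hv.
- exact: avoid_named S e At ta hv.
Qed.

Lemma cleanWW a b t u v w t' u' v' w' X :
  okm (RWith a (RWith b t u) (RWith b v w)) ->
  {subset names (RWith a (RWith b t u) (RWith b v w)) <= X} ->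
  instance X t t' -> instance X u u' -> instance X v v' -> instance X w w' ->
  apart t' u' -> apart v' w' -> apart t' v' -> apart t' w' -> apart u' v' -> apart u' w' ->
  aeq (RWith a (RWith b t u) (RWith b v w)) (RWith a (RWith b t' u') (RWith b v' w')) /\
  clean (RWith a (RWith b t' u') (RWith b v' w')).
Proof.
move=> o S it iu iv iw atu avw atv atw auv auw.
have [o1 o2] : okm (RWith b t u) /\ okm (RWith b v w) by case: o => ? [].
have S1 : {subset names (RWith b t u) <= X}.
  by move=> n h; apply: S; apply: names_foot h => z /= ->; rewrite orbT.
have S2 : {subset names (RWith b v w) <= X}.
  by move=> n h; apply: S; apply: names_foot h => z /= ->; rewrite !orbT.
have [e1 c1] := clean_instance_with S1 o1 it iu atu.
have [e2 c2] := clean_instance_with S2 o2 iv iw avw.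
have e := aeq_with e1 e2 o.
split=> //; apply: clean_with (aeq_okm e o) c1 c2 _ _ => [x y|x z].
  rewrite /= !andbT => /orP[h|h] /orP[h'|h'] E;
  by [move: (atv _ _ h h'); rewrite E eqxx|move: (atw _ _ h h'); rewrite E eqxx
     |move: (auv _ _ h h'); rewrite E eqxx|move: (auw _ _ h h'); rewrite E eqxx].
rewrite [res (RWith b t' u') _]/= [res (RWith b v' w') _]/= !andbT => /orP[/orP[h|h]|/orP[h|h]] hv.
- exact: avoid_named S e (proj2 (proj2 it)) h hv.
- exact: avoid_named S e (proj2 (proj2 iu)) h hv.
- exact: avoid_named S e (proj2 (proj2 iv)) h hv.
- exact: avoid_named S e (proj2 (proj2 iw)) h hv.
Qed.

(** Both premises of the with use the same [r] and the same instance [t'], so their common cuts are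
    superimposed; the cuts of [x'] and [y'] are kept apart. *)
Lemma cleanW2 k a r x y t x' y' t' X :
  okm (RWith a (side k r x t) (side k r y t)) ->
  {subset names (RWith a (side k r x t) (side k r y t)) <= X} ->
  (forall v, res (RWith a (side k r x t) (side k r y t)) (inl v) -> fresh_cut r v) ->
  instance X x x' -> instance X y y' -> instance X t t' ->
  apart x' y' -> apart x' t' -> apart y' t' ->
  aeq (RWith a (side k r x t) (side k r y t)) (RWith a (side k r x' t') (side k r y' t')) /\
  clean (RWith a (side k r x' t') (side k r y' t')).
Proof.
move=> o S F ix iy it axy axt ayt.
have [o1 o2] : okm (side k r x t) /\ okm (side k r y t) by case: o => ? [].
have S1 : {subset names (side k r x t) <= X}.
  by move=> n h; apply: S; apply: names_foot h => z /= ->; rewrite orbT.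
have S2 : {subset names (side k r y t) <= X}.
  by move=> n h; apply: S; apply: names_foot h => z /= ->; rewrite !orbT.
have [e1 c1] := clean_instance_side S1 o1 ix it axt.
have [e2 c2] := clean_instance_side S2 o2 iy it ayt.
have e := aeq_with e1 e2 o.
have P x1 : prin2 r (inr x1) -> x1.1 \in X.
  by move=> p; apply: S1; apply: cut_names; rewrite foot_side p.
have PX z x1 y1 : instance X z z -> prin2 r (inr x1) -> res z (inr y1) -> x1.1 != y1.1.
  by move=> [_ [_ A]] /P h /A; apply: contra => /eqP <-.
have [[_ [_ Ax]] [[_ [_ Ay]] [_ [[_ [ft _]] At]]]] := (ix, (iy, it)).
split=> //; apply: clean_with (aeq_okm e o) c1 c2 _ _ => [b c|b v].
  rewrite !res_side_cut => /or3P[pb|xb|tb] /or3P[pc|yc|tc] E.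
  - exact: prin2_functional pb pc E.
  - by have := Ay _ yc; rewrite -E P.
  - by have := At _ tc; rewrite -E P.
  - by have := Ax _ xb; rewrite E P.
  - by have := axy _ _ xb yc; rewrite E eqxx.
  - by have := axt _ _ xb tc; rewrite E eqxx.
  - by have := At _ tb; rewrite E P.
  - by have := ayt _ _ yc tb; rewrite E eqxx.
  - exact: ft E.
have Q : prin2 r (inr b) -> res (RWith a (side k r x' t') (side k r y' t')) (inl v) -> ~~ named b.1 v.
  move=> pb; rewrite -(aeq_res _ e) => /F; by have [A ->] := prin2_cut pb.
rewrite !res_side_cut => /orP[/or3P[pb|xb|tb]|/or3P[pb|yb|tb]] hv.
- exact: Q.
- exact: avoid_named S e Ax xb hv.
- exact: avoid_named S e At tb hv.
- exact: Q.
- exact: avoid_named S e Ay yb hv.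
- exact: avoid_named S e At tb hv.
Qed.

Lemma okm_fresh_cut k r x y v : okm (side k r x y) -> res (side k r x y) (inl v) -> fresh_cut r v.
Proof. by case/okm_side=> _ [_ [_ [_ [_ [_ [_ F]]]]]]; apply: F. Qed.

Lemma sub_catl (X Y : seq nat) : {subset X <= X ++ Y}.
Proof. by move=> n h; rewrite mem_cat h. Qed.

Lemma sub_catr (X Y : seq nat) : {subset Y <= X ++ Y}.
Proof. by move=> n h; rewrite mem_cat h orbT. Qed.

(* The commutations, up to the sides of the premises. *)
Inductive redex_shape : tree -> tree -> Prop :=
| shape_1_1 r s t : redex_shape (Rule1 r (Rule1 s t)) (Rule1 s (Rule1 r t))
| shape_1_2 k r s x y : redex_shape (Rule1 r (side k s x y)) (side k s (Rule1 r x) y)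
| shape_2_2 j k s r x y t :
    redex_shape (side j s (side k r x y) t) (side k r (side j s x t) y)
| shape_W_1 a r t u : redex_shape (RWith a (Rule1 r t) (Rule1 r u)) (Rule1 r (RWith a t u))
| shape_W_2 k a r x y t :
    redex_shape (RWith a (side k r x t) (side k r y t)) (side k r (RWith a x y) t)
| shape_W_W a b t u v w :
    redex_shape (RWith a (RWith b t u) (RWith b v w)) (RWith b (RWith a t v) (RWith a u w)).

Lemma commute_shape p q : commute p q -> redex_shape p q.
Proof.
case.
- exact: shape_1_1.
- by move=> r s t u; exact: (shape_1_2 false).
- by move=> r s t u; exact: (shape_1_2 true r s u t).
- by move=> r s t u v; exact: (shape_2_2 false false r s t u v).
- by move=> r s t u v; exact: (shape_2_2 false true r s u t v).
- by move=> r s t u v; exact: (shape_2_2 true false r s t u v).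
- by move=> r s t u v; exact: (shape_2_2 true true r s u t v).
- exact: shape_W_1.
- by move=> a r t u v; exact: (shape_W_2 false a r).
- by move=> a r t u v; exact: (shape_W_2 true a r t u v).
- exact: shape_W_W.
Qed.

(** Both sides are assembled from the same subproofs. These are instantiated once, avoiding the
    names of either side and of each other, and plugged into both shapes. *)
Lemma rep_commute p q : commute p q -> okm p -> okm q ->
  (forall v, res p (inl v) = res q (inl v)) -> exists p' q', rep p q p' q'.
Proof.
case/commute_shape=> {p q} [r s t|k r s x y|j k s r x y t|a r t u|k a r x y t|a b t u v w] op oq E.
- have ot : okm t by case: op => [[]].
  have [t' [et [ct _]]] := clean_exists [::] ot.
  have e1 := aeq_rule1 et (proj1 op); have e1' := aeq_rule1 e1 op.
  have e2 := aeq_rule1 et (proj1 oq); have e2' := aeq_rule1 e2 oq.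
  exists (Rule1 r (Rule1 s t')), (Rule1 s (Rule1 r t')); apply: rep_redex.
  + split=> //; apply: clean_rule1 (aeq_okm e1' op) _.
    exact: clean_rule1 (aeq_okm e1 (proj1 op)) ct.
  + split=> //; apply: clean_rule1 (aeq_okm e2' oq) _.
    exact: clean_rule1 (aeq_okm e2 (proj1 oq)) ct.
  + by move=> x; rewrite /= !sub1_cut !andbT.
  + by left; apply: comm_1_1.
- have oi : okm (side k s x y) := proj1 op.
  have [ox oy] : okm x /\ okm y by case/okm_side: oi => ? [].
  set X := names (side k s x y) ++ names (side k s (Rule1 r x) y).
  have [x' [y' [ix [iy axy]]]] := instance2 X ox oy.
  have [ei ci] := clean_instance_side (@sub_catl _ _) oi ix iy axy.
  have or1 : okm (Rule1 r x) by case/okm_side: oq.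
  have [ex [cx Ax]] := ix; have er := aeq_rule1 ex or1.
  have ir : instance X (Rule1 r x) (Rule1 r x').
    split=> //; split; first exact: clean_rule1 (aeq_okm er or1) cx.
    by move=> z; rewrite /= sub1_cut andbT; apply: Ax.
  have eo := aeq_rule1 ei op.
  exists (Rule1 r (side k s x' y')), (side k s (Rule1 r x') y'); apply: rep_redex.
  + by split=> //; apply: clean_rule1 (aeq_okm eo op) ci.
  + apply: clean_instance_side (@sub_catr _ _) oq ir iy _.
    by move=> a b; rewrite /= sub1_cut andbT; apply: axy.
  + by move=> z; rewrite /= !res_side_cut /= !sub1_cut !andbT.
  + exact: comm_1_side.
- have [oi ot] : okm (side k r x y) /\ okm t by case/okm_side: op => ? [].
  have [ox oy] : okm x /\ okm y by case/okm_side: oi => ? [].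
  have [x' [y' [t' [ix [iy [it [axy [axt ayt]]]]]]]] :=
    instance3 (names (side j s (side k r x y) t) ++ names (side k r (side j s x t) y)) ox oy ot.
  exists (side j s (side k r x' y') t'), (side k r (side j s x' t') y'); apply: rep_redex.
  + apply: clean22 op (@sub_catl _ _) _ ix iy it axy axt ayt => v.
    by rewrite E; apply: okm_fresh_cut.
  + apply: clean22 oq (@sub_catr _ _) _ ix it iy axt axy (apartC ayt) => v.
    by rewrite -E; apply: okm_fresh_cut.
  + by move=> z; rewrite !res_side_cut; case: (prin2 r _); case: (prin2 s _); case: (res x' _);
      case: (res y' _); case: (res t' _).
  + left; case: (j) (k) => [] []; [exact: comm_2_2rr|exact: comm_2_2rl|exact: comm_2_2lr|exact: comm_2_2ll].
- have [[ot _] [[ou _] _]] := op; have [or1 [or2 _]] := op.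
  set X := names (RWith a (Rule1 r t) (Rule1 r u)) ++ names (Rule1 r (RWith a t u)).
  have [t' [u' [it [iu atu]]]] := instance2 X ot ou.
  have ir z z' : okm (Rule1 r z) -> instance X z z' -> instance X (Rule1 r z) (Rule1 r z').
    move=> oz [ez [cz Az]]; have er := aeq_rule1 ez oz.
    split=> //; split; first exact: clean_rule1 (aeq_okm er oz) cz.
    by move=> c; rewrite /= sub1_cut andbT; apply: Az.
  have oi := proj1 oq; have Si : {subset names (RWith a t u) <= X}.
    move=> n h; apply: sub_catr; apply: names_foot h => z hz.
    by apply/orP; right.
  have [ei ci] := clean_instance_with Si oi it iu atu; have eo := aeq_rule1 ei oq.
  exists (RWith a (Rule1 r t') (Rule1 r u')), (Rule1 r (RWith a t' u')); apply: rep_redex.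
  + apply: clean_instance_with (@sub_catl _ _) op (ir _ _ or1 it) (ir _ _ or2 iu) _.
    by move=> c d; rewrite /= !sub1_cut !andbT; apply: atu.
  + by split=> //; apply: clean_rule1 (aeq_okm eo oq) ci.
  + by move=> z; rewrite /= !sub1_cut !andbT.
  + by left; apply: comm_with_1.
- have [oi ot] : okm (RWith a x y) /\ okm t by case/okm_side: oq => ? [].
  have [ox [oy _]] := oi.
  set X := names (RWith a (side k r x t) (side k r y t)) ++ names (side k r (RWith a x y) t).
  have [x' [y' [t' [ix [iy [it [axy [axt ayt]]]]]]]] := instance3 X ox oy ot.
  have Si : {subset names (RWith a x y) <= X}.
    by move=> n h; apply: sub_catr; apply: names_foot h => z; apply: foot_sideL.
  have [ei ci] := clean_instance_with Si oi ix iy axy.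
  exists (RWith a (side k r x' t') (side k r y' t')), (side k r (RWith a x' y') t'); apply: rep_redex.
  + apply: cleanW2 op (@sub_catl _ _) _ ix iy it axy axt ayt => v.
    by rewrite E; apply: okm_fresh_cut.
  + apply: clean_instance_side (@sub_catr _ _) oq _ it _.
      split=> //; split=> // z; rewrite /= !andbT => /orP[]; [exact: (proj2 (proj2 ix))|exact: (proj2 (proj2 iy))].
    by move=> c d; rewrite /= !andbT => /orP[]; [apply: axt|apply: ayt].
  + move=> z; rewrite res_side_cut /= !res_side_cut; rewrite !andbT.
    by case: (prin2 r _); case: (res x' _); case: (res y' _); case: (res t' _).
  + exact: comm_with_side.
- have [[ot [ou _]] [[ov [ow _]] _]] := op.
  have [t' [u' [v' [w' [it [iu [iv [iw [[atu [atv auv]] [atw [auw avw]]]]]]]]]]] :=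
    instance4 (names (RWith a (RWith b t u) (RWith b v w)) ++ names (RWith b (RWith a t v) (RWith a u w))) ot ou ov ow.
  exists (RWith a (RWith b t' u') (RWith b v' w')), (RWith b (RWith a t' v') (RWith a u' w')); apply: rep_redex.
  + exact: cleanWW op (@sub_catl _ _) it iu iv iw atu avw atv atw auv auw.
  + exact: cleanWW oq (@sub_catr _ _) it iv iu iw atv auw atu atw (apartC auv) avw.
  + by move=> z; rewrite /= !andbT orbACA.
  + by left; apply: comm_with_with.
Qed.

(** The proviso of a commutation is stated at the root, as equality of conclusions; this and the
    next two lemmas carry it up to the place where the rules are exchanged. *)
Lemma vres_rule1 r t u : okm (Rule1 r t) -> okm (Rule1 r u) ->
  (forall v, res (Rule1 r t) (inl v) = res (Rule1 r u) (inl v)) ->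
  forall v, res t (inl v) = res u (inl v).
Proof.
have K t1 u1 : okm (Rule1 r t1) -> okm (Rule1 r u1) ->
  (forall v, res (Rule1 r t1) (inl v) = res (Rule1 r u1) (inl v)) ->
  forall v, res t1 (inl v) -> res u1 (inl v).
  move=> [_ [_ [_ P]]] [_ [_ [S _]]] R v tv; have [/S//|nv] := boolP (sub1 r (inl v)).
  have := R v; rewrite /= tv nv orbT => /esym/orP[/eqP[Ev]|/andP[]//].
  by move: P; rewrite -Ev tv.
by move=> o o' R v; apply/idP/idP; apply: K.
Qed.

Lemma vres_side k r t t' u : okm (side k r t u) -> okm (side k r t' u) ->
  (forall v, res (side k r t u) (inl v) = res (side k r t' u) (inl v)) ->
  forall v, res t (inl v) = res t' (inl v).
Proof.
have K t1 t2 : okm (side k r t1 u) -> okm (side k r t2 u) ->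
  (forall v, res (side k r t1 u) (inl v) = res (side k r t2 u) (inl v)) ->
  forall v, res t1 (inl v) -> res t2 (inl v).
  move=> /okm_side[_ [_ [_ [_ [_ [P [D _]]]]]]] /okm_side[_ [_ [_ [S _]]]] R v tv.
  have [/S//|nv] := boolP (sub2 k r (inl v)).
  have := R v; rewrite !res_side tv nv orbT => /esym/or3P[pv|/andP[]//|h].
    by move: (P _ pv); rewrite tv.
  by move: (D v); rewrite tv nv h => /(_ isT).
by move=> o o' R v; apply/idP/idP; apply: K.
Qed.

Lemma vres_with b t t' u a : okm (choose b t u a) -> okm (choose b t' u a) ->
  forall v, res t (inl v) = res t' (inl v).
Proof.
case: b => -[_ [_ [_ [S1 [S2 [_ [_ D]]]]]]] [_ [_ [_ [S1' [S2' [_ [_ D']]]]]]] v.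
  have := D v; rewrite D'; have [->|//] := eqVneq v (child true a); last by rewrite !andbT.
  by rewrite S2 S2'.
have := D v; rewrite -D'; have [->|//] := eqVneq v (child false a); last by rewrite !andbT.
by rewrite S1 S1'.
Qed.

Lemma rep_context p q : in_context commute p q -> okm p -> okm q ->
  (forall v, res p (inl v) = res q (inl v)) -> exists p' q', rep p q p' q'.
Proof.
elim=> {p q} [p q|r t t' _ IH|r t t' u _ IH|r t u u' _ IH|a t t' u _ IH|a t u u' _ IH] .
- exact: rep_commute.
- move=> op oq E; have [p' [q' h]] := IH (proj1 op) (proj1 oq) (vres_rule1 op oq E).
  by exists (Rule1 r p'), (Rule1 r q'); apply: rep_rule1.
- move=> op oq E; have E' := vres_side (k := false) op oq E.
  apply: (rep_side (k := false)) => //; first by apply: IH => //; [case: op|case: oq].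
  by apply: rep_exists; case: op => _ [].
- move=> op oq E; have E' := vres_side (k := true) op oq E.
  apply: (rep_side (k := true)) => //; first by apply: IH => //; [case: op => _ []|case: oq => _ []].
  by apply: rep_exists; case: op.
- move=> op oq E; have E' := vres_with (b := false) op oq.
  apply: (rep_with (b := false)) => //; first by apply: IH => //; [case: op|case: oq].
  by apply: rep_exists; case: op => _ [].
- move=> op oq E; have E' := vres_with (b := true) op oq.
  apply: (rep_with (b := true)) => //; first by apply: IH => //; [case: op => _ []|case: oq => _ []].
  by apply: rep_exists; case: op.
Qed.

(** * From representatives to translations *)

Lemma aeq_same_proof t u : aeq t u -> okm t -> spec (conclusion G) (fun v => res t (inl v)) ->
  forall (Ht : mall m (conclusion G) t) (Hu : mall m (conclusion G) u),
  same_proof (exist (fun t => mall m (conclusion G) t) t Ht) (exist _ u Hu).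
Proof.
elim=> {t u} [t u [_ [_ [_ c]]]|t|t u e IH|t u v e1 IH1 e2 IH2] o sp Ht Hu.
- by apply: rst_step; right.
- by apply: rst_step; left.
- apply: rst_sym; apply: IH; first by case/aeq_same: e => E _; apply/E.
  by move=> w; rewrite sp (aeq_res _ e).
- have ou := aeq_okm e1 o.
  have sp' : spec (conclusion G) (fun v => res u (inl v)) by move=> w; rewrite sp (aeq_res _ e1).
  have [Hm _] := okm_derivable ou (conclusion_uniq G) (@conclusion_cons G) sp'.
  exact: rst_trans (IH1 o sp Ht Hm) (IH2 ou sp' Hm Hu).
Qed.

Definition cut_list (t : tree) : cuts :=
  undup (pmap (fun x => if x is inr c then Some c else None) [seq x <- resources t | res t x]).

Lemma cut_listP t : functional (fun x => res t (inr x)) -> cut_spec (cut_list t) (res t).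
Proof.
move=> f; have E x : (x \in cut_list t) = res t (inr x).
  rewrite mem_undup mem_pmap; apply/mapP/idP => [[[//|y]]|h].
    by rewrite mem_filter => /andP[h _] [->].
  by exists (inr x) => //; rewrite mem_filter h -footE res_foot.
split=> //; rewrite map_inj_in_uniq ?undup_uniq // => x y.
by rewrite !E; apply: f.
Qed.

Lemma rep_translates (p q : mall_proof m G) p' q' : rep (sval p) (sval q) p' q' ->
  exists O theta, translates p O theta /\ translates q O theta.
Proof.
case: p q => [p hp] [q hq] /= [ep [eq [[np [fp _]] [[nq [fq _]] [R L]]]]].
have [op sp] := mall_okm hp (@conclusion_cons G).
have [oq sq] := mall_okm hq (@conclusion_cons G).
have sp' : spec (conclusion G) (fun v => res p' (inl v)) by move=> w; rewrite sp (aeq_res _ ep).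
have sq' : spec (conclusion G) (fun v => res q' (inl v)) by move=> w; rewrite sq (aeq_res _ eq).
have [mp Sp] := okm_derivable (aeq_okm ep op) (conclusion_uniq G) (@conclusion_cons G) sp'.
have [mq Sq] := okm_derivable (aeq_okm eq oq) (conclusion_uniq G) (@conclusion_cons G) sq'.
have c := cut_listP fp; have c' : cut_spec (cut_list p') (res q').
  by case: c => u E; split=> // x; rewrite E R.
exists (cut_list p'), (linkings p'); split.
- exists (exist _ p' (Sp np _ c)); split=> //.
  exact: aeq_same_proof ep op sp hp _.
- exists (exist _ q' (Sq nq _ c')); split.
    exact: aeq_same_proof eq oq sq hq _.
  by apply/fsetP => l; apply/idP/idP => /L.
Qed.

End Representatives.

Theorem theorem2 (m : bool) (G : seq form) (p q : mall_proof m G) :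
  proof_net_equiv p q <-> commutation_equiv p q.
Proof.
split; elim=> {p q} [p q h|p|p q _|p q r _ + _]; try by [exact: rst_refl|exact: rst_sym|exact: rst_trans].
  by case: h => O [theta [hp hq]]; apply: translates_commutation hp hq.
case: h => h; last first.
  apply: rst_step; have [op sp] := mall_okm (svalP p) (@conclusion_cons G).
  have [oq sq] := mall_okm (svalP q) (@conclusion_cons G).
  have [|p' [q' r]] := rep_context h op oq; first by move=> v; rewrite -sp -sq.
  exact: rep_translates r.
(* The two proofs are the same up to notation, and [translates] is stated up to [same_proof]; a
   translation of [p] is therefore one of [q], and [rep_exists] provides it. *)
apply: rst_step; have [op _] := mall_okm (svalP p) (@conclusion_cons G).
have [p' [p'' r]] := rep_exists op.
have [O [theta [[t [tp tt]] _]]] := rep_translates r.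
exists O, theta; split; exists t; split=> //.
exact: rst_trans (rst_sym _ _ _ _ h) tp.
Qed.
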